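(* Let $\lambda\in\mathbb{C}$ be an arbitrary constant and let $$q(u,v,\tau)=\zeta(v-u,\tau)+\zeta(u,\tau)-g_1(\tau)\,v .$$ Then the brackets $$\{\tau(x),\tau(y)\}=0,\qquad \{\tau(x),e(u,y)\}=2\pi i\, e(u,y)\,\delta'(x-y),$$ $$\{e(u,x),e(v,y)\}=\Big(q(v,u,\tau(x))\,e_u(u,x)e(v,x)+q(u,v,\tau(x))\,e(u,x)e_v(v,x)+\lambda\, e_u(u,x)e_v(v,x)\Big)\delta'(x-y)$$ $$+\Big(q_{\tau}(v,u,\tau(x))\,e_u(u,x)e(v,x)\,\tau'(x)+q_u(v,u,\tau(x))\big(e(u,x)e_x(v,x)-e(v,x)e_x(u,x)\big)$$ $$+q(v,u,\tau(x))\,e_u(u,x)e_x(v,x)+q(u,v,\tau(x))\,e(u,x)e_{vx}(v,x)+\lambda\, e_u(u,x)e_{vx}(v,x)\Big)\delta(x-y)$$ define a Poisson structure on the set of variables $\tau(x),\ e(u,x)$ (that is, they satisfy anticommutativity and the Jacobi identity).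
   Context: Here $x,y$ are loop (space) variables, $\delta$ is the delta function, $\delta'$ its derivative, and $\tau'(x)=\partial_x\tau(x)$. The variable $\tau(x)$ is a field taking values in the upper half-plane $\mathrm{Im}\,\tau>0$; $e(u,x)$ is a field depending on a complex spectral parameter $u$. Subscripts denote partial derivatives, e.g. $e_u(u,x)=\partial_u e(u,x)$, $e_{vx}(v,x)=\partial_v\partial_x e(v,x)$; likewise $q_\tau(v,u,\tau)=\partial_\tau\big(q(v,u,\tau)\big)$ and $q_u(v,u,\tau)=\partial_u\big(q(v,u,\tau)\big)$ (derivative with respect to the variable named $u$, which here stands in the second slot). Brackets of fields are extended to functions of the fields and their derivatives in the usual way for Poisson structures of hydrodynamic type: by bilinearity, the Leibniz rule, and compatibility with differentiation in $x$, $y$ and in the spectral parameters; $\{A(x),B(y)\}$ is understood as a distribution in $x,y$ supported on $x=y$. ''Poisson structure'' means that $\{A(x),B(y)\}=-\{B(y),A(x)\}$ and the Jacobi identity hold for the generators. The coefficients are meromorphic in the spectral parameters; the identities are required whenever the brackets involved are defined (away from poles). Elliptic functions ($\mathrm{Im}\,\tau>0$): $$\zeta(z,\tau)=\frac1z+\sum_{(a,b)\in\mathbb{Z}^2\setminus\{0\}}\Big(\frac{1}{z-a-b\tau}+\frac{1}{a+b\tau}+\frac{z}{(a+b\tau)^2}\Big),$$ $$g_1(\tau)=\frac{\pi^2}{3}-8\pi^2\sum_{m=1}^\infty\frac{m\,\mathbf{q}^m}{1-\mathbf{q}^m},\qquad \mathbf{q}=e^{2\pi i\tau},$$ so that $\zeta(z+1,\tau)=\zeta(z,\tau)+g_1(\tau)$.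 *)

(* Defs.v *)
From Stdlib Require Import Reals ZArith List.
From Coquelicot Require Import Coquelicot.
Import ListNotations.

Open Scope C_scope.

(** * Analysis *)

(** Derivative of a complex-valued function of a real variable; complex
    derivatives are Coquelicot's [C_derive].  Both are total and meaningful
    only where the derivative exists. *)
Definition R_derive (f : R -> C) (x : R) : C :=
  iota (T := C_R_CompleteNormedModule)
    (fun l => is_derive (K := R_AbsRing) (V := C_R_NormedModule) f x l).

Definition C_series (a : nat -> C) : C :=
  iota (T := C_CompleteNormedModule)
    (fun l => is_series (K := C_AbsRing) (V := C_NormedModule) a l).

(** Unordered (absolutely convergent) summation of [f] over the indices
    satisfying [P]. *)
Definition is_usum {T : Type} (P : T -> Prop) (f : T -> C) (l : C) : Prop :=
  forall eps : posreal,
    exists L0 : list T, List.Forall P L0 /\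
      forall L : list T, List.Forall P L -> NoDup L -> incl L0 L ->
        (Cmod (fold_right Cplus 0 (map f L) - l) < eps)%R.

Definition usum {T : Type} (P : T -> Prop) (f : T -> C) : C :=
  iota (T := C_CompleteNormedModule) (is_usum P f).

Definition C_exp (z : C) : C :=
  ((exp (Re z) * cos (Im z))%R, (exp (Re z) * sin (Im z))%R).

Definition int_C (n : Z) : C := RtoC (IZR n).

(** * Elliptic functions *)

Definition zeta (z tau : C) : C :=
  / z +
  usum (fun p : Z * Z => p <> (0%Z, 0%Z))
    (fun p => let w := int_C (fst p) + int_C (snd p) * tau in
       / (z - w) + / w + z / (w * w)).

Definition g1 (tau : C) : C :=
  let qq := C_exp (2 * PI * Ci * tau) in
  PI * PI / 3 -
  8 * (PI * PI) *
    C_series (fun n => INR (S n) * Cpow qq (S n) / (1 - Cpow qq (S n))).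

Definition q (u v tau : C) : C :=
  zeta (v - u) tau + zeta u tau - g1 tau * v.

Definition q_2 (u v tau : C) : C := C_derive (fun w => q u w tau) v.
Definition q_tau (u v tau : C) : C := C_derive (fun t => q u v t) tau.

Definition period_lattice (tau z : C) : Prop :=
  exists a b : Z, z = int_C a + int_C b * tau.

(** * Fields on the loop *)

(** The loop is R/Z: functions on it are 1-periodic functions on R. *)
Definition smooth_loop (f : R -> C) : Prop :=
  (forall x : R, f (x + 1)%R = f x) /\
  exists J : nat -> R -> C,
    (forall x : R, J O x = f x) /\
    (forall n x, is_derive (K := R_AbsRing) (V := C_R_NormedModule)
                   (J n) x (J (S n) x)).

(** A point of the field space, or a tangent vector to it. *)
Record fields := Fields { tau_ : R -> C; e_ : C -> R -> C }.

(** [e] is smooth on [U] x loop and holomorphic in the spectral parameter: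
    [J i k] is the mixed derivative of orders [i] in [u] and [k] in [x]. *)
Definition smooth_spectral (U : C -> Prop) (e : C -> R -> C) : Prop :=
  (forall u x, U u -> e u (x + 1)%R = e u x) /\
  exists J : nat -> nat -> C -> R -> C,
    (forall u x, U u -> J O O u x = e u x) /\
    (forall i k u x, U u ->
       is_derive (K := C_AbsRing) (V := C_NormedModule)
         (fun w => J i k w x) u (J (S i) k u x) /\
       is_derive (K := R_AbsRing) (V := C_R_NormedModule)
         (fun y => J i k u y) x (J i (S k) u x) /\
       continuous (fun p : C * R => J i k (fst p) (snd p)) (u, x)).

(** Only the behaviour of [e] on the spectral domain [U] is constrained. *)
Definition field_point (U : C -> Prop) (F : fields) : Prop :=
  smooth_loop (tau_ F) /\
  (forall x, (0 < Im (tau_ F x))%R) /\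
  smooth_spectral U (e_ F).

Definition shift (F X : fields) (s : C) : fields :=
  Fields (fun x => tau_ F x + s * tau_ X x)
         (fun u x => e_ F u x + s * e_ X u x).

(** * Local brackets *)

Inductive generator := Tau | E (u : C).

(** The distribution [k0 x y * delta (x - y) + k1 x y * delta' (x - y)]. *)
Record kernel := Kernel { k0 : R -> R -> C; k1 : R -> R -> C }.

(** [K (x, y) |-> - K (y, x)], using that [delta] is even and [delta'] odd. *)
Definition skew (K : kernel) : kernel :=
  Kernel (fun x y => - k0 K y x) (fun x y => k1 K y x).

(** The function of [y] obtained by integrating [K (x, y)] against [phi x]. *)
Definition smear (K : kernel) (phi : R -> C) (y : R) : C :=
  k0 K y y * phi y - R_derive (fun x => k1 K x y * phi x) y.

Definition loop_int (f : R -> C) : C :=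
  RInt (V := C_R_CompleteNormedModule) f 0 1.

Definition bracket := generator -> generator -> fields -> kernel.

(** [{A(phi), B(y)}], where [A(phi)] is the integral of [A(x) phi(x)]. *)
Definition gen_bracket (br : bracket) (A B : generator) (phi : R -> C)
    (F : fields) (y : R) : C := smear (br A B F) phi y.

Definition ham_field (br : bracket) (A : generator) (phi : R -> C) (F : fields) : fields :=
  Fields (fun y => gen_bracket br A Tau phi F y)
         (fun u y => gen_bracket br A (E u) phi F y).

(** [{A(phi), G(y)}] for a local function [G] of the fields and of their
    derivatives.  Bilinearity, the Leibniz rule and compatibility with
    differentiation in [y] and in the spectral parameters together say that
    this is the derivative of [G] along the variation
    [B(y) |-> {A(phi), B(y)}] of all generators. *)
Definition ext_bracket (br : bracket) (A : generator) (phi : R -> C)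
    (G : fields -> R -> C) (F : fields) (y : R) : C :=
  C_derive (fun s => G (shift F (ham_field br A phi F) s) y) 0.

(** [{A(x), {B(y), C(z)}}] paired with [a(x) b(y) c(z)]; a distribution on the
    product of loops is determined by its values on such products. *)
Definition double_bracket (br : bracket) (A B C' : generator)
    (a b c : R -> C) (F : fields) : C :=
  loop_int (fun z => c z * ext_bracket br A a (gen_bracket br B C' b) F z).

Definition in_spectral_domain (U : C -> Prop) (A : generator) : Prop :=
  match A with Tau => True | E u => U u end.

(** [dom F A B]: the coefficients of the bracket of [A] and [B] have no pole
    at [F]. *)
Definition anticommutative (br : bracket)
    (dom : fields -> generator -> generator -> Prop) : Prop :=
  forall (U : C -> Prop) (F : fields) (A B : generator) (a b : R -> C),
    open U -> field_point U F ->
    in_spectral_domain U A -> in_spectral_domain U B ->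
    dom F A B ->
    smooth_loop a -> smooth_loop b ->
    loop_int (fun y => b y * gen_bracket br A B a F y) =
    - loop_int (fun x => a x * gen_bracket br B A b F x).

Definition jacobi (br : bracket)
    (dom : fields -> generator -> generator -> Prop) : Prop :=
  forall (U : C -> Prop) (F : fields) (A B C' : generator) (a b c : R -> C),
    open U -> field_point U F ->
    in_spectral_domain U A -> in_spectral_domain U B ->
    in_spectral_domain U C' ->
    dom F A B -> dom F B C' -> dom F C' A ->
    smooth_loop a -> smooth_loop b -> smooth_loop c ->
    double_bracket br A B C' a b c F + double_bracket br B C' A b c a F +
    double_bracket br C' A B c a b F = 0.

Definition poisson_structure (br : bracket)
    (dom : fields -> generator -> generator -> Prop) : Prop :=
  anticommutative br dom /\ jacobi br dom.

(** * The elliptic bracket *)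

Definition e_u (F : fields) (u : C) (x : R) : C :=
  C_derive (fun w => e_ F w x) u.
Definition e_x (F : fields) (u : C) (x : R) : C := R_derive (e_ F u) x.
Definition e_ux (F : fields) (u : C) (x : R) : C :=
  C_derive (fun w => e_x F w x) u.

Definition tau_e_kernel (u : C) (F : fields) : kernel :=
  Kernel (fun _ _ => 0) (fun _ y => 2 * PI * Ci * e_ F u y).

(** In [{e(u,x), e(v,y)}] the name [u] sits in the second slot of
    [q(v,u,tau)], so that [q_u(v,u,tau)] is [q_2 v u tau]. *)
Definition e_e_kernel (lambda u v : C) (F : fields) : kernel :=
  Kernel
    (fun x _ => let t := tau_ F x in
       q_tau v u t * e_u F u x * e_ F v x * R_derive (tau_ F) x
       + q_2 v u t * (e_ F u x * e_x F v x - e_ F v x * e_x F u x)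
       + q v u t * e_u F u x * e_x F v x
       + q u v t * e_ F u x * e_ux F v x
       + lambda * e_u F u x * e_ux F v x)
    (fun x _ => let t := tau_ F x in
       q v u t * e_u F u x * e_ F v x
       + q u v t * e_ F u x * e_u F v x
       + lambda * e_u F u x * e_u F v x).

(** The bracket [{e(u,x), tau(y)}] is the one forced by anticommutativity. *)
Definition elliptic_bracket (lambda : C) : bracket := fun A B F =>
  match A, B with
  | Tau, Tau => Kernel (fun _ _ => 0) (fun _ _ => 0)
  | Tau, E u => tau_e_kernel u F
  | E u, Tau => skew (tau_e_kernel u F)
  | E u, E v => e_e_kernel lambda u v F
  end.

Definition away_from_poles (F : fields) (A B : generator) : Prop :=
  match A, B with
  | E u, E v =>
      forall x : R,
        ~ period_lattice (tau_ F x) u /\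
        ~ period_lattice (tau_ F x) v /\
        ~ period_lattice (tau_ F x) (u - v)
  | _, _ => True
  end.

(* Main.v *)
Require Import Defs.
From Stdlib Require Import Reals ZArith List Lra Lia Psatz Permutation FunctionalExtensionality.
From Stdlib Require Import Ring_theory EnvRing.
From Coquelicot Require Import Coquelicot.
Import ListNotations.
Open Scope C_scope.

(** Why the theorem holds.

    The coefficients.  The combination zeta (z) - g1 z has period 1, and it is
    the sum of the cotangents pi cot (pi (z + n tau)) over the integers n: the
    logarithmic derivative of the odd theta function, written [Rho 0 0] below
    ([zeta_Rho_g1]).  So the linear terms of q cancel,
    q (u, v) = rho (v - u) + rho (u) ([q_Rho]), and all coefficients of the
    bracket are values of one odd function and of its derivatives [Rho i k], of
    order i in z and k in tau.  Besides parity the Jacobi identity uses one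
    property of rho, the addition theorem [Rho_addition]

      2 pi i (d_tau rho (x) - d_tau rho (y))
        = rho' (x) (rho (x+y) - rho (y)) + rho' (y) (rho (x) - rho (x+y)).

    It says that an absolutely convergent double series can be summed in either
    order.  The product cot' (x) (cot (x+y) - cot (y)) is symmetric in x and y.
    Take it at x + l tau and y + m tau.  The sum over m of the second factor is
    rho (x + y + l tau) - rho (y) = rho (x+y) - rho (y) - 2 pi i l, and the sum
    over l then gives rho' (x) (rho (x+y) - rho (y)) - 2 pi i d_tau rho (x).
    Summation in the other order exchanges x and y.

    The brackets.  At a given point of the field space everything in the
    statement is a polynomial in the jets of the fields, in the test functions
    and their derivatives, and in the values of the functions [Rho i k]: a
    differential polynomial ([dpoly]).  Derivatives along the loop, in a spectral
    parameter, and along a Hamiltonian vector field are formal derivations of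
    such polynomials (the chain rule [D_den]; [gen_bracket_den] and
    [ext_bracket_den] for the brackets).  Hence the three double brackets of the
    Jacobi identity are the integral over the loop of a differential polynomial,
    the [jacobiator], and the integral of a total derivative vanishes
    ([loop_int_exact]).  The same holds for anticommutativity.

    The identities.  If one of the three generators is tau, the Jacobiator is
    formally a total derivative.  For three generators e (u), e (v), e (w), with
    test functions a, b, c, it is

      d_x H + sum over cyclic permutations of
                c (d_w e (w) d_x O - d_x e (w) d_w O),

    where O, the [obstruction] of the first two generators and the third
    spectral parameter, is a linear combination of instances of the addition
    theorem and of a consequence of it ([cyclic_split]).  As O vanishes for all
    values of its arguments, so do its derivatives ([jacobians_zero]), and a
    total derivative is left.  These formal identities between large polynomials
    are decided by computing normal forms ([identical]). *)

(** * Derivatives *)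

(** The derivative of [f] with respect to [i].  With the identity of C and with
    the embedding of R in C as [i] this covers complex derivatives and
    derivatives along the loop, so that the rules of calculus are proved once. *)
Definition D_at {T : Type} (i : T -> C) (f : T -> C) (x : T) (l : C) : Prop :=
  forall eps : R, (0 < eps)%R -> exists del : R, (0 < del)%R /\
    forall y : T, (Cmod (i y - i x) < del)%R ->
      (Cmod (f y - f x - (i y - i x) * l) <= eps * Cmod (i y - i x))%R.

Notation DC := (D_at (fun z : C => z)).
Notation DR := (D_at RtoC).

Lemma Cmod_tri3 (a b c : C) : (Cmod (a + b + c) <= Cmod a + Cmod b + Cmod c)%R.
Proof.
  eapply Rle_trans; [apply Cmod_triangle|].
  apply Rplus_le_compat_r, Cmod_triangle.
Qed.

Lemma Cmod_sub_sym (a b : C) : Cmod (a - b) = Cmod (b - a).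
Proof. rewrite <- (Cmod_opp (a - b)). f_equal; ring. Qed.

Lemma Cmod_sub_triangle (a b : C) : (Cmod a - Cmod b <= Cmod (a - b))%R.
Proof.
  pose proof (Cmod_triangle (a - b) b) as H.
  replace (a - b + b) with a in H by ring. lra.
Qed.

Section Derivative.
Context {T : Type} (i : T -> C).
Implicit Types (f g : T -> C) (x : T).

Lemma D_at_const (c : C) x : D_at i (fun _ => c) x 0.
Proof.
  intros eps He; exists 1%R; split; [lra|]; intros y _.
  replace (c - c - (i y - i x) * 0) with (RtoC 0) by ring.
  rewrite Cmod_0. pose proof (Cmod_ge_0 (i y - i x)); nra.
Qed.

Lemma D_at_id x : D_at i i x 1.
Proof.
  intros eps He; exists 1%R; split; [lra|]; intros y _.
  replace (i y - i x - (i y - i x) * 1) with (RtoC 0) by ring.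
  rewrite Cmod_0. pose proof (Cmod_ge_0 (i y - i x)); nra.
Qed.

(** Also gives [f x = g x], as the point itself is within every distance. *)
Lemma D_at_ext_loc f g x (l : C) (d : R) : (0 < d)%R ->
  (forall y, (Cmod (i y - i x) < d)%R -> f y = g y) ->
  D_at i f x l -> D_at i g x l.
Proof.
  intros Hd E H eps He. destruct (H eps He) as [del [Hdel K]].
  exists (Rmin d del); split; [apply Rmin_pos; lra|]. intros y Hy.
  pose proof (Rmin_l d del); pose proof (Rmin_r d del).
  rewrite <- !E; [apply K; lra| |lra].
  replace (i x - i x) with (RtoC 0) by ring. rewrite Cmod_0; lra.
Qed.

Lemma D_at_ext f g x (l : C) :
  (forall y, f y = g y) -> D_at i f x l -> D_at i g x l.
Proof. intros E; apply D_at_ext_loc with (d := 1%R); [lra|auto]. Qed.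

Lemma D_at_val f x (l l' : C) : D_at i f x l -> l = l' -> D_at i f x l'.
Proof. intros H <-; exact H. Qed.

Lemma D_at_plus f g x (a b : C) :
  D_at i f x a -> D_at i g x b -> D_at i (fun y => f y + g y) x (a + b).
Proof.
  intros Hf Hg eps He.
  destruct (Hf (eps / 2)%R ltac:(lra)) as [d1 [Hd1 K1]].
  destruct (Hg (eps / 2)%R ltac:(lra)) as [d2 [Hd2 K2]].
  exists (Rmin d1 d2); split; [apply Rmin_pos; lra|]. intros y Hy.
  pose proof (Rmin_l d1 d2); pose proof (Rmin_r d1 d2).
  specialize (K1 y ltac:(lra)); specialize (K2 y ltac:(lra)).
  replace (f y + g y - (f x + g x) - (i y - i x) * (a + b)) with
    ((f y - f x - (i y - i x) * a) + (g y - g x - (i y - i x) * b)) by ring.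
  eapply Rle_trans; [apply Cmod_triangle|]. lra.
Qed.

Lemma D_at_loc_lipschitz f x (l : C) : D_at i f x l ->
  exists d : R, (0 < d)%R /\ forall y, (Cmod (i y - i x) < d)%R ->
    (Cmod (f y - f x) <= (Cmod l + 1) * Cmod (i y - i x))%R.
Proof.
  intros H. destruct (H 1%R Rlt_0_1) as [d [Hd K]].
  exists d; split; [exact Hd|]. intros y Hy. specialize (K y Hy).
  replace (f y - f x) with
    ((f y - f x - (i y - i x) * l) + (i y - i x) * l) by ring.
  eapply Rle_trans; [apply Cmod_triangle|]. rewrite Cmod_mult. lra.
Qed.

Lemma D_at_cont f x (l : C) : D_at i f x l ->
  forall eps : R, (0 < eps)%R -> exists d : R, (0 < d)%R /\
    forall y, (Cmod (i y - i x) < d)%R -> (Cmod (f y - f x) < eps)%R.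
Proof.
  intros H eps He. destruct (D_at_loc_lipschitz f x l H) as [d [Hd K]].
  pose proof (Cmod_ge_0 l) as Hl.
  assert (Hp : (0 < eps / (Cmod l + 1))%R) by (apply Rdiv_lt_0_compat; lra).
  exists (Rmin d (eps / (Cmod l + 1))); split.
  { apply Rmin_pos; lra. }
  intros y Hy.
  pose proof (Rmin_l d (eps / (Cmod l + 1)));
  pose proof (Rmin_r d (eps / (Cmod l + 1))).
  eapply Rle_lt_trans; [apply K; lra|].
  replace eps with ((Cmod l + 1) * (eps / (Cmod l + 1)))%R by (field; lra).
  apply Rmult_lt_compat_l; lra.
Qed.

Lemma D_at_mult f g x (a b : C) :
  D_at i f x a -> D_at i g x b ->
  D_at i (fun y => f y * g y) x (a * g x + f x * b).
Proof.
  intros Hf Hg eps He.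
  destruct (D_at_loc_lipschitz f x a Hf) as [d0 [Hd0 K0]].
  pose proof (Cmod_ge_0 a) as Ha. pose proof (Cmod_ge_0 (f x)) as Hfx.
  pose proof (Cmod_ge_0 (g x)) as Hgx.
  set (e1 := (eps / 3 / (Cmod (g x) + 1))%R).
  set (e2 := (eps / 3 / (Cmod (f x) + 1))%R).
  set (e3 := (eps / 3 / (Cmod a + 1))%R).
  assert (He1 : (0 < e1)%R) by (unfold e1; repeat apply Rdiv_lt_0_compat; lra).
  assert (He2 : (0 < e2)%R) by (unfold e2; repeat apply Rdiv_lt_0_compat; lra).
  assert (He3 : (0 < e3)%R) by (unfold e3; repeat apply Rdiv_lt_0_compat; lra).
  destruct (Hf e1 He1) as [d1 [Hd1 K1]].
  destruct (Hg e2 He2) as [d2 [Hd2 K2]].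
  destruct (D_at_cont g x b Hg e3 He3) as [d3 [Hd3 K3]].
  exists (Rmin (Rmin d0 d1) (Rmin d2 d3)); split.
  { repeat apply Rmin_pos; lra. }
  intros y Hy.
  pose proof (Rmin_l (Rmin d0 d1) (Rmin d2 d3));
  pose proof (Rmin_r (Rmin d0 d1) (Rmin d2 d3)).
  pose proof (Rmin_l d0 d1); pose proof (Rmin_r d0 d1).
  pose proof (Rmin_l d2 d3); pose proof (Rmin_r d2 d3).
  specialize (K0 y ltac:(lra)); specialize (K1 y ltac:(lra));
  specialize (K2 y ltac:(lra)); specialize (K3 y ltac:(lra)).
  replace (f y * g y - f x * g x - (i y - i x) * (a * g x + f x * b)) with
    ((f y - f x - (i y - i x) * a) * g x
     + f x * (g y - g x - (i y - i x) * b)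
     + (f y - f x) * (g y - g x)) by ring.
  eapply Rle_trans; [apply Cmod_tri3|]. rewrite !Cmod_mult.
  pose proof (Cmod_ge_0 (i y - i x)) as Hh.
  set (h := Cmod (i y - i x)) in *.
  assert (A1 : (e1 * Cmod (g x) <= eps / 3)%R).
  { replace (eps / 3)%R with (e1 * (Cmod (g x) + 1))%R by (unfold e1; field; lra).
    apply Rmult_le_compat_l; lra. }
  assert (A2 : (e2 * Cmod (f x) <= eps / 3)%R).
  { replace (eps / 3)%R with (e2 * (Cmod (f x) + 1))%R by (unfold e2; field; lra).
    apply Rmult_le_compat_l; lra. }
  assert (A3 : ((Cmod a + 1) * e3 = eps / 3)%R) by (unfold e3; field; lra).
  assert (B1 : (Cmod (f y - f x - (i y - i x) * a) * Cmod (g x) <= eps / 3 * h)%R).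
  { eapply Rle_trans; [apply Rmult_le_compat_r; [lra|exact K1]|]. nra. }
  assert (B2 : (Cmod (f x) * Cmod (g y - g x - (i y - i x) * b) <= eps / 3 * h)%R).
  { eapply Rle_trans; [apply Rmult_le_compat_l; [lra|exact K2]|]. nra. }
  assert (B3 : (Cmod (f y - f x) * Cmod (g y - g x) <= eps / 3 * h)%R).
  { eapply Rle_trans.
    - apply Rmult_le_compat; [apply Cmod_ge_0|apply Cmod_ge_0|exact K0|left; exact K3].
    - rewrite <- A3. right; ring. }
  lra.
Qed.

Lemma D_at_comp (g : C -> C) f x (a b : C) :
  DC g (f x) b -> D_at i f x a -> D_at i (fun y => g (f y)) x (a * b).
Proof.
  intros Hg Hf eps He.
  destruct (D_at_loc_lipschitz f x a Hf) as [d0 [Hd0 K0]].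
  pose proof (Cmod_ge_0 a) as Ha. pose proof (Cmod_ge_0 b) as Hb.
  set (e1 := (eps / 2 / (Cmod a + 1))%R).
  set (e2 := (eps / 2 / (Cmod b + 1))%R).
  assert (He1 : (0 < e1)%R) by (unfold e1; repeat apply Rdiv_lt_0_compat; lra).
  assert (He2 : (0 < e2)%R) by (unfold e2; repeat apply Rdiv_lt_0_compat; lra).
  destruct (Hg e1 He1) as [dg [Hdg Kg]].
  destruct (D_at_cont f x a Hf dg Hdg) as [d1 [Hd1 K1]].
  destruct (Hf e2 He2) as [d2 [Hd2 K2]].
  exists (Rmin d0 (Rmin d1 d2)); split.
  { repeat apply Rmin_pos; lra. }
  intros y Hy.
  pose proof (Rmin_l d0 (Rmin d1 d2)); pose proof (Rmin_r d0 (Rmin d1 d2)).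
  pose proof (Rmin_l d1 d2); pose proof (Rmin_r d1 d2).
  specialize (K0 y ltac:(lra)); specialize (K1 y ltac:(lra));
  specialize (K2 y ltac:(lra)); specialize (Kg (f y) K1).
  replace (g (f y) - g (f x) - (i y - i x) * (a * b)) with
    ((g (f y) - g (f x) - (f y - f x) * b)
     + (f y - f x - (i y - i x) * a) * b) by ring.
  eapply Rle_trans; [apply Cmod_triangle|]. rewrite Cmod_mult.
  pose proof (Cmod_ge_0 (i y - i x)) as Hh.
  set (h := Cmod (i y - i x)) in *.
  assert (A1 : (e1 * (Cmod a + 1) = eps / 2)%R) by (unfold e1; field; lra).
  assert (A2 : (e2 * Cmod b <= eps / 2)%R).
  { replace (eps / 2)%R with (e2 * (Cmod b + 1))%R by (unfold e2; field; lra).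
    apply Rmult_le_compat_l; lra. }
  assert (B1 : (e1 * Cmod (f y - f x) <= eps / 2 * h)%R).
  { rewrite <- A1. rewrite Rmult_assoc. apply Rmult_le_compat_l; lra. }
  assert (B2 : (Cmod (f y - f x - (i y - i x) * a) * Cmod b <= eps / 2 * h)%R).
  { eapply Rle_trans; [apply Rmult_le_compat_r; [lra|exact K2]|]. nra. }
  lra.
Qed.

Lemma D_at_opp f x (a : C) : D_at i f x a -> D_at i (fun y => - f y) x (- a).
Proof.
  intros H.
  apply D_at_ext with (f := fun y => (- (1)) * f y); [intros; ring|].
  eapply D_at_val; [apply D_at_mult; [apply D_at_const|exact H]|]. cbv beta; ring.
Qed.

Lemma D_at_minus f g x (a b : C) :
  D_at i f x a -> D_at i g x b -> D_at i (fun y => f y - g y) x (a - b).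
Proof. intros Hf Hg. apply D_at_plus; [exact Hf|apply D_at_opp; exact Hg]. Qed.

Lemma D_at_scal (c : C) f x (a : C) :
  D_at i f x a -> D_at i (fun y => c * f y) x (c * a).
Proof.
  intros H. eapply D_at_val; [apply D_at_mult; [apply D_at_const|exact H]|]. cbv beta; ring.
Qed.

End Derivative.

Lemma D_at_inv (z : C) : z <> 0 -> DC Cinv z (- / (z * z)).
Proof.
  intros Hz eps He.
  pose proof (proj1 (Cmod_gt_0 z) Hz) as Hm. set (m := Cmod z) in *.
  exists (Rmin (m / 2) (eps * (m * m * m) / 2)). split.
  { apply Rmin_pos; [lra|]. apply Rdiv_lt_0_compat; [|lra].
    repeat apply Rmult_lt_0_compat; lra. }
  intros y Hy.
  pose proof (Rmin_l (m / 2) (eps * (m * m * m) / 2));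
  pose proof (Rmin_r (m / 2) (eps * (m * m * m) / 2)).
  assert (Hym : (m / 2 < Cmod y)%R).
  { pose proof (Cmod_sub_triangle z y). rewrite Cmod_sub_sym in H1. fold m in H1. lra. }
  assert (Hy0 : y <> 0) by (apply Cmod_gt_0; lra).
  replace (/ y - / z - (y - z) * (- / (z * z))) with ((y - z) * ((y - z) / (y * (z * z))))
    by (field; auto).
  rewrite Cmod_mult, Rmult_comm. apply Rmult_le_compat_r; [apply Cmod_ge_0|].
  rewrite Cmod_div, !Cmod_mult by (repeat apply Cmult_neq_0; auto). fold m.
  apply Rle_div_l.
  { apply Rmult_gt_0_compat; [lra|apply Rmult_gt_0_compat; lra]. }
  assert (eps * (m * m * m) / 2 <= eps * (Cmod y * (m * m)))%R; [|lra].
  replace (eps * (m * m * m) / 2)%R with (eps * (m / 2 * (m * m)))%R by field.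
  apply Rmult_le_compat_l; [lra|]. apply Rmult_le_compat_r; nra.
Qed.

Lemma locally_C_Cmod (P : C -> Prop) (z : C) :
  @locally C_UniformSpace z P <->
  exists d : R, (0 < d)%R /\ forall w, (Cmod (w - z) < d)%R -> P w.
Proof.
  split.
  - intros [d Hd]. exists d; split; [apply cond_pos|]. intros w Hw. apply Hd.
    apply C_NormedModule_mixin_compat1. exact Hw.
  - intros [d [Hd H]].
    assert (Hs : (0 < sqrt 2)%R) by (apply sqrt_lt_R0; lra).
    assert (Hp : (0 < d / sqrt 2)%R) by (apply Rdiv_lt_0_compat; lra).
    exists (mkposreal _ Hp). intros w Hw. apply H.
    eapply Rlt_le_trans; [apply (C_NormedModule_mixin_compat2 z w _ Hw)|].
    simpl. right; field; lra.
Qed.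

(** The two uniform structures on C, products of real balls and balls of
    [Cmod], have the same neighbourhoods. *)
Lemma locally_AbsRing_C (P : C -> Prop) (z : C) :
  @locally (AbsRing_UniformSpace C_AbsRing) z P <-> @locally C_UniformSpace z P.
Proof.
  rewrite locally_C_Cmod. split.
  - intros [d Hd]. exists d; split; [apply cond_pos|]. intros w Hw. apply Hd. exact Hw.
  - intros [d [Hd H]]. exists (mkposreal d Hd). intros w Hw. apply H. exact Hw.
Qed.

Lemma is_derive_DC (f : C -> C) (z l : C) :
  is_derive (K := C_AbsRing) (V := C_NormedModule) f z l <-> DC f z l.
Proof.
  split.
  - intros [_ H] eps He.
    specialize (H z (fun P HP => HP) (mkposreal eps He)).
    apply locally_AbsRing_C, locally_C_Cmod in H. destruct H as [d [Hd H]].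
    exists d; split; [exact Hd|]. intros y Hy. exact (H y Hy).
  - intros H. split; [apply is_linear_scal_l|].
    intros x Hx.
    apply (is_filter_lim_locally_unique (K := C_AbsRing)
             (V := AbsRing_NormedModule C_AbsRing)) in Hx. subst x.
    intros eps. destruct (H eps (cond_pos eps)) as [d [Hd K]].
    apply locally_AbsRing_C, locally_C_Cmod.
    exists d; split; [exact Hd|]. intros y Hy. exact (K y Hy).
Qed.

Lemma Cmod_RtoC_minus (x y : R) : Cmod (RtoC x - RtoC y) = Rabs (x - y).
Proof. rewrite <- RtoC_minus. apply Cmod_R. Qed.

Lemma locally_R_Rabs (P : R -> Prop) (x : R) :
  locally x P <-> exists d : R, (0 < d)%R /\ forall y, (Rabs (y - x) < d)%R -> P y.
Proof.
  split.
  - intros [d Hd]. exists d; split; [apply cond_pos|]. exact Hd.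
  - intros [d [Hd H]]. exists (mkposreal d Hd). exact H.
Qed.

Lemma norm_R_Cmod (v : C) : @norm R_AbsRing C_R_NormedModule v = Cmod v.
Proof.
  unfold Cmod. change (sqrt (Rabs (fst v) ^ 2 + Rabs (snd v) ^ 2) = sqrt (fst v ^ 2 + snd v ^ 2))%R.
  now rewrite !pow2_abs.
Qed.

Lemma is_derive_DR (f : R -> C) (x : R) (l : C) :
  is_derive (K := R_AbsRing) (V := C_R_NormedModule) f x l <-> DR f x l.
Proof.
  assert (E : forall y, minus (minus (f y) (f x))
            (@scal R_AbsRing C_R_NormedModule (minus y x) l)
            = f y - f x - (RtoC y - RtoC x) * l).
  { intros y. rewrite <- RtoC_minus. rewrite <- scal_R_Cmult. reflexivity. }
  split.
  - intros [_ H] eps He.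
    specialize (H x (fun P HP => HP) (mkposreal eps He)).
    apply locally_R_Rabs in H. destruct H as [d [Hd H]].
    exists d; split; [exact Hd|]. intros y Hy. rewrite Cmod_RtoC_minus in Hy |- *.
    rewrite <- norm_R_Cmod, <- E. exact (H y Hy).
  - intros H. split; [apply is_linear_scal_l|].
    intros x' Hx. apply (is_filter_lim_locally_unique (K := R_AbsRing)
             (V := AbsRing_NormedModule R_AbsRing)) in Hx. subst x'.
    intros eps. destruct (H eps (cond_pos eps)) as [d [Hd K]].
    apply locally_R_Rabs. exists d; split; [exact Hd|]. intros y Hy.
    specialize (K y). rewrite Cmod_RtoC_minus, <- norm_R_Cmod, <- E in K. exact (K Hy).
Qed.

Lemma DC_unique (f : C -> C) (z l : C) : DC f z l -> C_derive f z = l.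
Proof. intros H. apply is_C_derive_unique, is_derive_DC, H. Qed.

(** [R_derive] is a definite description, so it has the value [l] only if no
    other derivative exists: two of them are compared at one nearby point. *)
Lemma DR_unique (f : R -> C) (x : R) (l : C) : DR f x l -> R_derive f x = l.
Proof.
  intros H. apply (iota_unique (V := C_R_CompleteNormedModule)).
  - intros y Hy. apply is_derive_DR in Hy.
    destruct (Ceq_dec y l) as [E|N]; [exact E|exfalso].
    assert (Hn : (0 < Cmod (y - l))%R).
    { apply Cmod_gt_0. intros E; apply N. replace y with (y - l + l) by ring.
      rewrite E; ring. }
    set (e := (Cmod (y - l) / 4)%R).
    destruct (H e ltac:(unfold e; lra)) as [d1 [Hd1 K1]].
    destruct (Hy e ltac:(unfold e; lra)) as [d2 [Hd2 K2]].
    set (h := (Rmin d1 d2 / 2)%R).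
    assert (Hh : (0 < h)%R) by (unfold h; pose proof (Rmin_pos d1 d2 Hd1 Hd2); lra).
    specialize (K1 (x + h)%R); specialize (K2 (x + h)%R).
    rewrite Cmod_RtoC_minus in K1, K2.
    replace (x + h - x)%R with h in K1, K2 by ring.
    rewrite (Rabs_pos_eq h) in K1, K2 by lra.
    pose proof (Rmin_l d1 d2); pose proof (Rmin_r d1 d2).
    specialize (K1 ltac:(unfold h in *; lra)); specialize (K2 ltac:(unfold h in *; lra)).
    assert (B : (Cmod (RtoC h * (y - l)) <= 2 * e * h)%R).
    { replace (RtoC h * (y - l)) with
        ((f (x + h)%R - f x - (RtoC (x + h) - RtoC x) * l)
         + - (f (x + h)%R - f x - (RtoC (x + h) - RtoC x) * y))
        by (rewrite RtoC_plus; ring).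
      eapply Rle_trans; [apply Cmod_triangle|]. rewrite Cmod_opp. lra. }
    rewrite Cmod_mult, Cmod_R, (Rabs_pos_eq h) in B by lra.
    unfold e in B. nra.
  - apply is_derive_DR, H.
Qed.

(** * Mean value inequality *)

Lemma DR_Re (f : R -> C) (x : R) (l : C) :
  DR f x l -> is_derive (fun t => Re (f t)) x (Re l).
Proof.
  intros H. split; [apply is_linear_scal_l|].
  intros x' Hx. apply (is_filter_lim_locally_unique (K := R_AbsRing)
             (V := AbsRing_NormedModule R_AbsRing)) in Hx. subst x'.
  intros eps. destruct (H eps (cond_pos eps)) as [d [Hd K]].
  apply locally_R_Rabs. exists d; split; [exact Hd|]. intros y Hy.
  specialize (K y). rewrite Cmod_RtoC_minus in K. specialize (K Hy).
  eapply Rle_trans; [|exact K].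
  eapply Rle_trans; [|apply re_le_Cmod]. right.
  change (Rabs (Re (f y) - Re (f x) - (y - x) * Re l) =
    Rabs (Re (f y - f x - (RtoC y - RtoC x) * l))).
  f_equal. unfold Re. simpl. ring.
Qed.

Lemma Im_rotation (z : C) : Im z = Re (- Ci * z).
Proof. unfold Re, Im. simpl. ring. Qed.

(** The constant 2 comes from estimating the real and the imaginary part
    separately by the mean value theorem of real functions. *)
Lemma mean_value_inequality (f g : C -> C) (z w : C) (M : R) :
  (forall y, (Cmod (y - z) <= Cmod (w - z))%R -> DC f y (g y) /\ (Cmod (g y) <= M)%R) ->
  (Cmod (f w - f z) <= 2 * M * Cmod (w - z))%R.
Proof.
  intros H.
  set (p := fun t : R => z + t * (w - z)).
  assert (Hp : forall t, (Rabs (t - 0) <= Rabs (1 - 0))%R ->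
            (Cmod (p t - z) <= Cmod (w - z))%R).
  { intros t Ht. rewrite Rminus_0_r, (Rabs_pos_eq (1 - 0)) in Ht by lra.
    unfold p. replace (z + t * (w - z) - z) with (t * (w - z)) by ring.
    rewrite Cmod_mult, Cmod_R. pose proof (Cmod_ge_0 (w - z)). nra. }
  assert (Dp : forall t, DR p t (w - z)).
  { intros t. eapply D_at_val.
    - apply D_at_plus; [apply D_at_const|].
      apply D_at_mult; [apply D_at_id|apply D_at_const].
    - cbv beta. ring. }
  assert (Df : forall c t, (Rabs (t - 0) <= Rabs (1 - 0))%R ->
            DR (fun t => c * f (p t)) t (c * ((w - z) * g (p t)))).
  { intros c t Ht. apply D_at_scal.
    apply D_at_comp; [apply H, Hp, Ht|apply Dp]. }
  assert (M0 : (0 <= M)%R).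
  { destruct (H z) as [_ Hz].
    { replace (z - z) with (RtoC 0) by ring. rewrite Cmod_0. apply Cmod_ge_0. }
    pose proof (Cmod_ge_0 (g z)); lra. }
  assert (B : forall c, Cmod c = 1%R ->
            (Rabs (Re (c * (f w - f z))) <= M * Cmod (w - z))%R).
  { intros c Hc.
    pose proof (bounded_variation (fun t => Re (c * f (p t)))
      (fun t => Re (c * ((w - z) * g (p t)))) (M * Cmod (w - z)) 0 1) as V.
    cbv beta in V.
    replace (p 1%R) with w in V by (unfold p; ring).
    replace (p 0%R) with z in V by (unfold p; ring).
    rewrite Rminus_0_r, Rabs_R1, Rmult_1_r in V.
    replace (Re (c * (f w - f z))) with (Re (c * f w) - Re (c * f z))%R
      by (unfold Re; simpl; ring).
    apply V. intros t Ht. split.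
    - apply (DR_Re (fun t => c * f (p t))), Df. rewrite (Rminus_0_r 1), Rabs_R1; exact Ht.
    - eapply Rle_trans; [apply re_le_Cmod|]. rewrite !Cmod_mult, Hc, Rmult_1_l, Rmult_comm.
      apply Rmult_le_compat_r; [apply Cmod_ge_0|]. apply H, Hp.
      rewrite (Rminus_0_r 1), Rabs_R1; exact Ht. }
  pose proof (B 1 Cmod_1) as B1.
  pose proof (B (- Ci) ltac:(rewrite Cmod_opp; apply Cmod_Ci)) as B2.
  rewrite <- Im_rotation in B2. rewrite Cmult_1_l in B1.
  eapply Rle_trans with (Rabs (Re (f w - f z)) + Rabs (Im (f w - f z)))%R.
  - set (v := f w - f z). pose proof (Cmod2_alt v) as E.
    pose proof (Cmod_ge_0 v). pose proof (Rabs_pos (Re v)); pose proof (Rabs_pos (Im v)).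
    rewrite <- (pow2_abs (Re v)), <- (pow2_abs (Im v)) in E. nra.
  - lra.
Qed.

(** The mean value inequality for the first derivative and then for the
    remainder. *)
Lemma taylor_quadratic (f g h : C -> C) (z w : C) (M : R) :
  (forall y, (Cmod (y - z) <= Cmod (w - z))%R ->
     DC f y (g y) /\ DC g y (h y) /\ (Cmod (h y) <= M)%R) ->
  (Cmod (f w - f z - (w - z) * g z) <= 4 * M * (Cmod (w - z) * Cmod (w - z)))%R.
Proof.
  intros H.
  assert (G : forall y, (Cmod (y - z) <= Cmod (w - z))%R ->
            (Cmod (g y - g z) <= 2 * M * Cmod (w - z))%R).
  { intros y Hy. eapply Rle_trans.
    - apply (mean_value_inequality g h z y M). intros x Hx.
      destruct (H x ltac:(lra)) as [_ [A B]]. auto.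
    - destruct (H y Hy) as [_ [_ B]]. pose proof (Cmod_ge_0 (h y)).
      apply Rmult_le_compat_l; lra. }
  pose proof (mean_value_inequality (fun y => f y - (y - z) * g z)
    (fun y => g y - g z) z w (2 * M * Cmod (w - z))) as V.
  cbv beta in V.
  replace (f w - f z - (w - z) * g z) with
    (f w - (w - z) * g z - (f z - (z - z) * g z)) by ring.
  eapply Rle_trans; [apply V|right; ring].
  intros y Hy. split; [|apply G, Hy].
  destruct (H y Hy) as [A _].
  eapply D_at_val.
  - apply D_at_minus; [exact A|]. apply D_at_mult; [|apply D_at_const].
    apply D_at_minus; [apply D_at_id|apply D_at_const].
  - cbv beta. ring.
Qed.

(** * Integrals over the loop *)

Lemma DR_continuous (f : R -> C) (x : R) (l : C) : DR f x l ->
  continuous (U := C_R_CompleteNormedModule) f x.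
Proof.
  intros H. apply (ex_derive_continuous (K := R_AbsRing) (V := C_R_NormedModule)).
  exists l. apply is_derive_DR, H.
Qed.

Lemma loop_int_ext (f g : R -> C) : (forall x, f x = g x) -> loop_int f = loop_int g.
Proof. intros E. unfold loop_int. apply (RInt_ext (V := C_R_CompleteNormedModule)). intros x _. apply E. Qed.

Lemma loop_int_plus (f g : R -> C) :
  (forall x, exists l, DR f x l) -> (forall x, exists l, DR g x l) ->
  loop_int (fun x => f x + g x) = loop_int f + loop_int g.
Proof.
  intros Hf Hg. apply (RInt_plus (V := C_R_CompleteNormedModule)).
  - apply ex_RInt_continuous. intros x _. destruct (Hf x) as [l H].
    exact (DR_continuous f x l H).
  - apply ex_RInt_continuous. intros x _. destruct (Hg x) as [l H].
    exact (DR_continuous g x l H).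
Qed.

(** Integration by parts on the loop: there are no boundary terms. *)
Lemma loop_int_derivative (H h : R -> C) :
  (forall x, DR H x (h x)) -> (forall x, exists l, DR h x l) ->
  H 1%R = H 0%R -> loop_int h = 0.
Proof.
  intros D C E.
  apply (is_RInt_unique (V := C_R_CompleteNormedModule)).
  replace (RtoC 0) with (@minus C_R_CompleteNormedModule (H 1%R) (H 0%R)).
  - apply (is_RInt_derive (V := C_R_CompleteNormedModule)).
    + intros x _. apply is_derive_DR, D.
    + intros x _. destruct (C x) as [l Hl]. exact (DR_continuous h x l Hl).
  - rewrite E. apply (minus_eq_zero (G := C_R_CompleteNormedModule)).
Qed.

(** * Limits of complex sequences *)

Definition Clim (u : nat -> C) (l : C) : Prop :=
  forall eps : R, (0 < eps)%R -> exists N : nat, forall n : nat, (N <= n)%nat ->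
    (Cmod (u n - l) < eps)%R.

Lemma Cmod_small_eq (a b : C) :
  (forall eps : R, (0 < eps)%R -> (Cmod (a - b) < eps)%R) -> a = b.
Proof.
  intros H. replace a with (a - b + b) by ring.
  rewrite (Cmod_eq_0 (a - b)); [ring|].
  destruct (Cmod_ge_0 (a - b)) as [P|P]; [|lra].
  specialize (H (Cmod (a - b)) P). lra.
Qed.

Lemma Clim_unique u l l' : Clim u l -> Clim u l' -> l = l'.
Proof.
  intros H H'. apply Cmod_small_eq. intros eps He.
  destruct (H (eps / 2)%R ltac:(lra)) as [N K].
  destruct (H' (eps / 2)%R ltac:(lra)) as [N' K'].
  specialize (K (N + N')%nat ltac:(lia)); specialize (K' (N + N')%nat ltac:(lia)).
  replace (l - l') with (- (u (N + N')%nat - l) + (u (N + N')%nat - l')) by ring.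
  eapply Rle_lt_trans; [apply Cmod_triangle|]. rewrite Cmod_opp. lra.
Qed.

Lemma Clim_const l : Clim (fun _ => l) l.
Proof.
  intros eps He; exists O; intros n _. replace (l - l) with (RtoC 0) by ring.
  rewrite Cmod_0; lra.
Qed.

Lemma Clim_ext_ev u v l (N0 : nat) :
  (forall n, (N0 <= n)%nat -> u n = v n) -> Clim u l -> Clim v l.
Proof.
  intros E H eps He. destruct (H eps He) as [N K].
  exists (N + N0)%nat. intros n Hn. rewrite <- E by lia. apply K; lia.
Qed.

Lemma Clim_ext u v l : (forall n, u n = v n) -> Clim u l -> Clim v l.
Proof. intros E; apply (Clim_ext_ev u v l 0); auto. Qed.

Lemma Clim_val u l l' : Clim u l -> l = l' -> Clim u l'.
Proof. intros H <-; exact H. Qed.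

Lemma Clim_plus u v l l' : Clim u l -> Clim v l' -> Clim (fun n => u n + v n) (l + l').
Proof.
  intros H H' eps He.
  destruct (H (eps / 2)%R ltac:(lra)) as [N K].
  destruct (H' (eps / 2)%R ltac:(lra)) as [N' K'].
  exists (N + N')%nat. intros n Hn.
  specialize (K n ltac:(lia)); specialize (K' n ltac:(lia)).
  replace (u n + v n - (l + l')) with ((u n - l) + (v n - l')) by ring.
  eapply Rle_lt_trans; [apply Cmod_triangle|]. lra.
Qed.

Lemma Clim_scal c u l : Clim u l -> Clim (fun n => c * u n) (c * l).
Proof.
  intros H eps He. pose proof (Cmod_ge_0 c).
  destruct (H (eps / (Cmod c + 1))%R ltac:(apply Rdiv_lt_0_compat; lra)) as [N K].
  exists N. intros n Hn. specialize (K n Hn).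
  replace (c * u n - c * l) with (c * (u n - l)) by ring. rewrite Cmod_mult.
  pose proof (Cmod_ge_0 (u n - l)).
  apply Rle_lt_trans with ((Cmod c) * (eps / (Cmod c + 1)))%R.
  - apply Rmult_le_compat_l; lra.
  - apply Rlt_le_trans with ((Cmod c + 1) * (eps / (Cmod c + 1)))%R.
    + apply Rmult_lt_compat_r; [apply Rdiv_lt_0_compat; lra|lra].
    + right; field; lra.
Qed.

Lemma Clim_opp u l : Clim u l -> Clim (fun n => - u n) (- l).
Proof.
  intros H. apply Clim_ext with (fun n => - (1) * u n); [intros; ring|].
  eapply Clim_val; [apply Clim_scal, H|ring].
Qed.

Lemma Clim_minus u v l l' : Clim u l -> Clim v l' -> Clim (fun n => u n - v n) (l - l').
Proof. intros H H'. apply Clim_plus; [exact H|apply Clim_opp, H']. Qed.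

Lemma Clim_subseq u l (m : nat -> nat) :
  (forall j, (j <= m j)%nat) -> Clim u l -> Clim (fun j => u (m j)) l.
Proof.
  intros Hm H eps He. destruct (H eps He) as [N K]. exists N. intros n Hn.
  apply K. specialize (Hm n). lia.
Qed.

Lemma Clim_bound_le u l (B : R) (N0 : nat) :
  (forall n, (N0 <= n)%nat -> (Cmod (u n) <= B)%R) -> Clim u l -> (Cmod l <= B)%R.
Proof.
  intros HB H. apply le_epsilon. intros eps He. destruct (H eps He) as [N K].
  specialize (K (N + N0)%nat ltac:(lia)). specialize (HB (N + N0)%nat ltac:(lia)).
  replace l with (u (N + N0)%nat - (u (N + N0)%nat - l)) by ring.
  unfold Cminus at 1. eapply Rle_trans; [apply Cmod_triangle|]. rewrite Cmod_opp. lra.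
Qed.

(** Comparison with the single term [u N] is the form that tails of series
    provide. *)
Lemma Clim_cauchy u :
  (forall eps : R, (0 < eps)%R -> exists N, forall n, (N <= n)%nat ->
     (Cmod (u n - u N) <= eps)%R) -> exists l, Clim u l.
Proof.
  intros H.
  assert (G : forall p : C -> R, (forall a b, Rabs (p a - p b) <= Cmod (a - b))%R ->
     exists l, Un_cv (fun n : nat => p (u n)) l).
  { intros p Hp. destruct (Rcomplete.R_complete (fun n : nat => p (u n))) as [l Hl]; [|now exists l].
    intros eps He. destruct (H (eps / 3)%R ltac:(lra)) as [N K].
    exists N. intros n k Hn Hk. unfold R_dist.
    replace (p (u n) - p (u k))%R with ((p (u n) - p (u N)) - (p (u k) - p (u N)))%R by ring.
    pose proof (Hp (u n) (u N)). pose proof (Hp (u k) (u N)).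
    specialize (K n Hn) as K1. specialize (K k Hk) as K2.
    unfold Rminus at 1. eapply Rle_lt_trans; [apply Rabs_triang|]. rewrite Rabs_Ropp. lra. }
  destruct (G Re) as [x Hx].
  { intros a b. replace (Re a - Re b)%R with (Re (a - b)) by (unfold Re; simpl; ring).
    apply re_le_Cmod. }
  destruct (G Im) as [y Hy].
  { intros a b. rewrite !Im_rotation.
    replace (Re (- Ci * a) - Re (- Ci * b))%R with (Re (- Ci * (a - b)))
      by (unfold Re; simpl; ring).
    eapply Rle_trans; [apply re_le_Cmod|].
    rewrite Cmod_mult, Cmod_opp, Cmod_Ci. lra. }
  exists (x, y). intros eps He.
  destruct (Hx (eps / 3)%R ltac:(lra)) as [N K].
  destruct (Hy (eps / 3)%R ltac:(lra)) as [N' K'].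
  exists (N + N')%nat. intros n Hn.
  specialize (K n ltac:(lia)); specialize (K' n ltac:(lia)).
  unfold R_dist in *.
  set (v := u n - (x, y)).
  assert (E1 : Re v = (Re (u n) - x)%R) by reflexivity.
  assert (E2 : Im v = (Im (u n) - y)%R) by reflexivity.
  rewrite <- E1 in K. rewrite <- E2 in K'.
  pose proof (Cmod2_alt v) as E. pose proof (Cmod_ge_0 v).
  rewrite <- (pow2_abs (Re v)), <- (pow2_abs (Im v)) in E.
  pose proof (Rabs_pos (Re v)); pose proof (Rabs_pos (Im v)). nra.
Qed.

(** * Sums over lists and symmetric sums over the integers *)

Section ListSums.
Context {T : Type}.
Definition lsum (f : T -> C) (L : list T) : C := fold_right Cplus 0 (map f L).
Definition rsum (g : T -> R) (L : list T) : R := fold_right Rplus 0%R (map g L).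

Lemma lsum_app f L L' : lsum f (L ++ L') = lsum f L + lsum f L'.
Proof.
  unfold lsum. induction L as [|x L IH]; simpl; [ring|]. rewrite IH. ring.
Qed.

Lemma rsum_app f L L' : (rsum f (L ++ L') = rsum f L + rsum f L')%R.
Proof.
  unfold rsum. induction L as [|x L IH]; simpl; [ring|]. rewrite IH. ring.
Qed.

Lemma lsum_ext f g L : (forall x, In x L -> f x = g x) -> lsum f L = lsum g L.
Proof.
  unfold lsum. induction L as [|x L IH]; simpl; intros H; [reflexivity|].
  rewrite H, IH; auto.
Qed.

Lemma lsum_plus f g L : lsum (fun x => f x + g x) L = lsum f L + lsum g L.
Proof. unfold lsum. induction L as [|x L IH]; simpl; [ring|]. rewrite IH. ring. Qed.

Lemma lsum_scal c f L : lsum (fun x => c * f x) L = c * lsum f L.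
Proof. unfold lsum. induction L as [|x L IH]; simpl; [ring|]. rewrite IH. ring. Qed.

Lemma lsum_minus f g L : lsum (fun x => f x - g x) L = lsum f L - lsum g L.
Proof. unfold lsum. induction L as [|x L IH]; simpl; [ring|]. rewrite IH. ring. Qed.

Lemma lsum_zero L : lsum (fun _ => 0) L = 0.
Proof. unfold lsum. induction L as [|x L IH]; simpl; [ring|]. rewrite IH. ring. Qed.

Lemma rsum_scal c f L : (rsum (fun x => c * f x) L = c * rsum f L)%R.
Proof. unfold rsum. induction L as [|x L IH]; simpl; [ring|]. rewrite IH. ring. Qed.

Lemma rsum_plus f g L : (rsum (fun x => f x + g x) L = rsum f L + rsum g L)%R.
Proof. unfold rsum. induction L as [|x L IH]; simpl; [ring|]. rewrite IH. ring. Qed.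

Lemma rsum_le f g L : (forall x, In x L -> (f x <= g x)%R) -> (rsum f L <= rsum g L)%R.
Proof.
  unfold rsum. induction L as [|x L IH]; simpl; intros H; [lra|].
  apply Rplus_le_compat; auto.
Qed.

Lemma rsum_nonneg f L : (forall x, In x L -> (0 <= f x)%R) -> (0 <= rsum f L)%R.
Proof.
  unfold rsum. induction L as [|x L IH]; simpl; intros H; [lra|].
  apply Rplus_le_le_0_compat; auto.
Qed.

Lemma lsum_bound f g L :
  (forall x, In x L -> (Cmod (f x) <= g x)%R) -> (Cmod (lsum f L) <= rsum g L)%R.
Proof.
  unfold lsum, rsum. induction L as [|x L IH]; simpl; intros H.
  - rewrite Cmod_0; lra.
  - eapply Rle_trans; [apply Cmod_triangle|]. apply Rplus_le_compat; auto.
Qed.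

Lemma lsum_perm f L L' : Permutation L L' -> lsum f L = lsum f L'.
Proof.
  unfold lsum. induction 1; simpl; try congruence; try ring.
Qed.

Lemma rsum_perm f L L' : Permutation L L' -> rsum f L = rsum f L'.
Proof.
  unfold rsum. induction 1; simpl; try congruence; try ring.
Qed.

Lemma Clim_lsum (F : nat -> T -> C) f L :
  (forall x, In x L -> Clim (fun j => F j x) (f x)) ->
  Clim (fun j => lsum (F j) L) (lsum f L).
Proof.
  unfold lsum. induction L as [|x L IH]; simpl; intros H; [apply Clim_const|].
  apply Clim_plus; auto.
Qed.

End ListSums.

Lemma lsum_map {S T} (h : S -> T) (f : T -> C) L : lsum f (map h L) = lsum (fun x => f (h x)) L.
Proof. unfold lsum. rewrite map_map. reflexivity. Qed.

Lemma lsum_prod {S T} (g : S -> T -> C) L M :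
  lsum (fun p => g (fst p) (snd p)) (list_prod L M) = lsum (fun a => lsum (g a) M) L.
Proof.
  induction L as [|x L IH]; [reflexivity|]. simpl. rewrite lsum_app, IH, lsum_map. reflexivity.
Qed.

Lemma lsum_swap {S T} (g : S -> T -> C) L M :
  lsum (fun a => lsum (g a) M) L = lsum (fun b => lsum (fun a => g a b) L) M.
Proof.
  induction L as [|x L IH]; simpl.
  - unfold lsum at 1; simpl. rewrite (lsum_ext _ (fun _ => 0)); [now rewrite lsum_zero|].
    reflexivity.
  - change (lsum (g x) M + lsum (fun a => lsum (g a) M) L =
            lsum (fun b => g x b + lsum (fun a => g a b) L) M).
    rewrite lsum_plus, IH. reflexivity.
Qed.

Lemma rsum_prod {S T} (g : S -> R) (h : T -> R) L M :
  rsum (fun p => g (fst p) * h (snd p))%R (list_prod L M) = (rsum g L * rsum h M)%R.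
Proof.
  induction L as [|x L IH]; [unfold rsum; simpl; ring|]. simpl.
  rewrite rsum_app, IH.
  replace (rsum (fun p : S * T => (g (fst p) * h (snd p))%R) (map (fun y => (x, y)) M))
    with (g x * rsum h M)%R.
  - unfold rsum; simpl; ring.
  - rewrite <- rsum_scal. unfold rsum. rewrite map_map. reflexivity.
Qed.

(** Opposite integers enter together: the sums over these ranges are the
    symmetric (Eisenstein) ones, and some of them converge only in this order. *)
Fixpoint zrange (N : nat) : list Z :=
  match N with
  | O => [0%Z]
  | S n => Z.of_nat (S n) :: (- Z.of_nat (S n))%Z :: zrange n
  end.

Lemma in_zrange N n : In n (zrange N) <-> (Z.abs n <= Z.of_nat N)%Z.
Proof.
  induction N as [|N IH]; cbn [zrange In].
  - simpl; lia.
  - rewrite IH. lia.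
Qed.

Lemma NoDup_zrange N : NoDup (zrange N).
Proof.
  induction N as [|N IH]; cbn [zrange].
  - constructor; [simpl; auto|constructor].
  - constructor; [|constructor]; [| |exact IH].
    + simpl. rewrite in_zrange. lia.
    + rewrite in_zrange. lia.
Qed.

Definition Zs (f : Z -> C) (N : nat) : C := lsum f (zrange N).

Lemma Zs_S f N : Zs f (S N) = Zs f N + (f (Z.of_nat (S N)) + f (- Z.of_nat (S N))%Z).
Proof. unfold Zs. cbn [zrange]. unfold lsum. cbn [map fold_right]. ring. Qed.

Lemma Zs_O f : Zs f 0 = f 0%Z.
Proof. unfold Zs, lsum; simpl. ring. Qed.

Lemma Zs_neg f N : Zs (fun n => f (- n)%Z) N = Zs f N.
Proof.
  induction N as [|N IH]; [now rewrite !Zs_O|]. rewrite !Zs_S, IH, Z.opp_involutive. ring.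
Qed.

Lemma zrange_split N M : (N <= M)%nat ->
  Permutation (zrange M) (zrange N ++ filter (fun n => Z.of_nat N <? Z.abs n)%Z (zrange M)).
Proof.
  intros H. apply NoDup_Permutation.
  - apply NoDup_zrange.
  - apply NoDup_app; [apply NoDup_zrange|apply NoDup_filter, NoDup_zrange|].
    intros n Hn. rewrite filter_In, Z.ltb_lt. rewrite in_zrange in Hn. lia.
  - intros n. rewrite in_app_iff, filter_In, Z.ltb_lt, !in_zrange. lia.
Qed.

Lemma Zs_tail_bound (g : Z -> C) (b : Z -> R) N M : (N <= M)%nat ->
  (forall n, (Z.of_nat N < Z.abs n <= Z.of_nat M)%Z -> (Cmod (g n) <= b n)%R) ->
  (Cmod (Zs g M - Zs g N) <= rsum b (zrange M) - rsum b (zrange N))%R.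
Proof.
  intros H B. unfold Zs.
  rewrite (lsum_perm g _ _ (zrange_split N M H)), (rsum_perm b _ _ (zrange_split N M H)).
  rewrite lsum_app, rsum_app.
  replace (lsum g (zrange N) + lsum g (filter (fun n => (Z.of_nat N <? Z.abs n)%Z) (zrange M))
           - lsum g (zrange N))
    with (lsum g (filter (fun n => (Z.of_nat N <? Z.abs n)%Z) (zrange M))) by ring.
  match goal with |- (_ <= ?x + ?y - ?x)%R => replace (x + y - x)%R with y by ring end.
  apply lsum_bound. intros n. rewrite filter_In, Z.ltb_lt, in_zrange. intros; apply B; lia.
Qed.

(** * Dominated convergence for symmetric sums *)

Definition summable (b : Z -> R) : Prop :=
  (forall n, (0 <= b n)%R) /\ exists S, forall N, (rsum b (zrange N) <= S)%R.

Lemma rsum_zrange_mono b N M : (forall n, (0 <= b n)%R) -> (N <= M)%nat ->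
  (rsum b (zrange N) <= rsum b (zrange M))%R.
Proof.
  intros Hb H. rewrite (rsum_perm b _ _ (zrange_split N M H)), rsum_app.
  pose proof (rsum_nonneg b (filter (fun n => (Z.of_nat N <? Z.abs n)%Z) (zrange M))
    (fun n _ => Hb n)). lra.
Qed.

Lemma summable_tail b : summable b -> forall eps : R, (0 < eps)%R ->
  exists N, forall M, (N <= M)%nat ->
    (rsum b (zrange M) - rsum b (zrange N) <= eps)%R.
Proof.
  intros [Hb [S HS]] eps He.
  destruct (completeness (fun x => exists N, x = rsum b (zrange N))) as [l [Hu Hl]].
  - exists S. intros x [N ->]. apply HS.
  - exists (rsum b (zrange 0)). now exists 0%nat.
  - destruct (Classical_Prop.classic (exists N, (l - eps < rsum b (zrange N))%R)) as [[N HN]|HN].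
    + exists N. intros M _. specialize (Hu (rsum b (zrange M)) (ex_intro _ M eq_refl)). lra.
    + exfalso. specialize (Hl (l - eps)%R). apply (Rlt_not_le l (l - eps)); [lra|].
      apply Hl. intros x [N ->]. apply Rnot_lt_le. intros K. apply HN. now exists N.
Qed.

Lemma summable_scal (c : R) b : (0 <= c)%R -> summable b -> summable (fun n => c * b n)%R.
Proof.
  intros Hc [Hb [S HS]]. split; [intros n; apply Rmult_le_pos; auto|].
  exists (c * S)%R. intros N. rewrite rsum_scal. apply Rmult_le_compat_l; auto.
Qed.

Lemma summable_converges f b (N0 : nat) : summable b ->
  (forall n, (Z.of_nat N0 < Z.abs n)%Z -> (Cmod (f n) <= b n)%R) ->
  exists l, Clim (Zs f) l.
Proof.
  intros Hb Hf. apply Clim_cauchy. intros eps He.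
  destruct (summable_tail b Hb eps He) as [N K].
  exists (N + N0)%nat. intros M HM.
  eapply Rle_trans; [apply (Zs_tail_bound f b); [lia|intros; apply Hf; lia]|].
  specialize (K M ltac:(lia)).
  pose proof (rsum_zrange_mono b N (N + N0) (proj1 Hb) ltac:(lia)). lra.
Qed.

(** Tannery's theorem.  The summands to which it is applied have a period that
    grows with [j]; they are dominated only within the range of summation. *)
Lemma tannery (F : nat -> Z -> C) (f : Z -> C) (b : Z -> R) (m : nat -> nat) (J : nat) :
  summable b -> (forall j, (j <= m j)%nat) ->
  (forall j n, (J <= j)%nat -> (Z.abs n <= Z.of_nat (m j))%Z -> (Cmod (F j n) <= b n)%R) ->
  (forall n, Clim (fun j => F j n) (f n)) ->
  Clim (fun j => Zs (F j) (m j) - Zs f (m j)) 0.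
Proof.
  intros Hb Hm HF Hf eps He.
  assert (Hfb : forall n, (Cmod (f n) <= b n)%R).
  { intros n. apply (Clim_bound_le (fun j => F j n) (f n) (b n) (J + Z.to_nat (Z.abs n)));
      [|apply Hf].
    intros j Hj. apply HF; [lia|]. specialize (Hm j). lia. }
  destruct (summable_tail b Hb (eps / 8)%R ltac:(lra)) as [N K].
  destruct (Clim_lsum F f (zrange N) (fun n _ => Hf n) (eps / 2)%R ltac:(lra)) as [N1 K1].
  exists (N + N1 + J)%nat. intros j Hj. pose proof (Hm j) as Hmj.
  specialize (K1 j ltac:(lia)). specialize (K (m j) ltac:(lia)).
  replace (Zs (F j) (m j) - Zs f (m j) - 0) with
    ((Zs (F j) N - Zs f N) + (Zs (F j) (m j) - Zs (F j) N) + - (Zs f (m j) - Zs f N)) by ring.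
  eapply Rle_lt_trans; [apply Cmod_tri3|]. rewrite Cmod_opp.
  pose proof (Zs_tail_bound (F j) b N (m j) ltac:(lia)
    (fun n Hn => HF j n ltac:(lia) (proj2 Hn))).
  pose proof (Zs_tail_bound f b N (m j) ltac:(lia) (fun n _ => Hfb n)).
  change (lsum (F j) (zrange N)) with (Zs (F j) N) in K1.
  change (lsum f (zrange N)) with (Zs f N) in K1. lra.
Qed.

(** [tannery] for the sequence of partial row sums: for a family dominated by a
    product the sums over growing squares have the limit of the iterated sums. *)
Lemma square_sums (f : Z -> Z -> C) (a : Z -> R) (m : nat -> nat) (row : Z -> C) :
  summable a -> (forall j, (j <= m j)%nat) ->
  (forall x y, (Cmod (f x y) <= a x * a y)%R) ->
  (forall y, Clim (fun j => Zs (fun x => f x y) (m j)) (row y)) ->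
  Clim (fun j => Zs (fun y => Zs (fun x => f x y) (m j)) (m j) - Zs row (m j)) 0.
Proof.
  intros Ha Hm Hf Hrow. pose proof Ha as [Ha0 [S HS]].
  apply (tannery (fun j y => Zs (fun x => f x y) (m j)) row (fun y => S * a y)%R m 0).
  - apply summable_scal; [|exact Ha].
    eapply Rle_trans; [|apply (HS O)]. apply rsum_nonneg. auto.
  - exact Hm.
  - intros j y _ _. eapply Rle_trans; [apply (lsum_bound _ (fun x => a y * a x)%R)|].
    + intros x _. rewrite Rmult_comm. apply Hf.
    + rewrite rsum_scal, Rmult_comm. apply Rmult_le_compat_r; auto.
  - exact Hrow.
Qed.

Lemma Clim_diff u v l : Clim (fun n => u n - v n) 0 -> Clim v l -> Clim u l.
Proof.
  intros H H'. apply Clim_ext with (fun n => (u n - v n) + v n); [intros; ring|].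
  eapply Clim_val; [apply Clim_plus; [exact H|exact H']|ring].
Qed.

Lemma Zs_swap (f : Z -> Z -> C) N M :
  Zs (fun y => Zs (fun x => f x y) N) M = Zs (fun x => Zs (fun y => f x y) M) N.
Proof. unfold Zs. apply (lsum_swap (fun y x => f x y)). Qed.

Definition Zsum (f : Z -> C) : C := iota (T := C_CompleteNormedModule) (Clim (Zs f)).

Lemma Zsum_eq f l : Clim (Zs f) l -> Zsum f = l.
Proof.
  intros H. apply (iota_unique (V := C_CompleteNormedModule)); [|exact H].
  intros y Hy. exact (Clim_unique _ _ _ Hy H).
Qed.

Lemma Zsum_correct f l : Clim (Zs f) l -> Clim (Zs f) (Zsum f).
Proof. intros H. now rewrite (Zsum_eq f l H). Qed.

(** * The complex exponential *)

Lemma C_exp_plus (a b : C) : C_exp (a + b) = C_exp a * C_exp b.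
Proof.
  unfold C_exp. destruct a as [x y], b as [x' y']. simpl.
  rewrite exp_plus, cos_plus, sin_plus. apply injective_projections; simpl; ring.
Qed.

Lemma C_exp_0 : C_exp 0 = 1.
Proof. unfold C_exp. simpl. rewrite exp_0, cos_0, sin_0. apply injective_projections; simpl; ring. Qed.

Lemma Cmod_C_exp (z : C) : Cmod (C_exp z) = exp (Re z).
Proof.
  unfold C_exp, Cmod. simpl fst; simpl snd.
  replace ((exp (Re z) * cos (Im z)) ^ 2 + (exp (Re z) * sin (Im z)) ^ 2)%R
    with (exp (Re z) * exp (Re z))%R.
  - apply sqrt_square. left; apply exp_pos.
  - pose proof (sin2_cos2 (Im z)) as H. unfold Rsqr in H.
    transitivity (exp (Re z) * exp (Re z) * (sin (Im z) * sin (Im z) + cos (Im z) * cos (Im z)))%R;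
      [rewrite H; ring|ring].
Qed.

Lemma C_exp_neq_0 (z : C) : C_exp z <> 0.
Proof. apply Cmod_gt_0. rewrite Cmod_C_exp. apply exp_pos. Qed.

Lemma derivable_pt_lim_small (f : R -> R) (l : R) : derivable_pt_lim f 0 l ->
  forall eps, (0 < eps)%R -> exists d, (0 < d)%R /\
    forall x, (Rabs x < d)%R -> (Rabs (f x - f 0 - x * l) <= eps * Rabs x)%R.
Proof.
  intros H eps He. destruct (H eps He) as [[d Hd] K]. exists d; split; [exact Hd|].
  intros x Hx. destruct (Req_dec x 0) as [->|N].
  - rewrite Rabs_R0. replace (f 0 - f 0 - 0 * l)%R with 0%R by ring. rewrite Rabs_R0; lra.
  - specialize (K x N Hx). rewrite Rplus_0_l in K.
    replace (f x - f 0 - x * l)%R with (((f x - f 0) / x - l) * x)%R by (field; auto).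
    rewrite Rabs_mult. apply Rmult_le_compat_r; [apply Rabs_pos|lra].
Qed.

Lemma Cmod_le_Re_Im (v : C) : (Cmod v <= Rabs (Re v) + Rabs (Im v))%R.
Proof.
  pose proof (Cmod2_alt v) as expi. pose proof (Cmod_ge_0 v).
  pose proof (Rabs_pos (Re v)); pose proof (Rabs_pos (Im v)).
  rewrite <- (pow2_abs (Re v)), <- (pow2_abs (Im v)) in expi. nra.
Qed.

Lemma im_le_Cmod (v : C) : (Rabs (Im v) <= Cmod v)%R.
Proof.
  rewrite Im_rotation. eapply Rle_trans; [apply re_le_Cmod|].
  rewrite Cmod_mult, Cmod_opp, Cmod_Ci. lra.
Qed.

(** From the derivatives of the real functions [exp], [cos] and [sin] at 0; the
    addition law then gives all other points. *)
Lemma D_C_exp_0 : DC C_exp 0 1.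
Proof.
  intros eps He.
  set (e := Rmin (eps / 8) 1).
  assert (He0 : (0 < e)%R) by (apply Rmin_pos; lra).
  assert (He1 : (e <= eps / 8)%R) by apply Rmin_l.
  assert (He2 : (e <= 1)%R) by apply Rmin_r.
  destruct (derivable_pt_lim_small exp 1 derivable_pt_lim_exp_0 e He0) as [d1 [Hd1 K1]].
  pose proof (derivable_pt_lim_cos 0) as Dc. rewrite sin_0, Ropp_0 in Dc.
  destruct (derivable_pt_lim_small cos 0 Dc e He0) as [d2 [Hd2 K2]].
  pose proof (derivable_pt_lim_sin 0) as Ds. rewrite cos_0 in Ds.
  destruct (derivable_pt_lim_small sin 1 Ds e He0) as [d3 [Hd3 K3]].
  set (d4 := Rmin (e / 2) (1 / 2)).
  assert (Hd4 : (0 < d4)%R) by (apply Rmin_pos; lra).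
  exists (Rmin (Rmin d1 d2) (Rmin d3 d4)). split; [repeat apply Rmin_pos; lra|].
  intros h. replace (h - 0) with h by ring. intros Hh.
  pose proof (Rmin_l (Rmin d1 d2) (Rmin d3 d4)); pose proof (Rmin_r (Rmin d1 d2) (Rmin d3 d4)).
  pose proof (Rmin_l d1 d2); pose proof (Rmin_r d1 d2);
  pose proof (Rmin_l d3 d4); pose proof (Rmin_r d3 d4).
  pose proof (Rmin_l (e / 2) (1 / 2)); pose proof (Rmin_r (e / 2) (1 / 2)).
  fold d4 in H5, H6.
  pose proof (re_le_Cmod h) as Hx. pose proof (im_le_Cmod h) as Hy.
  set (x := Re h) in *. set (y := Im h) in *. set (m := Cmod h) in *.
  specialize (K1 x ltac:(lra)); specialize (K2 y ltac:(lra)); specialize (K3 y ltac:(lra)).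
  rewrite exp_0 in K1. rewrite cos_0 in K2. rewrite sin_0 in K3.
  pose proof (Rabs_pos x); pose proof (Rabs_pos y).
  assert (Ex : (Rabs (exp x - 1) <= 2 * Rabs x)%R).
  { replace (exp x - 1)%R with ((exp x - 1 - x * 1) + x)%R by ring.
    eapply Rle_trans; [apply Rabs_triang|]. nra. }
  assert (Ep : (0 < exp x <= 2)%R).
  { split; [apply exp_pos|]. pose proof (Rle_abs (exp x - 1)). lra. }
  rewrite C_exp_0. rewrite Cmult_1_r.
  eapply Rle_trans; [apply Cmod_le_Re_Im|].
  replace (Re (C_exp h - 1 - h)) with
    (exp x * (cos y - 1 - y * 0) + (exp x - 1 - x * 1))%R
    by (unfold C_exp, x, y; unfold Re, Im; simpl; ring).
  replace (Im (C_exp h - 1 - h)) with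
    (exp x * (sin y - 0 - y * 1) + (exp x - 1) * y)%R
    by (unfold C_exp, x, y; unfold Re, Im; simpl; ring).
  assert (A1 : (Rabs (exp x * (cos y - 1 - y * 0)) <= 2 * (e * Rabs y))%R).
  { rewrite Rabs_mult, (Rabs_pos_eq (exp x)) by lra.
    apply Rmult_le_compat; try lra. apply Rabs_pos. }
  assert (A2 : (Rabs (exp x * (sin y - 0 - y * 1)) <= 2 * (e * Rabs y))%R).
  { rewrite Rabs_mult, (Rabs_pos_eq (exp x)) by lra.
    apply Rmult_le_compat; try lra. apply Rabs_pos. }
  assert (A3 : (Rabs ((exp x - 1) * y) <= e * Rabs y)%R).
  { rewrite Rabs_mult. apply Rmult_le_compat_r; lra. }
  pose proof (Rabs_triang (exp x * (cos y - 1 - y * 0)) (exp x - 1 - x * 1)).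
  pose proof (Rabs_triang (exp x * (sin y - 0 - y * 1)) ((exp x - 1) * y)).
  nra.
Qed.

Lemma D_C_exp (z : C) : DC C_exp z (C_exp z).
Proof.
  apply D_at_ext with (f := fun w => C_exp z * C_exp (w - z)).
  { intros w. rewrite <- C_exp_plus. f_equal. ring. }
  eapply D_at_val; [apply D_at_scal|].
  - apply (D_at_comp _ C_exp (fun w => w - z) z 1 1).
    + replace (z - z) with (RtoC 0) by ring. apply D_C_exp_0.
    + eapply D_at_val; [apply D_at_minus; [apply D_at_id|apply D_at_const]|]. ring.
  - ring.
Qed.

Definition P2i : C := 2 * PI * Ci.

Lemma P2i_neq_0 : P2i <> 0.
Proof.
  unfold P2i. intros H. apply (f_equal snd) in H. simpl in H.
  pose proof PI_RGT_0. nra.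
Qed.

Definition expi (z : C) : C := C_exp (P2i * z).

Lemma expi_plus (a b : C) : expi (a + b) = expi a * expi b.
Proof. unfold expi. rewrite <- C_exp_plus. f_equal; ring. Qed.

Lemma expi_0 : expi 0 = 1.
Proof. unfold expi. rewrite Cmult_0_r. apply C_exp_0. Qed.

Lemma expi_neq_0 (z : C) : expi z <> 0.
Proof. apply C_exp_neq_0. Qed.

Lemma expi_opp (z : C) : expi (- z) = / expi z.
Proof.
  assert (H : expi (- z) * expi z = 1).
  { rewrite <- expi_plus. replace (- z + z) with (RtoC 0) by ring. apply expi_0. }
  rewrite <- (Cmult_1_l (/ expi z)), <- H. field. apply expi_neq_0.
Qed.

Lemma Cmod_expi (z : C) : Cmod (expi z) = exp (- (2 * PI * Im z)).
Proof.
  unfold expi. rewrite Cmod_C_exp. f_equal. unfold P2i, Re, Im. simpl. ring.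
Qed.

Lemma D_expi (z : C) : DC expi z (P2i * expi z).
Proof.
  apply (D_at_comp _ C_exp (fun w => P2i * w) z P2i (C_exp (P2i * z))).
  - apply D_C_exp.
  - eapply D_at_val; [apply D_at_scal, D_at_id|ring].
Qed.

(** The zeros of [expi - 1] are the poles of the cotangent. *)
Lemma expi_eq_1 (z : C) : expi z = 1 <-> exists n : Z, z = int_C n.
Proof.
  split.
  - intros H.
    assert (Hi : Im z = 0%R).
    { pose proof (Cmod_expi z) as K. rewrite H, Cmod_1, <- exp_0 in K.
      apply exp_inv in K. pose proof PI_RGT_0. nra. }
    assert (Hc : cos (2 * (PI * Re z)) = 1%R).
    { apply (f_equal fst) in H. unfold expi, C_exp, P2i in H. simpl in H.
      unfold Re, Im in *. rewrite Hi in H.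
      replace ((2 * PI - 0 * 0) * 0 - (2 * 0 + 0 * PI) * 1)%R with 0%R in H by ring.
      match type of H with (exp ?a * cos ?b)%R = _ =>
        replace a with 0%R in H by ring;
        replace b with (2 * (PI * fst z))%R in H by ring end.
      rewrite exp_0 in H. lra. }
    rewrite cos_2a_sin in Hc.
    assert (Hs : sin (PI * Re z) = 0%R) by nra.
    apply sin_eq_0_0 in Hs. destruct Hs as [k Hk]. exists k.
    apply injective_projections; simpl; [|exact Hi].
    change (fst z) with (Re z). pose proof PI_RGT_0. nra.
  - intros [n ->]. unfold int_C, expi, P2i, C_exp. simpl.
    assert (Hs : sin (PI * IZR n) = 0%R).
    { apply sin_eq_0_1. exists n. ring. }
    match goal with |- ((exp ?a * cos ?b)%R, (exp ?c * sin ?d)%R) = _ =>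
      replace a with 0%R by ring; replace b with (2 * (PI * IZR n))%R by ring end.
    rewrite exp_0, cos_2a_sin, sin_2a, Hs. apply injective_projections; simpl; ring.
Qed.

Lemma expi_int (n : Z) : expi (int_C n) = 1.
Proof. apply expi_eq_1. now exists n. Qed.

(** * The cotangent and its derivatives *)

(** [cot z] is [PI * cot (PI * z)]. *)
Definition cot (z : C) : C := PI * Ci * (expi z + 1) / (expi z - 1).

Definition csq (z : C) : C := expi z / ((1 - expi z) * (1 - expi z)).
Definition rat1 (z : C) : C := expi z / (1 - expi z).

(** The derivatives of [csq], written in the family [rat1 ^ m * csq], which
    differentiation maps to itself. *)
Fixpoint csq_deriv (j m : nat) (z : C) : C :=
  match j with
  | O => Cpow (rat1 z) m * csq z
  | S j' => P2i * ((INR m + 1) * csq_deriv j' m z + (INR m + 2) * csq_deriv j' (S m) z)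
  end.

(** The [j]-th derivative of [cot]. *)
Definition cotd (j : nat) (z : C) : C :=
  match j with
  | O => cot z
  | S j' => - (P2i * P2i) * csq_deriv j' 0 z
  end.

Lemma sub_neq_0 (a b : C) : a <> b -> a - b <> 0.
Proof. intros H K; apply H. replace a with (a - b + b) by ring. rewrite K; ring. Qed.

Lemma D_rat1 z : expi z <> 1 -> DC rat1 z (P2i * csq z).
Proof.
  intros H. assert (N : 1 - expi z <> 0) by (apply sub_neq_0; auto).
  eapply D_at_val.
  - unfold rat1, Cdiv. apply D_at_mult; [apply D_expi|].
    apply (D_at_comp _ Cinv (fun w => 1 - expi w)).
    + apply D_at_inv, N.
    + apply D_at_minus; [apply D_at_const|apply D_expi].
  - unfold csq. field. auto.
Qed.

Lemma csq_rat1 z : expi z <> 1 -> csq z = rat1 z + rat1 z * rat1 z.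
Proof.
  intros H. assert (N : 1 - expi z <> 0) by (apply sub_neq_0; auto).
  unfold csq, rat1. field. auto.
Qed.

Lemma D_csq z : expi z <> 1 -> DC csq z (P2i * ((1 + 2 * rat1 z) * csq z)).
Proof.
  intros H. assert (N : 1 - expi z <> 0) by (apply sub_neq_0; auto).
  eapply D_at_val.
  - unfold csq, Cdiv. apply D_at_mult; [apply D_expi|].
    apply (D_at_comp _ Cinv (fun w => (1 - expi w) * (1 - expi w))).
    + apply D_at_inv. apply Cmult_neq_0; auto.
    + apply D_at_mult; apply D_at_minus; [apply D_at_const|apply D_expi|apply D_at_const|apply D_expi].
  - unfold csq, rat1. field. auto.
Qed.

Lemma D_pow (f : C -> C) z l n :
  DC f z l -> DC (fun w => Cpow (f w) (S n)) z ((INR n + 1) * Cpow (f z) n * l).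
Proof.
  intros H. induction n as [|n IH].
  - apply D_at_ext with (f := f); [intros; simpl; ring|].
    eapply D_at_val; [exact H|]. simpl. ring.
  - apply D_at_ext with (f := fun w => f w * Cpow (f w) (S n)); [reflexivity|].
    eapply D_at_val; [apply D_at_mult; [exact H|exact IH]|].
    rewrite S_INR, RtoC_plus. simpl. ring.
Qed.

Lemma D_csq_deriv j m z : expi z <> 1 -> DC (csq_deriv j m) z (csq_deriv (S j) m z).
Proof.
  intros H. revert m. induction j as [|j IH]; intros m.
  - destruct m as [|m].
    + apply D_at_ext with (f := csq); [intros; simpl; ring|].
      eapply D_at_val; [apply D_csq, H|]. simpl. ring.
    + eapply D_at_val.
      * apply (D_at_mult _ (fun w => Cpow (rat1 w) (S m)) csq).
        -- apply D_pow, D_rat1, H.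
        -- apply D_csq, H.
      * cbn [csq_deriv]. rewrite S_INR, RtoC_plus. cbn [Cpow].
        replace ((INR m + 1) * rat1 z ^ m * (P2i * csq z) * csq z) with
          ((INR m + 1) * rat1 z ^ m * (P2i * (rat1 z + rat1 z * rat1 z)) * csq z)
          by (rewrite <- csq_rat1; auto).
        ring.
  - cbn [csq_deriv]. apply D_at_scal, D_at_plus; apply D_at_scal; apply IH.
Qed.

Lemma D_cotd j z : expi z <> 1 -> DC (cotd j) z (cotd (S j) z).
Proof.
  intros H. destruct j as [|j].
  - assert (N : expi z - 1 <> 0) by (apply sub_neq_0; auto).
    assert (N' : 1 - expi z <> 0) by (apply sub_neq_0; auto).
    eapply D_at_val.
    + unfold cotd, cot, Cdiv. apply D_at_mult.
      * apply D_at_scal, D_at_plus; [apply D_expi|apply D_at_const].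
      * apply (D_at_comp _ Cinv (fun w => expi w - 1)); [apply D_at_inv, N|].
        apply D_at_minus; [apply D_expi|apply D_at_const].
    + cbn [cotd csq_deriv Cpow]. unfold csq, P2i. field. auto.
  - cbn [cotd]. apply D_at_scal, D_csq_deriv, H.
Qed.

(** * Exponentially small families *)

(** These families dominate all series below: the cotangent and its derivatives
    approach their limits at the ends of the strip at this rate. *)
Definition geo (s : R) (n : Z) : R := exp (- (s * IZR (Z.abs n))).

Lemma exp_mono x y : (x <= y)%R -> (exp x <= exp y)%R.
Proof. intros [H| ->]; [left; apply exp_increasing, H|right; reflexivity]. Qed.

Lemma geo_pos s n : (0 < geo s n)%R.
Proof. apply exp_pos. Qed.

Lemma rsum_zrange_S b N :
  (rsum b (zrange (S N)) = rsum b (zrange N) + (b (Z.of_nat (S N)) + b (- Z.of_nat (S N))%Z))%R.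
Proof. cbn [zrange]. unfold rsum. cbn [map fold_right]. ring. Qed.

Lemma geo_nat s N : (geo s (Z.of_nat N) = exp (- s) ^ N)%R.
Proof.
  unfold geo. rewrite Z.abs_eq, <- INR_IZR_INZ by lia.
  induction N as [|N IH].
  - simpl. rewrite Rmult_0_r, Ropp_0. apply exp_0.
  - rewrite S_INR. simpl pow. rewrite <- IH, <- exp_plus. f_equal. ring.
Qed.

Lemma geo_opp s n : geo s (- n) = geo s n.
Proof. unfold geo. now rewrite Z.abs_opp. Qed.

Lemma summable_geo s : (0 < s)%R -> summable (geo s).
Proof.
  intros Hs. split; [intros; left; apply geo_pos|].
  set (t := exp (- s)).
  assert (Ht : (0 < t < 1)%R).
  { split; [apply exp_pos|]. rewrite <- exp_0. apply exp_increasing. lra. }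
  exists (1 + 2 / (1 - t))%R. intros N.
  assert (H : (rsum (geo s) (zrange N) = 1 + 2 * (t - t ^ S N) / (1 - t))%R).
  { induction N as [|N IH].
    - unfold rsum. simpl. unfold geo. simpl. rewrite Rmult_0_r, Ropp_0, exp_0. field. lra.
    - rewrite rsum_zrange_S, geo_opp, geo_nat, IH. fold t. simpl. field. lra. }
  rewrite H. apply Rplus_le_compat_l. apply Rmult_le_compat_r.
  - left. apply Rinv_0_lt_compat. lra.
  - pose proof (pow_lt t (S N) ltac:(lra)). lra.
Qed.

(** Polynomial factors cost only a smaller rate. *)
Lemma geo_poly s k : (0 < s)%R -> exists K s', (0 <= K)%R /\ (0 < s')%R /\
  forall n, (IZR (Z.abs n) ^ k * geo s n <= K * geo s' n)%R.
Proof.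
  intros Hs. induction k as [|k [K [s' [HK [Hs' H]]]]].
  - exists 1%R, s. split; [lra|split; [lra|]]. intros n. simpl. lra.
  - exists (K * (2 / s'))%R, (s' / 2)%R.
    assert (0 < 2 / s')%R by (apply Rdiv_lt_0_compat; lra).
    split; [nra|split; [lra|]]. intros n. simpl pow.
    set (x := IZR (Z.abs n)) in *.
    assert (Hx : (0 <= x)%R) by (apply IZR_le; lia).
    assert (Hlin : (x <= 2 / s' * exp (s' / 2 * x))%R).
    { pose proof (exp_ineq1_le (s' / 2 * x)) as L.
      apply Rle_trans with (2 / s' * (1 + s' / 2 * x))%R.
      - rewrite Rmult_plus_distr_l. replace (2 / s' * (s' / 2 * x))%R with x by (field; lra). lra.
      - apply Rmult_le_compat_l; lra. }
    rewrite Rmult_assoc.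
    apply Rle_trans with (x * (K * geo s' n))%R.
    { apply Rmult_le_compat_l; [exact Hx|apply H]. }
    apply Rle_trans with (2 / s' * exp (s' / 2 * x) * (K * geo s' n))%R.
    { apply Rmult_le_compat_r; [|exact Hlin]. pose proof (geo_pos s' n). nra. }
    right. unfold geo. fold x.
    replace (- (s' / 2 * x))%R with (s' / 2 * x + - (s' * x))%R by field.
    rewrite exp_plus. ring.
Qed.

Lemma geo_small s (A eps : R) : (0 < s)%R -> (0 < eps)%R ->
  exists N0 : nat, forall n, (Z.of_nat N0 < Z.abs n)%Z -> (A * geo s n <= eps)%R.
Proof.
  intros Hs He.
  destruct (INR_unbounded (Rabs A / (eps * s))) as [N0 HN]. exists N0. intros n Hn.
  assert (Hx : (INR N0 <= IZR (Z.abs n))%R).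
  { rewrite INR_IZR_INZ. apply IZR_le. lia. }
  set (x := IZR (Z.abs n)) in *. pose proof (Rabs_pos A).
  assert (Hs' : (0 < eps * s)%R) by (apply Rmult_lt_0_compat; lra).
  assert (B : (Rabs A <= eps * exp (s * x))%R).
  { apply Rle_trans with (eps * s * x)%R.
    - apply Rle_trans with (eps * s * (Rabs A / (eps * s)))%R.
      + right; field. split; lra.
      + apply Rmult_le_compat_l; lra.
    - rewrite Rmult_assoc. apply Rmult_le_compat_l; [lra|].
      pose proof (exp_ineq1_le (s * x)); lra. }
  apply Rle_trans with (Rabs A * geo s n)%R.
  { apply Rmult_le_compat_r; [left; apply geo_pos|apply Rle_abs]. }
  apply Rle_trans with (eps * exp (s * x) * geo s n)%R.
  { apply Rmult_le_compat_r; [left; apply geo_pos|exact B]. }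
  right. unfold geo. fold x. rewrite Rmult_assoc, <- exp_plus.
  replace (s * x + - (s * x))%R with 0%R by ring. rewrite exp_0; ring.
Qed.

Lemma expi_translate (z tau : C) (n : Z) (t1 Y : R) :
  (0 < t1 <= Im tau)%R -> (Rabs (Im z) <= Y)%R ->
  (0 <= n)%Z -> (Cmod (expi (z + int_C n * tau)) <= exp (2 * PI * Y) * geo (2 * PI * t1) n)%R.
Proof.
  intros Ht HY Hn. rewrite Cmod_expi. unfold geo. rewrite <- exp_plus.
  assert (HI : Im (z + int_C n * tau) = (Im z + IZR n * Im tau)%R).
  { unfold int_C, Im; simpl; ring. }
  rewrite HI, Z.abs_eq by exact Hn.
  assert (Hn' : (0 <= IZR n)%R) by (apply IZR_le; exact Hn).
  assert (- Y <= Im z)%R by (pose proof (Rle_abs (- Im z)); rewrite Rabs_Ropp in *; lra).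
  pose proof PI_RGT_0.
  apply exp_mono.
  assert (A1 : (0 <= PI * (Y + Im z))%R) by (apply Rmult_le_pos; lra).
  assert (A2 : (0 <= PI * (IZR n * (Im tau - t1)))%R).
  { apply Rmult_le_pos; [lra|]. apply Rmult_le_pos; lra. }
  lra.
Qed.

Lemma expi_translate_neg (z tau : C) (n : Z) (t1 Y : R) :
  (0 < t1 <= Im tau)%R -> (Rabs (Im z) <= Y)%R ->
  (n <= 0)%Z -> (/ Cmod (expi (z + int_C n * tau)) <= exp (2 * PI * Y) * geo (2 * PI * t1) n)%R.
Proof.
  intros Ht HY Hn. rewrite <- Cmod_inv, <- expi_opp by apply expi_neq_0.
  replace (- (z + int_C n * tau)) with (- z + int_C (- n) * tau)
    by (unfold int_C; rewrite opp_IZR, RtoC_opp; ring).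
  rewrite <- geo_opp. apply expi_translate; [exact Ht| |lia].
  replace (Im (- z)) with (- Im z)%R by reflexivity. rewrite Rabs_Ropp. exact HY.
Qed.

Lemma Cmod_one_minus_ge (X : C) : (1 - Cmod X <= Cmod (1 - X))%R.
Proof. pose proof (Cmod_sub_triangle 1 X). rewrite Cmod_1 in H. exact H. Qed.

Lemma rat1_csq_small z : (Cmod (expi z) <= 1 / 2)%R ->
  (Cmod (rat1 z) <= 2)%R /\ (Cmod (csq z) <= 4 * Cmod (expi z))%R.
Proof.
  intros H. pose proof (Cmod_one_minus_ge (expi z)) as L. pose proof (Cmod_ge_0 (expi z)).
  assert (N : 1 - expi z <> 0) by (apply Cmod_gt_0; lra).
  unfold rat1, csq. rewrite !Cmod_div by (repeat apply Cmult_neq_0; auto).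
  rewrite Cmod_mult. set (d := Cmod (1 - expi z)) in *. split.
  - apply Rle_div_l; lra.
  - apply Rle_div_l; [nra|]. assert (1 <= 4 * (d * d))%R by nra. nra.
Qed.

Lemma rat1_csq_large z : (2 <= Cmod (expi z))%R ->
  (Cmod (rat1 z) <= 2)%R /\ (Cmod (csq z) <= 4 * / Cmod (expi z))%R.
Proof.
  intros H. pose proof (Cmod_sub_triangle (expi z) 1) as L. rewrite Cmod_1, Cmod_sub_sym in L.
  assert (N : 1 - expi z <> 0) by (apply Cmod_gt_0; lra).
  unfold rat1, csq. rewrite !Cmod_div by (repeat apply Cmult_neq_0; auto).
  rewrite Cmod_mult. set (d := Cmod (1 - expi z)) in *. set (x := Cmod (expi z)) in *. split.
  - apply Rle_div_l; lra.
  - apply Rle_div_l; [nra|].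
    replace (4 * / x * (d * d))%R with (4 * (d * d) / x)%R by (field; lra).
    apply Rle_div_r; [lra|]. nra.
Qed.

Lemma csq_deriv_bound j m : exists K, (0 <= K)%R /\ forall z x,
  (Cmod (rat1 z) <= 2)%R -> (Cmod (csq z) <= 4 * x)%R -> (Cmod (csq_deriv j m z) <= K * x)%R.
Proof.
  revert m. induction j as [|j IH]; intros m.
  - exists (2 ^ m * 4)%R. split; [apply Rmult_le_pos; [apply pow_le|]; lra|].
    intros z x H1 H2. cbn [csq_deriv]. rewrite Cmod_mult, Cmod_pow, Rmult_assoc.
    apply Rmult_le_compat; [apply pow_le, Cmod_ge_0|apply Cmod_ge_0| |exact H2].
    apply pow_incr. split; [apply Cmod_ge_0|exact H1].
  - destruct (IH m) as [K1 [P1 H1]]. destruct (IH (S m)) as [K2 [P2 H2]].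
    exists (Cmod P2i * (Cmod (INR m + 1) * K1 + Cmod (INR m + 2) * K2))%R. split.
    { pose proof (Cmod_ge_0 P2i); pose proof (Cmod_ge_0 (INR m + 1));
      pose proof (Cmod_ge_0 (INR m + 2)).
      apply Rmult_le_pos; [lra|]. apply Rplus_le_le_0_compat; apply Rmult_le_pos; lra. }
    intros z x Hr Hc. cbn [csq_deriv]. rewrite Cmod_mult, Rmult_assoc.
    apply Rmult_le_compat_l; [apply Cmod_ge_0|].
    eapply Rle_trans; [apply Cmod_triangle|]. rewrite !Cmod_mult, Rmult_plus_distr_r, !Rmult_assoc.
    apply Rplus_le_compat; apply Rmult_le_compat_l; try apply Cmod_ge_0; auto.
Qed.

Lemma cot_upper z : expi z <> 1 -> cot z + PI * Ci = 2 * PI * Ci * (expi z / (expi z - 1)).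
Proof. intros H. assert (expi z - 1 <> 0) by (apply sub_neq_0; auto). unfold cot. field. auto. Qed.

Lemma cot_lower z : expi z <> 1 -> cot z - PI * Ci = 2 * PI * Ci * / (expi z - 1).
Proof. intros H. assert (expi z - 1 <> 0) by (apply sub_neq_0; auto). unfold cot. field. auto. Qed.

(** For large |n| the value of [expi] at z + n tau is very small or very large.  The
    cotangent is a fractional linear function of it, hence close to its values
    at 0 or at infinity, and the derivatives contain the factor [csq], which
    vanishes at both.  Uniformity in [z] and [tau] is needed to differentiate. *)
Lemma translate_bounds (t1 Y : R) (j : nat) : (0 < t1)%R ->
  exists (N0 : nat) (K s : R), (0 <= K)%R /\ (0 < s)%R /\
  forall z tau n, (t1 <= Im tau)%R -> (Rabs (Im z) <= Y)%R -> (Z.of_nat N0 < Z.abs n)%Z ->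
    expi (z + int_C n * tau) <> 1 /\
    (Cmod (cotd (S j) (z + int_C n * tau)) <= K * geo s n)%R /\
    ((0 < n)%Z -> (Cmod (cot (z + int_C n * tau) + PI * Ci) <= K * geo s n)%R) /\
    ((n < 0)%Z -> (Cmod (cot (z + int_C n * tau) - PI * Ci) <= K * geo s n)%R).
Proof.
  intros Ht. pose proof PI_RGT_0 as Hpi.
  set (s := (2 * PI * t1)%R). assert (Hs : (0 < s)%R) by (unfold s; nra).
  set (A := exp (2 * PI * Y)). assert (HA : (0 < A)%R) by apply exp_pos.
  destruct (geo_small s A (1 / 2) Hs ltac:(lra)) as [N0 HN].
  destruct (csq_deriv_bound j 0) as [K [HK B]].
  set (k1 := Cmod (- (P2i * P2i))). assert (Hk1 : (0 <= k1)%R) by apply Cmod_ge_0.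
  set (k2 := Cmod (2 * PI * Ci)). assert (Hk2 : (0 <= k2)%R) by apply Cmod_ge_0.
  exists N0, ((k1 * K + k2 * 2) * A)%R, s. split; [|split; [exact Hs|]].
  { assert (0 <= k1 * K)%R by (apply Rmult_le_pos; lra). apply Rmult_le_pos; lra. }
  intros z tau n Htau HY Hn. specialize (HN n Hn).
  set (w := z + int_C n * tau).
  pose proof (geo_pos s n) as Hg.
  assert (Hk1K : (0 <= k1 * K)%R) by (apply Rmult_le_pos; lra).
  assert (HAg : (0 < A * geo s n)%R) by (apply Rmult_lt_0_compat; lra).
  assert (Main : forall x, (0 <= x <= A * geo s n)%R ->
      (Cmod (rat1 w) <= 2)%R -> (Cmod (csq w) <= 4 * x)%R ->
      (Cmod (cotd (S j) w) <= (k1 * K + k2 * 2) * A * geo s n)%R).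
  { intros x Hx H1 H2. cbn [cotd]. rewrite Cmod_mult. fold k1.
    apply Rle_trans with (k1 * (K * x))%R.
    - apply Rmult_le_compat_l; [exact Hk1|]. apply B; auto.
    - rewrite (Rmult_assoc _ A). apply Rle_trans with (k1 * K * (A * geo s n))%R.
      + rewrite <- Rmult_assoc. apply Rmult_le_compat_l; lra.
      + apply Rmult_le_compat_r; lra. }
  destruct (Z_lt_le_dec 0 n) as [Hp|Hp].
  - pose proof (expi_translate z tau n t1 Y (conj Ht Htau) HY ltac:(lia)) as HE.
    fold w A s in HE.
    assert (HE1 : expi w <> 1) by (intros Q; rewrite Q, Cmod_1 in HE; lra).
    destruct (rat1_csq_small w ltac:(lra)) as [R1 R2].
    split; [exact HE1|]. split; [|split; [intros _|lia]].
    + apply (Main (Cmod (expi w))); auto. split; [apply Cmod_ge_0|exact HE].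
    + rewrite cot_upper by exact HE1. rewrite Cmod_mult. fold k2.
      rewrite Cmod_div by (apply sub_neq_0, HE1).
      pose proof (Cmod_one_minus_ge (expi w)) as L. rewrite Cmod_sub_sym in L.
      assert (Cmod (expi w) / Cmod (expi w - 1) <= 2 * (A * geo s n))%R.
      { apply Rle_div_l; [lra|]. pose proof (Cmod_ge_0 (expi w)). nra. }
      apply Rle_trans with (k2 * (2 * (A * geo s n)))%R; [apply Rmult_le_compat_l; lra|].
      rewrite <- (Rmult_assoc k2), (Rmult_assoc _ A). apply Rmult_le_compat_r; lra.
  - pose proof (expi_translate_neg z tau n t1 Y (conj Ht Htau) HY Hp) as HE.
    fold w A s in HE.
    assert (HEp : (0 < Cmod (expi w))%R) by (apply Cmod_gt_0, expi_neq_0).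
    assert (HE2 : (2 <= Cmod (expi w))%R).
    { rewrite <- (Rinv_inv (Cmod (expi w))). apply Rle_trans with (/ (1 / 2))%R; [lra|].
      apply Rinv_le_contravar; [apply Rinv_0_lt_compat, HEp|lra]. }
    assert (HE1 : expi w <> 1) by (intros Q; rewrite Q, Cmod_1 in HE2; lra).
    destruct (rat1_csq_large w HE2) as [R1 R2].
    split; [exact HE1|]. split; [|split; [lia|intros _]].
    + apply (Main (/ Cmod (expi w))%R); auto. split; [left; apply Rinv_0_lt_compat, HEp|exact HE].
    + rewrite cot_lower by exact HE1. rewrite Cmod_mult. fold k2.
      rewrite Cmod_inv by (apply sub_neq_0, HE1).
      pose proof (Cmod_sub_triangle (expi w) 1) as L. rewrite Cmod_1 in L.
      assert (/ Cmod (expi w - 1) <= 2 * (A * geo s n))%R.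
      { apply Rle_trans with (2 * / Cmod (expi w))%R; [|lra].
        replace (2 * / Cmod (expi w))%R with (/ (Cmod (expi w) / 2))%R by (field; lra).
        apply Rinv_le_contravar; lra. }
      apply Rle_trans with (k2 * (2 * (A * geo s n)))%R; [apply Rmult_le_compat_l; lra|].
      rewrite <- (Rmult_assoc k2), (Rmult_assoc _ A). apply Rmult_le_compat_r; lra.
Qed.

(** * Termwise differentiation *)

Lemma D_at_lsum {T S} (i : T -> C) (f : S -> T -> C) (g : S -> C) x L :
  (forall n, In n L -> D_at i (f n) x (g n)) ->
  D_at i (fun w => lsum (fun n => f n w) L) x (lsum g L).
Proof.
  unfold lsum. induction L as [|n L IH]; simpl; intros H; [apply D_at_const|].
  apply D_at_plus; auto.
Qed.

(** Termwise differentiation needs no uniform convergence of the sum itself: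
    a dominated second derivative bounds all remainders of order one at once. *)
Lemma Zsum_derivative (f g h : Z -> C -> C) (z : C) (d : R) (N0 : nat) (b : Z -> R)
    (F : C -> C) (G : C) :
  summable b -> (0 < d)%R ->
  (forall n, DC (f n) z (g n z)) ->
  (forall n w, (Z.of_nat N0 < Z.abs n)%Z -> (Cmod (w - z) < d)%R ->
     DC (f n) w (g n w) /\ DC (g n) w (h n w) /\ (Cmod (h n w) <= b n)%R) ->
  (forall w, (Cmod (w - z) < d)%R -> Clim (Zs (fun n => f n w)) (F w)) ->
  Clim (Zs (fun n => g n z)) G ->
  DC F z G.
Proof.
  intros Hb Hd Hf Hfg HF HG eps He.
  pose proof Hb as [Hb0 [S HS]].
  assert (HS0 : (0 <= S)%R).
  { eapply Rle_trans; [|apply (HS O)]. apply rsum_nonneg; auto. }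
  destruct (D_at_lsum (fun w => w) f (fun n => g n z) z (zrange N0)
    (fun n _ => Hf n) (eps / 2)%R ltac:(lra)) as [d1 [Hd1 K1]].
  set (d2 := (eps / (8 * (S + 1)))%R).
  assert (Hd2 : (0 < d2)%R) by (apply Rdiv_lt_0_compat; lra).
  exists (Rmin d (Rmin d1 d2)). split; [repeat apply Rmin_pos; lra|].
  intros y Hy.
  pose proof (Rmin_l d (Rmin d1 d2)); pose proof (Rmin_r d (Rmin d1 d2));
  pose proof (Rmin_l d1 d2); pose proof (Rmin_r d1 d2).
  specialize (K1 y ltac:(lra)). cbv beta in K1.
  assert (Hz : (Cmod (z - z) < d)%R).
  { replace (z - z) with (RtoC 0) by ring. rewrite Cmod_0. exact Hd. }
  set (u := fun n => f n y - f n z - (y - z) * g n z).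
  apply (Clim_bound_le (Zs u) _ _ N0).
  2:{ apply Clim_ext with (fun N => Zs (fun n => f n y) N - Zs (fun n => f n z) N
        - (y - z) * Zs (fun n => g n z) N).
      - intros N. unfold Zs, u. rewrite !lsum_minus, lsum_scal. reflexivity.
      - apply Clim_minus; [apply Clim_minus; apply HF; [lra|exact Hz]|apply Clim_scal, HG]. }
  intros M HM.
  replace (Zs u M) with (Zs u N0 + (Zs u M - Zs u N0)) by ring.
  eapply Rle_trans; [apply Cmod_triangle|].
  set (m := Cmod (y - z)) in *.
  assert (Hm : (0 <= m)%R) by apply Cmod_ge_0.
  assert (B1 : (Cmod (Zs u N0) <= eps / 2 * m)%R).
  { unfold Zs, u. rewrite !lsum_minus, lsum_scal. exact K1. }
  assert (B2 : (Cmod (Zs u M - Zs u N0) <= 4 * (m * m) * S)%R).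
  { eapply Rle_trans.
    - apply (Zs_tail_bound u (fun n => (4 * (m * m)) * b n)%R N0 M HM).
      intros n Hn. unfold u.
      eapply Rle_trans; [apply (taylor_quadratic (f n) (g n) (h n) z y (b n))|unfold m; right; ring].
      intros x Hx. apply Hfg; [lia|]. fold m in Hx. lra.
    - rewrite !rsum_scal.
      pose proof (rsum_nonneg b (zrange N0) (fun n _ => Hb0 n)).
      specialize (HS M). assert (0 <= m * m)%R by nra. nra. }
  assert (B3 : (8 * (S + 1) * m <= eps)%R).
  { apply Rle_trans with (8 * (S + 1) * d2)%R; [apply Rmult_le_compat_l; lra|].
    right. unfold d2. field. lra. }
  nra.
Qed.

(** * The logarithmic derivative of theta *)

(** Each derivative in [tau] brings out a factor [n]. *)
Definition rho_term (i k : nat) (z tau : C) (n : Z) : C :=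
  Cpow (int_C n) k * cotd (i + k) (z + int_C n * tau).

(** [Rho 0 0] is the logarithmic derivative in [z] of the odd theta function,
    as an Eisenstein sum of cotangents; [Rho i k] is its derivative of order [i]
    in [z] and [k] in [tau]. *)
Definition Rho (i k : nat) (z tau : C) : C := Zsum (rho_term i k z tau).

(** Phrased by the terms of the series: none of its cotangents has a pole.  See
    [off_lattice_iff] for the lattice. *)
Definition off_lattice (tau z : C) : Prop := forall n : Z, expi (z + int_C n * tau) <> 1.

Lemma int_C_opp n : int_C (- n) = - int_C n.
Proof. unfold int_C. now rewrite opp_IZR, RtoC_opp. Qed.

Lemma int_C_plus n m : int_C (n + m) = int_C n + int_C m.
Proof. unfold int_C. now rewrite plus_IZR, RtoC_plus. Qed.

Lemma off_lattice_iff tau z : off_lattice tau z <-> ~ period_lattice tau z.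
Proof.
  split.
  - intros H [a [b ->]]. apply (H (- b)%Z). rewrite int_C_opp.
    replace (int_C a + int_C b * tau + - int_C b * tau) with (int_C a) by ring. apply expi_int.
  - intros H n Hn. apply expi_eq_1 in Hn. destruct Hn as [a Ha]. apply H.
    exists a, (- n)%Z. rewrite int_C_opp, <- Ha. ring.
Qed.

Lemma off_lattice_opp tau z : off_lattice tau z -> off_lattice tau (- z).
Proof.
  intros H n Hn. apply (H (- n)%Z).
  replace (z + int_C (- n) * tau) with (- (- z + int_C n * tau)) by (rewrite int_C_opp; ring).
  rewrite expi_opp, Hn. field.
Qed.

Lemma Cmod_int_C_pow n k : Cmod (Cpow (int_C n) k) = (IZR (Z.abs n) ^ k)%R.
Proof. rewrite Cmod_pow. unfold int_C. rewrite Cmod_R, abs_IZR. reflexivity. Qed.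

Lemma rho_term_bounds (t1 Y : R) (i k : nat) : (0 < t1)%R ->
  exists (N0 : nat) (K s : R), (0 <= K)%R /\ (0 < s)%R /\
  forall z tau n, (t1 <= Im tau)%R -> (Rabs (Im z) <= Y)%R -> (Z.of_nat N0 < Z.abs n)%Z ->
    expi (z + int_C n * tau) <> 1 /\
    (forall l, (l <= k)%nat ->
      (Cmod (Cpow (int_C n) l * cotd (S i) (z + int_C n * tau)) <= K * geo s n)%R).
Proof.
  intros Ht. destruct (translate_bounds t1 Y i Ht) as [N0 [K [s [HK [Hs H]]]]].
  destruct (geo_poly s k Hs) as [K' [s' [HK' [Hs' P]]]].
  exists N0, (K * K')%R, s'. split; [apply Rmult_le_pos; lra|split; [exact Hs'|]].
  intros z tau n Htau HY Hn. destruct (H z tau n Htau HY Hn) as [H1 [H2 _]].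
  split; [exact H1|]. intros l Hl. rewrite Cmod_mult, Cmod_int_C_pow.
  assert (Hx : (1 <= IZR (Z.abs n))%R) by (apply IZR_le; lia).
  apply Rle_trans with (IZR (Z.abs n) ^ k * (K * geo s n))%R.
  - apply Rmult_le_compat; [apply pow_le; lra|apply Cmod_ge_0|apply Rle_pow; auto|exact H2].
  - specialize (P n). pose proof (geo_pos s n).
    replace (IZR (Z.abs n) ^ k * (K * geo s n))%R with (K * (IZR (Z.abs n) ^ k * geo s n))%R by ring.
    rewrite Rmult_assoc. apply Rmult_le_compat_l; lra.
Qed.

(** All derivatives are exponentially dominated.  The cotangent itself is not,
    but its limits above and below the real axis are opposite, so that the sums
    of two opposite terms are. *)
Lemma Rho_converges i k z tau : (0 < Im tau)%R ->
  Clim (Zs (rho_term i k z tau)) (Rho i k z tau).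
Proof.
  intros Ht.
  assert (X : exists l, Clim (Zs (rho_term i k z tau)) l).
  2:{ destruct X as [l Hl]. apply (Zsum_correct _ l Hl). }
  unfold rho_term. destruct (i + k)%nat as [|j] eqn:Eik.
  - assert (k = 0%nat) by lia. subst k.
    destruct (translate_bounds (Im tau) (Rabs (Im z)) 0 Ht) as [N0 [K [s [HK [Hs H]]]]].
    set (f := fun n => int_C n ^ 0 * cotd 0 (z + int_C n * tau)).
    assert (Hf : forall n, (Z.of_nat N0 < n)%Z -> (Cmod (f n + f (- n)%Z) <= 2 * K * geo s n)%R).
    { intros n Hn.
      destruct (H z tau n ltac:(lra) ltac:(lra) ltac:(lia)) as [_ [_ [A _]]].
      destruct (H z tau (- n)%Z ltac:(lra) ltac:(lra) ltac:(lia)) as [_ [_ [_ B]]].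
      specialize (A ltac:(lia)). specialize (B ltac:(lia)). rewrite geo_opp in B.
      unfold f. cbn [Cpow cotd].
      replace (1 * cot (z + int_C n * tau) + 1 * cot (z + int_C (- n) * tau)) with
        ((cot (z + int_C n * tau) + PI * Ci) + (cot (z + int_C (- n) * tau) - PI * Ci)) by ring.
      eapply Rle_trans; [apply Cmod_triangle|]. lra. }
    destruct (summable_converges (fun n => / 2 * (f n + f (- n)%Z)) (fun n => K * geo s n)%R N0)
      as [l Hl].
    + apply summable_scal; [exact HK|apply summable_geo, Hs].
    + intros n Hn.
      rewrite Cmod_mult, Cmod_inv, Cmod_R, (Rabs_pos_eq 2) by (try lra; intros Q; apply RtoC_inj in Q; lra).
      destruct (Z_lt_le_dec 0 n).
      * specialize (Hf n ltac:(lia)). lra.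
      * specialize (Hf (- n)%Z ltac:(lia)). rewrite Z.opp_involutive, Cplus_comm, geo_opp in Hf. lra.
    + exists l. apply (Clim_ext _ _ _) with (2 := Hl). intros N. unfold Zs.
      rewrite lsum_scal, lsum_plus. change (lsum (fun n => f (- n)%Z) (zrange N)) with
        (Zs (fun n => f (- n)%Z) N). rewrite Zs_neg. unfold Zs. field.
  - destruct (rho_term_bounds (Im tau) (Rabs (Im z)) j k Ht) as [N0 [K [s [HK [Hs H]]]]].
    apply (summable_converges _ (fun n => K * geo s n)%R N0).
    + apply summable_scal; [exact HK|apply summable_geo, Hs].
    + intros n Hn. apply (H z tau n); [lra|lra|exact Hn|lia].
Qed.

Lemma D_cotd_translate_z j n z tau : expi (z + int_C n * tau) <> 1 ->
  DC (fun w => cotd j (w + int_C n * tau)) z (cotd (S j) (z + int_C n * tau)).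
Proof.
  intros H. eapply D_at_val; [apply (D_at_comp _ (cotd j) (fun w => w + int_C n * tau) z)|].
  - apply D_cotd, H.
  - apply D_at_plus; [apply D_at_id|apply D_at_const].
  - ring.
Qed.

Lemma D_cotd_translate_tau j n z tau : expi (z + int_C n * tau) <> 1 ->
  DC (fun t => cotd j (z + int_C n * t)) tau (int_C n * cotd (S j) (z + int_C n * tau)).
Proof.
  intros H. eapply D_at_val; [apply (D_at_comp _ (cotd j) (fun t => z + int_C n * t) tau)|].
  - apply D_cotd, H.
  - apply D_at_plus; [apply D_at_const|apply D_at_scal, D_at_id].
  - ring.
Qed.

Lemma D_rho_term_z i k n z tau : expi (z + int_C n * tau) <> 1 ->
  DC (fun w => rho_term i k w tau n) z (rho_term (S i) k z tau n).
Proof.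
  intros H. unfold rho_term. apply D_at_scal.
  exact (D_cotd_translate_z (i + k) n z tau H).
Qed.

Lemma D_rho_term_tau i k n z tau : expi (z + int_C n * tau) <> 1 ->
  DC (fun t => rho_term i k z t n) tau (rho_term i (S k) z tau n).
Proof.
  intros H. unfold rho_term. replace (i + S k)%nat with (S (i + k)) by lia.
  eapply D_at_val; [apply D_at_scal; exact (D_cotd_translate_tau (i + k) n z tau H)|].
  cbn [Cpow]. ring.
Qed.

Lemma Im_close a b : (Rabs (Im a - Im b) <= Cmod (a - b))%R.
Proof. replace (Im a - Im b)%R with (Im (a - b)) by (unfold Im; simpl; ring). apply im_le_Cmod. Qed.

Lemma D_Rho_z i k z tau : (0 < Im tau)%R -> off_lattice tau z ->
  DC (fun w => Rho i k w tau) z (Rho (S i) k z tau).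
Proof.
  intros Ht Hoff.
  destruct (rho_term_bounds (Im tau) (Rabs (Im z) + 1) (S (i + k)) k Ht)
    as [N0 [K [s [HK [Hs H]]]]].
  apply (Zsum_derivative (fun n w => rho_term i k w tau n) (fun n w => rho_term (S i) k w tau n)
    (fun n w => rho_term (S (S i)) k w tau n) z 1 N0 (fun n => K * geo s n)%R).
  - apply summable_scal; [exact HK|apply summable_geo, Hs].
  - lra.
  - intros n. apply D_rho_term_z, Hoff.
  - intros n w Hn Hw.
    assert (HY : (Rabs (Im w) <= Rabs (Im z) + 1)%R).
    { pose proof (Im_close w z). replace (Im w) with ((Im w - Im z) + Im z)%R by ring.
      eapply Rle_trans; [apply Rabs_triang|]. lra. }
    destruct (H w tau n ltac:(lra) HY Hn) as [H1 H2]. split; [|split].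
    + apply D_rho_term_z, H1.
    + apply D_rho_term_z, H1.
    + unfold rho_term. apply H2. lia.
  - intros w _. apply Rho_converges, Ht.
  - apply Rho_converges, Ht.
Qed.

Lemma D_Rho_tau i k z tau : (0 < Im tau)%R -> off_lattice tau z ->
  DC (fun t => Rho i k z t) tau (Rho i (S k) z tau).
Proof.
  intros Ht Hoff.
  destruct (rho_term_bounds (Im tau / 2) (Rabs (Im z)) (S (i + k)) (S (S k)) ltac:(lra))
    as [N0 [K [s [HK [Hs H]]]]].
  assert (HI : forall t, (Cmod (t - tau) < Im tau / 2)%R -> (Im tau / 2 <= Im t)%R).
  { intros t Hw. pose proof (Im_close t tau).
    pose proof (Rle_abs (- (Im t - Im tau))). rewrite Rabs_Ropp in *. lra. }
  apply (Zsum_derivative (fun n t => rho_term i k z t n) (fun n t => rho_term i (S k) z t n)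
    (fun n t => rho_term i (S (S k)) z t n) tau (Im tau / 2) N0 (fun n => K * geo s n)%R).
  - apply summable_scal; [exact HK|apply summable_geo, Hs].
  - lra.
  - intros n. apply D_rho_term_tau, Hoff.
  - intros n t Hn Hw.
    destruct (H z t n (HI t Hw) ltac:(lra) Hn) as [H1 H2]. split; [|split].
    + apply D_rho_term_tau, H1.
    + apply D_rho_term_tau, H1.
    + unfold rho_term. replace (i + S (S k))%nat with (S (S (i + k))) by lia. apply H2. lia.
  - intros t Hw. specialize (HI t Hw). apply Rho_converges. lra.
  - apply Rho_converges, Ht.
Qed.

Lemma csq_opp z : csq (- z) = csq z.
Proof.
  unfold csq. rewrite expi_opp. pose proof (expi_neq_0 z) as N.
  destruct (Ceq_dec (expi z) 1) as [->|H].
  - f_equal. + field. + f_equal; f_equal; field.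
  - assert (1 - expi z <> 0) by (apply sub_neq_0; auto).
    assert (expi z - 1 <> 0) by (apply sub_neq_0; auto).
    field. auto.
Qed.

Lemma cot_opp z : expi z <> 1 -> cot (- z) = - cot z.
Proof.
  intros H. unfold cot. rewrite expi_opp. pose proof (expi_neq_0 z) as N.
  assert (1 - expi z <> 0) by (apply sub_neq_0; auto).
  assert (expi z - 1 <> 0) by (apply sub_neq_0; auto).
  field. auto.
Qed.

(** Only this parity is computed from the series; [Rho_opp] obtains the others
    by differentiation. *)
Lemma Rho_opp_00 z tau : (0 < Im tau)%R -> off_lattice tau z ->
  Rho 0 0 (- z) tau = - Rho 0 0 z tau.
Proof.
  intros Ht Hoff. apply Zsum_eq.
  apply Clim_ext with (fun N => - Zs (rho_term 0 0 z tau) N).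
  - intros N. rewrite <- (Zs_neg (rho_term 0 0 z tau)).
    replace (- Zs (fun n => rho_term 0 0 z tau (- n)) N) with
      (- (1) * Zs (fun n => rho_term 0 0 z tau (- n)) N) by ring.
    unfold Zs. rewrite <- lsum_scal. apply lsum_ext. intros n _.
    unfold rho_term. cbn [Cpow cotd Nat.add].
    replace (- z + int_C n * tau) with (- (z + int_C (- n) * tau)) by (rewrite int_C_opp; ring).
    rewrite cot_opp by apply Hoff. ring.
  - apply Clim_opp, Rho_converges, Ht.
Qed.

(** * Distance from the lattice *)

Lemma list_positive_min {T} (g : T -> R) (L : list T) :
  (forall x, In x L -> (0 < g x)%R) ->
  exists k, (0 < k)%R /\ forall x, In x L -> (k <= g x)%R.
Proof.
  induction L as [|y L IH]; intros H.
  - exists 1%R. split; [lra|]. intros x [].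
  - destruct IH as [k [Hk K]]; [intros; apply H; now right|].
    pose proof (H y (or_introl eq_refl)).
    exists (Rmin k (g y)). split; [apply Rmin_pos; lra|].
    intros x [<-|Hx]; [apply Rmin_r|].
    eapply Rle_trans; [apply Rmin_l|auto].
Qed.

Definition lat (tau : C) (a b : Z) : C := int_C a + int_C b * tau.

Definition size (a b : Z) : R := (IZR (Z.abs a) + IZR (Z.abs b))%R.

Lemma size_pos a b : (0 <= size a b)%R.
Proof. apply Rplus_le_le_0_compat; apply IZR_le; lia. Qed.

(** The imaginary part controls [b], and then the real part controls [a]. *)
Lemma lat_norm tau : (0 < Im tau)%R ->
  exists k, (0 < k)%R /\ forall a b, (k * size a b <= Cmod (lat tau a b))%R.
Proof.
  intros Ht. pose proof (Cmod_ge_0 tau) as Hc.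
  set (D := (1 + (Cmod tau + 1) / Im tau)%R).
  assert (HD : (1 <= D)%R).
  { unfold D. assert (0 < (Cmod tau + 1) / Im tau)%R by (apply Rdiv_lt_0_compat; lra). lra. }
  exists (/ D)%R. split; [apply Rinv_0_lt_compat; lra|]. intros a b.
  set (w := lat tau a b).
  assert (Hb : (IZR (Z.abs b) * Im tau <= Cmod w)%R).
  { pose proof (im_le_Cmod w) as H.
    replace (Im w) with (IZR b * Im tau)%R in H
      by (unfold w, lat, int_C, Im; simpl; ring).
    rewrite Rabs_mult, (Rabs_pos_eq (Im tau)), <- abs_IZR in H by lra. exact H. }
  assert (Ha : (IZR (Z.abs a) <= Cmod w + IZR (Z.abs b) * Cmod tau)%R).
  { replace (IZR (Z.abs a)) with (Cmod (int_C a)) by (unfold int_C; now rewrite Cmod_R, abs_IZR).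
    replace (int_C a) with (w + - (int_C b * tau)) by (unfold w, lat; ring).
    eapply Rle_trans; [apply Cmod_triangle|]. rewrite Cmod_opp, Cmod_mult.
    unfold int_C. rewrite Cmod_R, abs_IZR. lra. }
  assert (Hb' : (IZR (Z.abs b) <= Cmod w / Im tau)%R).
  { apply Rle_div_r; lra. }
  apply Rmult_le_reg_l with D; [lra|]. rewrite <- Rmult_assoc, Rinv_r, Rmult_1_l by lra.
  unfold size, D.
  apply Rle_trans with (Cmod w + (Cmod tau + 1) * IZR (Z.abs b))%R; [lra|].
  replace ((1 + (Cmod tau + 1) / Im tau) * Cmod w)%R with
    (Cmod w + (Cmod tau + 1) * (Cmod w / Im tau))%R by (field; lra).
  apply Rplus_le_compat_l, Rmult_le_compat_l; lra.
Qed.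

(** Far lattice points are controlled by [lat_norm]; the finitely many others
    are at a positive distance. *)
Lemma lattice_distance tau z : (0 < Im tau)%R -> off_lattice tau z ->
  exists k, (0 < k)%R /\ forall a b, (k * (1 + size a b) <= Cmod (z - lat tau a b))%R.
Proof.
  intros Ht Hoff. destruct (lat_norm tau Ht) as [k0 [Hk0 K0]].
  pose proof (Cmod_ge_0 z) as Hz.
  destruct (INR_unbounded ((2 * Cmod z + k0) / k0)) as [N HN].
  assert (HN' : (2 * Cmod z + k0 <= INR N * k0)%R).
  { apply Rle_div_l; lra. }
  destruct (list_positive_min
    (fun p => Cmod (z - lat tau (fst p) (snd p)) / (1 + size (fst p) (snd p)))%R
    (list_prod (zrange N) (zrange N))) as [k1 [Hk1 K1]].
  { intros [a b] _. simpl. pose proof (size_pos a b).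
    apply Rdiv_lt_0_compat; [|lra]. apply Cmod_gt_0, sub_neq_0. intros Q.
    apply off_lattice_iff in Hoff. apply Hoff. now exists a, b. }
  exists (Rmin k1 (k0 / 2)). split; [apply Rmin_pos; lra|]. intros a b.
  pose proof (size_pos a b) as Hs.
  destruct (Rle_lt_dec (size a b) (INR N)) as [Hle|Hgt].
  - apply Rle_trans with (k1 * (1 + size a b))%R.
    { apply Rmult_le_compat_r; [lra|apply Rmin_l]. }
    apply Rle_div_r; [lra|]. apply (K1 (a, b)).
    rewrite INR_IZR_INZ in Hle. unfold size in Hle. rewrite <- plus_IZR in Hle.
    apply le_IZR in Hle. apply in_prod; apply in_zrange; lia.
  - apply Rle_trans with (k0 / 2 * (1 + size a b))%R.
    { apply Rmult_le_compat_r; [lra|apply Rmin_r]. }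
    pose proof (Cmod_sub_triangle (lat tau a b) z) as L. rewrite Cmod_sub_sym in L.
    specialize (K0 a b). nra.
Qed.

(** Moving [tau] moves a lattice point in proportion to its size, and so does
    the lower bound of [lattice_distance]. *)
Lemma off_lattice_open tau z : (0 < Im tau)%R -> off_lattice tau z ->
  exists d, (0 < d)%R /\ forall z' tau',
    (Cmod (z' - z) < d)%R -> (Cmod (tau' - tau) < d)%R ->
    off_lattice tau' z' /\ (0 < Im tau')%R.
Proof.
  intros Ht Hoff. destruct (lattice_distance tau z Ht Hoff) as [k [Hk K]].
  exists (Rmin k (Im tau)). split; [apply Rmin_pos; lra|].
  intros z' tau' Hz Htau.
  pose proof (Rmin_l k (Im tau)); pose proof (Rmin_r k (Im tau)). split.
  - apply off_lattice_iff. intros [a [b Q]].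
    specialize (K a b).
    replace (z - lat tau a b) with (- (z' - z) + int_C b * (tau' - tau)) in K
      by (rewrite Q; unfold lat; ring).
    pose proof (Cmod_triangle (- (z' - z)) (int_C b * (tau' - tau))) as L.
    rewrite Cmod_opp, Cmod_mult in L. unfold int_C in L. rewrite Cmod_R, <- abs_IZR in L.
    unfold size in K.
    assert (Ha : (0 <= IZR (Z.abs a))%R) by (apply IZR_le; lia).
    assert (Hb : (0 <= IZR (Z.abs b))%R) by (apply IZR_le; lia).
    unfold int_C in K.
    assert (IZR (Z.abs b) * Cmod (tau' - tau) <= IZR (Z.abs b) * k)%R
      by (apply Rmult_le_compat_l; lra).
    nra.
  - pose proof (Im_close tau' tau). pose proof (Rle_abs (- (Im tau' - Im tau))).
    rewrite Rabs_Ropp in *. lra.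
Qed.

Lemma DC_unique2 (f : C -> C) (z l l' : C) : DC f z l -> DC f z l' -> l = l'.
Proof. intros H H'. now rewrite <- (DC_unique f z l H), <- (DC_unique f z l' H'). Qed.

Lemma Rho_opp i k z tau : (0 < Im tau)%R -> off_lattice tau z ->
  Rho i k (- z) tau = Cpow (- (1)) (S i) * Rho i k z tau.
Proof.
  revert z tau. induction i as [|i IHi].
  - induction k as [|k IHk]; intros z tau Ht Hoff.
    + rewrite Rho_opp_00 by auto. simpl. ring.
    + destruct (off_lattice_open tau z Ht Hoff) as [d [Hd K]].
      apply (DC_unique2 (fun t => Rho 0 k (- z) t) tau).
      * apply D_Rho_tau; [exact Ht|apply off_lattice_opp, Hoff].
      * apply D_at_ext_loc with (f := fun t => Cpow (- (1)) 1 * Rho 0 k z t) (d := d); [exact Hd| |].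
        -- intros t Hw. destruct (K z t) as [K1 K2]; [|exact Hw|symmetry; apply IHk; auto].
           replace (z - z) with (RtoC 0) by ring. now rewrite Cmod_0.
        -- apply D_at_scal, D_Rho_tau; auto.
  - intros z tau Ht Hoff.
    destruct (off_lattice_open tau z Ht Hoff) as [d [Hd K]].
    assert (A : DC (fun w => Rho i k (- w) tau) z (- (1) * Rho (S i) k (- z) tau)).
    { apply (D_at_comp _ (fun w => Rho i k w tau) (fun w => - w) z).
      - apply D_Rho_z; [exact Ht|apply off_lattice_opp, Hoff].
      - apply D_at_opp, D_at_id. }
    assert (B : DC (fun w => Rho i k (- w) tau) z (Cpow (- (1)) (S i) * Rho (S i) k z tau)).
    { apply D_at_ext_loc with (f := fun w => Cpow (- (1)) (S i) * Rho i k w tau) (d := d); [exact Hd| |].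
      - intros w Hw. destruct (K w tau) as [K1 K2]; [exact Hw| |symmetry; apply IHi; auto].
        replace (tau - tau) with (RtoC 0) by ring. now rewrite Cmod_0.
      - apply D_at_scal, D_Rho_z; auto. }
    pose proof (DC_unique2 _ _ _ _ A B) as Q.
    replace (Rho (S i) k (- z) tau) with (- (1) * (- (1) * Rho (S i) k (- z) tau)) by ring.
    rewrite Q. cbn [Cpow]. ring.
Qed.

(** * Quasi-periodicity *)

Lemma Zs_shift f N :
  Zs (fun n => f (n + 1)%Z) N = Zs f N + f (Z.of_nat N + 1)%Z - f (- Z.of_nat N)%Z.
Proof.
  induction N as [|N IH].
  - rewrite !Zs_O. simpl. ring.
  - rewrite !Zs_S, IH.
    replace (Z.of_nat (S N)) with (Z.of_nat N + 1)%Z by lia.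
    replace (- (Z.of_nat N + 1) + 1)%Z with (- Z.of_nat N)%Z by lia. ring.
Qed.

Lemma cot_limits z tau : (0 < Im tau)%R ->
  Clim (fun N => cot (z + int_C (Z.of_nat N + 1) * tau)) (- (PI * Ci)) /\
  Clim (fun N => cot (z + int_C (- Z.of_nat N) * tau)) (PI * Ci).
Proof.
  intros Ht.
  destruct (translate_bounds (Im tau) (Rabs (Im z)) 0 Ht) as [N0 [K [s [HK [Hs H]]]]].
  split; intros eps He;
    destruct (geo_small s K (eps / 2) Hs ltac:(lra)) as [N1 B]; exists (S (N0 + N1));
    intros n Hn.
  - destruct (H z tau (Z.of_nat n + 1)%Z ltac:(lra) ltac:(lra) ltac:(lia)) as [_ [_ [A _]]].
    specialize (A ltac:(lia)). specialize (B (Z.of_nat n + 1)%Z ltac:(lia)).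
    replace (cot (z + int_C (Z.of_nat n + 1) * tau) - - (PI * Ci)) with
      (cot (z + int_C (Z.of_nat n + 1) * tau) + PI * Ci) by ring. lra.
  - destruct (H z tau (- Z.of_nat n)%Z ltac:(lra) ltac:(lra) ltac:(lia)) as [_ [_ [_ A]]].
    specialize (A ltac:(lia)). specialize (B (- Z.of_nat n)%Z ltac:(lia)). lra.
Qed.

(** The shift leaves two boundary terms of the telescoping sum, at the two ends
    of the strip, where the cotangent has opposite limits. *)
Lemma Rho_add_tau z tau : (0 < Im tau)%R -> Rho 0 0 (z + tau) tau = Rho 0 0 z tau - P2i.
Proof.
  intros Ht. destruct (cot_limits z tau Ht) as [A B].
  apply Zsum_eq.
  apply Clim_ext with (fun N => Zs (rho_term 0 0 z tau) N
    + cot (z + int_C (Z.of_nat N + 1) * tau) - cot (z + int_C (- Z.of_nat N) * tau)).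
  - intros N. transitivity (Zs (fun n => rho_term 0 0 z tau (n + 1)%Z) N).
    + rewrite Zs_shift. unfold rho_term. cbn [Cpow cotd Nat.add]. ring.
    + unfold Zs. apply lsum_ext. intros n _. unfold rho_term. cbn [Cpow cotd Nat.add].
      rewrite int_C_plus. do 2 f_equal. unfold int_C at 2. ring.
  - apply Clim_val with (Rho 0 0 z tau + - (PI * Ci) - PI * Ci).
    + apply Clim_minus; [apply Clim_plus; [apply Rho_converges, Ht|exact A]|exact B].
    + unfold P2i. ring.
Qed.

Lemma Rho_add_n_tau z tau n : (0 < Im tau)%R ->
  Rho 0 0 (z + int_C n * tau) tau = Rho 0 0 z tau - P2i * int_C n.
Proof.
  intros Ht.
  assert (P : forall (N : nat) z, Rho 0 0 (z + int_C (Z.of_nat N) * tau) tau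
             = Rho 0 0 z tau - P2i * int_C (Z.of_nat N)).
  { intros N. induction N as [|N IH]; intros w.
    - replace (w + int_C (Z.of_nat 0) * tau) with w by (unfold int_C; simpl; ring).
      unfold int_C; simpl; ring.
    - replace (w + int_C (Z.of_nat (S N)) * tau) with (w + int_C (Z.of_nat N) * tau + tau)
        by (rewrite Nat2Z.inj_succ, <- Z.add_1_r, int_C_plus; unfold int_C at 3; ring).
      rewrite Rho_add_tau, IH by exact Ht.
      rewrite Nat2Z.inj_succ, <- Z.add_1_r, int_C_plus. unfold int_C at 3. ring. }
  destruct (Z_le_gt_dec 0 n) as [Hn|Hn].
  - rewrite <- (Z2Nat.id n) by exact Hn. apply P.
  - pose proof (P (Z.to_nat (- n)) (z + int_C n * tau)) as Q.
    rewrite Z2Nat.id in Q by lia. rewrite int_C_opp in Q.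
    replace (z + int_C n * tau + - int_C n * tau) with z in Q by ring.
    rewrite Q. ring.
Qed.

(** * The addition theorem *)

(** Near the ends of the strip one of [|expi|] and 1 dominates; in between there are
    finitely many translates, none of them a zero of [expi - 1]. *)
Lemma expi_minus_one_bound tau z : (0 < Im tau)%R -> off_lattice tau z ->
  exists k, (0 < k)%R /\ forall n : Z,
    (k * (1 + Cmod (expi (z + int_C n * tau))) <= Cmod (expi (z + int_C n * tau) - 1))%R.
Proof.
  intros Ht Hoff.
  set (s := (2 * PI * Im tau)%R). assert (Hs : (0 < s)%R).
  { unfold s. pose proof PI_RGT_0. nra. }
  destruct (geo_small s (exp (2 * PI * Rabs (Im z))) (1 / 2) Hs ltac:(lra)) as [N0 HN].
  destruct (list_positive_min
    (fun n => Cmod (expi (z + int_C n * tau) - 1) / (1 + Cmod (expi (z + int_C n * tau))))%R (zrange N0))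
    as [k1 [Hk1 K1]].
  { intros n _. pose proof (Cmod_ge_0 (expi (z + int_C n * tau))).
    apply Rdiv_lt_0_compat; [|lra]. apply Cmod_gt_0, sub_neq_0, Hoff. }
  exists (Rmin k1 (1 / 3)). split; [apply Rmin_pos; lra|]. intros n.
  pose proof (Cmod_ge_0 (expi (z + int_C n * tau))) as H0.
  pose proof (Rmin_l k1 (1 / 3)); pose proof (Rmin_r k1 (1 / 3)).
  destruct (Z_le_gt_dec (Z.abs n) (Z.of_nat N0)) as [Hn|Hn].
  - apply Rle_trans with (k1 * (1 + Cmod (expi (z + int_C n * tau))))%R.
    { apply Rmult_le_compat_r; lra. }
    apply Rle_div_r; [lra|]. apply K1, in_zrange, Hn.
  - specialize (HN n ltac:(lia)).
    apply Rle_trans with (1 / 3 * (1 + Cmod (expi (z + int_C n * tau))))%R.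
    { apply Rmult_le_compat_r; lra. }
    pose proof (Cmod_sub_triangle (expi (z + int_C n * tau)) 1) as L1.
    pose proof (Cmod_one_minus_ge (expi (z + int_C n * tau))) as L2.
    rewrite Cmod_sub_sym in L2. rewrite Cmod_1 in L1.
    destruct (Z_le_gt_dec 0 n) as [Hp|Hp].
    + pose proof (expi_translate z tau n (Im tau) _ (conj Ht (Rle_refl _)) (Rle_refl _) Hp) as B.
      fold s in B. lra.
    + pose proof (expi_translate_neg z tau n (Im tau) _ (conj Ht (Rle_refl _)) (Rle_refl _)
        ltac:(lia)) as B. fold s in B.
      assert (HEp : (0 < Cmod (expi (z + int_C n * tau)))%R) by (apply Cmod_gt_0, expi_neq_0).
      assert (2 <= Cmod (expi (z + int_C n * tau)))%R; [|lra].
      rewrite <- (Rinv_inv (Cmod (expi (z + int_C n * tau)))).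
      apply Rle_trans with (/ (1 / 2))%R; [lra|].
      apply Rinv_le_contravar; [apply Rinv_0_lt_compat, HEp|lra].
Qed.

(** The square root of [|expi z|]. *)
Definition half_weight (z : C) : R := exp (- (PI * Im z)).

Lemma Cmod_expi_half z : Cmod (expi z) = (half_weight z * half_weight z)%R.
Proof. rewrite Cmod_expi. unfold half_weight. rewrite <- exp_plus. f_equal. ring. Qed.

Lemma half_weight_bound z tau n : (0 < Im tau)%R ->
  (half_weight (z + int_C n * tau) / (1 + Cmod (expi (z + int_C n * tau)))
   <= exp (PI * Rabs (Im z)) * geo (PI * Im tau) n)%R.
Proof.
  intros Ht. pose proof PI_RGT_0 as Hpi. rewrite Cmod_expi_half. set (w := z + int_C n * tau).
  set (p := half_weight w). assert (Hp : (0 < p)%R) by apply exp_pos.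
  assert (HI : Im w = (Im z + IZR n * Im tau)%R).
  { unfold w, int_C, Im; simpl; ring. }
  unfold geo. rewrite <- exp_plus.
  pose proof (Rle_abs (Im z)); pose proof (Rle_abs (- Im z)). rewrite Rabs_Ropp in *.
  destruct (Z_le_gt_dec 0 n) as [Hn|Hn].
  - apply Rle_trans with p.
    + apply Rle_div_l; nra.
    + unfold p, half_weight. rewrite HI, Z.abs_eq by lia. apply exp_mono.
      assert (0 <= PI * (Rabs (Im z) + Im z))%R by (apply Rmult_le_pos; lra). lra.
  - apply Rle_trans with (/ p)%R.
    + apply Rle_div_l; [nra|]. replace (/ p * (1 + p * p))%R with (/ p + p)%R by (field; lra).
      pose proof (Rinv_0_lt_compat p Hp). lra.
    + unfold p, half_weight. rewrite <- exp_Ropp, Ropp_involutive.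
      rewrite HI, Z.abs_neq, opp_IZR by lia. apply exp_mono.
      assert (0 <= PI * (Rabs (Im z) - Im z))%R by (apply Rmult_le_pos; lra). lra.
Qed.

(** Symmetric in [x] and [y], although [cot_difference] reaches it from an
    expression which is not. *)
Definition triple (x y : C) : C := expi x * expi y / ((expi x - 1) * (expi y - 1) * (expi x * expi y - 1)).

(** With p^2 = |expi u| and r^2 = |expi v| the bound is, up to a constant, p^2 r^2 over
    (1 + p^2) (1 + r^2) (1 + p^2 r^2).  The third denominator absorbs one factor
    p r, as p r <= 1 + p^2 r^2, and leaves the product of p / (1 + p^2) and
    r / (1 + r^2), each of them exponentially small in both directions. *)
Lemma triple_bound tau x y : (0 < Im tau)%R ->
  off_lattice tau x -> off_lattice tau y -> off_lattice tau (x + y) ->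
  exists K, (0 <= K)%R /\ forall l m : Z,
    (Cmod (triple (x + int_C l * tau) (y + int_C m * tau))
     <= K * (geo (PI * Im tau) l * geo (PI * Im tau) m))%R.
Proof.
  intros Ht Hx Hy Hw.
  destruct (expi_minus_one_bound tau x Ht Hx) as [k1 [P1 B1]].
  destruct (expi_minus_one_bound tau y Ht Hy) as [k2 [P2 B2]].
  destruct (expi_minus_one_bound tau (x + y) Ht Hw) as [k3 [P3 B3]].
  set (cx := exp (PI * Rabs (Im x))). set (cy := exp (PI * Rabs (Im y))).
  assert (Hcx : (0 < cx)%R) by apply exp_pos. assert (Hcy : (0 < cy)%R) by apply exp_pos.
  assert (Hk : (0 < k1 * k2 * k3)%R) by (repeat apply Rmult_lt_0_compat; lra).
  exists (/ (k1 * k2 * k3) * (cx * cy))%R. split.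
  { apply Rmult_le_pos; [left; apply Rinv_0_lt_compat, Hk|nra]. }
  intros l m. set (u := x + int_C l * tau). set (v := y + int_C m * tau).
  assert (Huv : expi u * expi v = expi (x + y + int_C (l + m) * tau)).
  { rewrite <- expi_plus. f_equal. unfold u, v. rewrite int_C_plus. ring. }
  pose proof (half_weight_bound x tau l Ht) as W1. pose proof (half_weight_bound y tau m Ht) as W2.
  fold u cx in W1. fold v cy in W2.
  specialize (B1 l). specialize (B2 m). specialize (B3 (l + m)%Z).
  rewrite <- Huv in B3. fold u in B1. fold v in B2.
  assert (N1 : expi u - 1 <> 0) by apply sub_neq_0, Hx.
  assert (N2 : expi v - 1 <> 0) by apply sub_neq_0, Hy.
  assert (N3 : expi u * expi v - 1 <> 0) by (rewrite Huv; apply sub_neq_0, Hw).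
  unfold triple. rewrite Cmod_div by (repeat apply Cmult_neq_0; auto). rewrite !Cmod_mult.
  rewrite Cmod_mult in B3.
  rewrite (Cmod_expi_half u), (Cmod_expi_half v) in *.
  set (p := half_weight u) in *. set (r := half_weight v) in *.
  assert (Hp : (0 < p)%R) by apply exp_pos. assert (Hr : (0 < r)%R) by apply exp_pos.
  set (d1 := Cmod (expi u - 1)) in *. set (d2 := Cmod (expi v - 1)) in *.
  set (d3 := Cmod (expi u * expi v - 1)) in *.
  assert (Q1 : (0 < 1 + p * p)%R) by nra. assert (Q2 : (0 < 1 + r * r)%R) by nra.
  assert (Q3 : (0 < 1 + p * p * (r * r))%R) by (assert (0 < p * p * (r * r))%R by (apply Rmult_lt_0_compat; nra); lra).
  assert (D1 : (0 < k1 * (1 + p * p))%R) by nra.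
  assert (D2 : (0 < k2 * (1 + r * r))%R) by nra.
  assert (D3 : (0 < k3 * (1 + p * p * (r * r)))%R) by (apply Rmult_lt_0_compat; lra).
  apply Rle_trans with (p * p * (r * r) /
    (k1 * (1 + p * p) * (k2 * (1 + r * r)) * (k3 * (1 + p * p * (r * r)))))%R.
  { apply Rmult_le_compat_l; [apply Rmult_le_pos; nra|]. apply Rinv_le_contravar.
    - repeat apply Rmult_lt_0_compat; lra.
    - apply Rmult_le_compat; [|lra| |lra]; [apply Rmult_le_pos; lra|].
      apply Rmult_le_compat; lra. }
  replace (p * p * (r * r) /
    (k1 * (1 + p * p) * (k2 * (1 + r * r)) * (k3 * (1 + p * p * (r * r)))))%R with
    (/ (k1 * k2 * k3) * ((p * r / (1 + p * p * (r * r))) * ((p / (1 + p * p)) * (r / (1 + r * r)))))%R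
    by (field; repeat split; lra).
  rewrite (Rmult_assoc (/ _)). apply Rmult_le_compat_l; [left; apply Rinv_0_lt_compat, Hk|].
  assert (Z1 : (0 <= p * r / (1 + p * p * (r * r)) <= 1)%R).
  { split; [left; apply Rdiv_lt_0_compat; nra|]. apply Rle_div_l; [lra|].
    assert (0 <= (1 - p * r) * (1 - p * r))%R by apply Rle_0_sqr. nra. }
  assert (Z2 : (0 <= p / (1 + p * p))%R) by (left; apply Rdiv_lt_0_compat; lra).
  assert (Z3 : (0 <= r / (1 + r * r))%R) by (left; apply Rdiv_lt_0_compat; lra).
  apply Rle_trans with (1 * ((cx * geo (PI * Im tau) l) * (cy * geo (PI * Im tau) m)))%R;
    [|right; ring].
  apply Rmult_le_compat; try lra; [apply Rmult_le_pos; lra|].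
  apply Rmult_le_compat; lra.
Qed.

Lemma cotd_1 z : cotd 1 z = - (P2i * P2i) * csq z.
Proof. cbn [cotd csq_deriv Cpow]. ring. Qed.

(** The derivative in [x] of the addition formula of the cotangent. *)
Lemma cot_difference x y : expi x <> 1 -> expi y <> 1 -> expi (x + y) <> 1 ->
  cotd 1 x * (cot (x + y) - cot y) = (P2i * P2i * P2i) * triple x y.
Proof.
  intros Hx Hy Hxy. rewrite cotd_1. unfold csq, cot, triple, P2i. rewrite expi_plus in *.
  assert (1 - expi x <> 0) by (apply sub_neq_0; auto).
  assert (expi x - 1 <> 0) by (apply sub_neq_0; auto).
  assert (expi y - 1 <> 0) by (apply sub_neq_0; auto).
  assert (expi x * expi y - 1 <> 0) by (apply sub_neq_0; auto).
  field. auto.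
Qed.

Lemma triple_sym x y : triple x y = triple y x.
Proof. unfold triple. rewrite (Cmult_comm (expi y) (expi x)), (Cmult_comm (expi y - 1)). reflexivity. Qed.

(** One of the two iterated sums of [triple].  The inner sum of [cot_difference]
    is a difference of values of [Rho 0 0] at x + y + l tau and at y; there
    quasi-periodicity splits off the term - P2i * l, and the factor [l] turns the
    outer sum of the derivatives of the cotangent into [Rho 0 1]. *)
Lemma triple_iterated tau x y : (0 < Im tau)%R ->
  off_lattice tau x -> off_lattice tau y -> off_lattice tau (x + y) ->
  Clim (fun N => Zs (fun l => Zs (fun m =>
      (P2i * P2i * P2i) * triple (x + int_C l * tau) (y + int_C m * tau)) N) N)
    (Rho 1 0 x tau * (Rho 0 0 (x + y) tau - Rho 0 0 y tau) - P2i * Rho 0 1 x tau).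
Proof.
  intros Ht Hx Hy Hw. pose proof PI_RGT_0 as Hpi.
  destruct (triple_bound tau x y Ht Hx Hy Hw) as [K [HK B]].
  set (s := (PI * Im tau)%R) in *. assert (Hs : (0 < s)%R) by (unfold s; nra).
  set (k := Cmod ((P2i * P2i * P2i))). assert (Hk : (0 <= k)%R) by apply Cmod_ge_0.
  assert (HkK : (0 <= k * K)%R) by (apply Rmult_le_pos; lra).
  apply Clim_diff with (fun N => Zs (fun l => cotd 1 (x + int_C l * tau) *
       (Rho 0 0 (x + y) tau - P2i * int_C l - Rho 0 0 y tau)) N).
  1: apply (square_sums (fun m l => (P2i * P2i * P2i) *
      triple (x + int_C l * tau) (y + int_C m * tau))
    (fun n => (1 + k * K) * geo s n)%R (fun N => N)
    (fun l => cotd 1 (x + int_C l * tau) *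
       (Rho 0 0 (x + y) tau - P2i * int_C l - Rho 0 0 y tau))).
  - apply summable_scal; [lra|apply summable_geo, Hs].
  - auto.
  - intros m l. rewrite Cmod_mult. fold k.
    apply Rle_trans with (k * (K * (geo s l * geo s m)))%R.
    { apply Rmult_le_compat_l; [exact Hk|apply B]. }
    pose proof (geo_pos s l); pose proof (geo_pos s m).
    assert (0 < geo s l * geo s m)%R by nra.
    replace (k * (K * (geo s l * geo s m)))%R with ((k * K) * (geo s l * geo s m))%R by ring.
    replace ((1 + k * K) * geo s m * ((1 + k * K) * geo s l))%R with
      ((1 + k * K) * (1 + k * K) * (geo s l * geo s m))%R by ring.
    apply Rmult_le_compat_r; [lra|nra].
  - intros l. set (u := x + int_C l * tau).
    apply Clim_ext with (fun N => cotd 1 u *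
      (Zs (rho_term 0 0 (x + y + int_C l * tau) tau) N - Zs (rho_term 0 0 y tau) N)).
    + intros N. unfold Zs. rewrite <- lsum_minus, <- lsum_scal. apply lsum_ext. intros m _.
      unfold rho_term. cbn [Nat.add Cpow cotd].
      replace (x + y + int_C l * tau + int_C m * tau) with (u + (y + int_C m * tau))
        by (unfold u; ring).
      rewrite <- (cot_difference u (y + int_C m * tau)); [unfold cotd; ring|apply Hx|apply Hy|].
      replace (u + (y + int_C m * tau)) with (x + y + int_C (l + m) * tau)
        by (unfold u; rewrite int_C_plus; ring).
      apply Hw.
    + apply Clim_scal, Clim_minus; [|apply Rho_converges, Ht].
      rewrite <- Rho_add_n_tau by exact Ht. apply Rho_converges, Ht.
  - apply Clim_ext with (fun N => (Rho 0 0 (x + y) tau - Rho 0 0 y tau) * Zs (rho_term 1 0 x tau) N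
      - P2i * Zs (rho_term 0 1 x tau) N).
    + intros N. unfold Zs. rewrite <- !lsum_scal, <- lsum_minus. apply lsum_ext. intros l _.
      unfold rho_term. cbn [Nat.add Cpow]. ring.
    + eapply Clim_val; [apply Clim_minus; apply Clim_scal, Rho_converges, Ht|ring].
Qed.

(** The addition theorem: the two iterated sums of the symmetric family [triple]
    agree, because it is dominated by a product. *)
Lemma Rho_addition tau x y : (0 < Im tau)%R ->
  off_lattice tau x -> off_lattice tau y -> off_lattice tau (x + y) ->
  P2i * (Rho 0 1 x tau - Rho 0 1 y tau) =
  Rho 1 0 x tau * (Rho 0 0 (x + y) tau - Rho 0 0 y tau)
  + Rho 1 0 y tau * (Rho 0 0 x tau - Rho 0 0 (x + y) tau).
Proof.
  intros Ht Hx Hy Hw.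
  pose proof (triple_iterated tau x y Ht Hx Hy Hw) as A.
  rewrite Cplus_comm in Hw. pose proof (triple_iterated tau y x Ht Hy Hx Hw) as B.
  rewrite (Cplus_comm y x) in B.
  assert (B' : Clim (fun N => Zs (fun l => Zs (fun m =>
      (P2i * P2i * P2i) * triple (x + int_C l * tau) (y + int_C m * tau)) N) N)
    (Rho 1 0 y tau * (Rho 0 0 (x + y) tau - Rho 0 0 x tau) - P2i * Rho 0 1 y tau)).
  { apply (Clim_ext _ _ _) with (2 := B). intros N. rewrite Zs_swap.
    unfold Zs. apply lsum_ext. intros l _. apply lsum_ext. intros m _. now rewrite triple_sym. }
  pose proof (Clim_unique _ _ _ A B') as Q.
  replace (P2i * (Rho 0 1 x tau - Rho 0 1 y tau)) with
    (P2i * Rho 0 1 x tau - P2i * Rho 0 1 y tau) by ring.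
  replace (P2i * Rho 0 1 x tau) with
    (Rho 1 0 x tau * (Rho 0 0 (x + y) tau - Rho 0 0 y tau)
     - (Rho 1 0 x tau * (Rho 0 0 (x + y) tau - Rho 0 0 y tau) - P2i * Rho 0 1 x tau)) by ring.
  rewrite Q. ring.
Qed.

(** * Unordered sums *)

(** The two exhausting lists are compared on their union. *)
Lemma is_usum_unique (P : Z * Z -> Prop) f l l' : is_usum P f l -> is_usum P f l' -> l = l'.
Proof.
  intros H H'. apply Cmod_small_eq. intros eps He.
  assert (He2 : (0 < eps / 2)%R) by lra.
  destruct (H (mkposreal _ He2)) as [L [PL K]]. destruct (H' (mkposreal _ He2)) as [L' [PL' K']].
  assert (dec : forall x y : Z * Z, {x = y} + {x <> y}) by (decide equality; apply Z.eq_dec).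
  set (M := nodup dec (L ++ L')).
  assert (PM : List.Forall P M).
  { apply Forall_forall. intros x Hx. apply nodup_In, in_app_iff in Hx.
    rewrite Forall_forall in PL, PL'. destruct Hx; auto. }
  assert (NM : NoDup M) by apply NoDup_nodup.
  specialize (K M PM NM). specialize (K' M PM NM).
  assert (I : incl L M) by (intros x Hx; apply nodup_In, in_app_iff; now left).
  assert (I' : incl L' M) by (intros x Hx; apply nodup_In, in_app_iff; now right).
  specialize (K I). specialize (K' I'). simpl in K, K'.
  set (u := fold_right Cplus 0 (map f M)) in *.
  replace (l - l') with (- (u - l) + (u - l')) by ring.
  eapply Rle_lt_trans; [apply Cmod_triangle|]. rewrite Cmod_opp. lra.
Qed.

Lemma usum_eq (P : Z * Z -> Prop) f l : is_usum P f l -> usum P f = l.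
Proof.
  intros H. apply (iota_unique (V := C_CompleteNormedModule)); [|exact H].
  intros y Hy. exact (is_usum_unique P f y l Hy H).
Qed.

Definition pair_in (L : list (Z * Z)) (p : Z * Z) : bool :=
  existsb (fun p' => (Z.eqb (fst p) (fst p') && Z.eqb (snd p) (snd p'))%bool) L.

Lemma pair_in_spec L p : pair_in L p = true <-> In p L.
Proof.
  unfold pair_in. rewrite existsb_exists. split.
  - intros [q [Hq H]]. apply andb_prop in H. destruct H as [A B].
    apply Z.eqb_eq in A. apply Z.eqb_eq in B. destruct p, q. simpl in *. now subst.
  - intros H. exists p. split; [exact H|]. now rewrite !Z.eqb_refl.
Qed.

Lemma split_by_list (L B : list (Z * Z)) : NoDup L -> NoDup B -> incl L B ->
  Permutation B (L ++ filter (fun p => negb (pair_in L p)) B).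
Proof.
  intros HL HB I. apply NoDup_Permutation; [exact HB| |].
  - apply NoDup_app; [exact HL|apply NoDup_filter, HB|].
    intros p Hp Hq. apply filter_In in Hq. destruct Hq as [_ Hq].
    apply pair_in_spec in Hp. rewrite Hp in Hq. discriminate.
  - intros p. rewrite in_app_iff, filter_In. split.
    + intros H. destruct (pair_in L p) eqn:Q; [left; now apply pair_in_spec|right; auto].
    + intros [H|[H _]]; auto.
Qed.

Lemma rsum_filter_le {T} (h : T -> R) (s t : T -> bool) L :
  (forall x, (0 <= h x)%R) ->
  (forall x, In x L -> s x = true -> h x = 0%R \/ t x = true) ->
  (rsum h (filter s L) <= rsum h (filter t L))%R.
Proof.
  intros H0. induction L as [|x L IH]; simpl; intros H; [lra|].
  assert (IH' := IH (fun y Hy => H y (or_intror Hy))).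
  specialize (H x (or_introl eq_refl)). pose proof (H0 x).
  destruct (s x); destruct (t x); unfold rsum in *; simpl; try lra.
Qed.

Definition square (N : nat) : list (Z * Z) := list_prod (zrange N) (zrange N).

Lemma NoDup_list_prod {S T} (L : list S) (M : list T) : NoDup L -> NoDup M -> NoDup (list_prod L M).
Proof.
  intros HL HM. induction HL as [|x L Hx HL IH]; simpl; [constructor|].
  apply NoDup_app; [|exact IH|].
  - apply FinFun.Injective_map_NoDup; [|exact HM]. intros a b; congruence.
  - intros [a b] H1 H2. apply in_map_iff in H1. destruct H1 as [y [Q _]].
    apply in_prod_iff in H2. injection Q; intros; subst. tauto.
Qed.

Lemma in_square N p : In p (square N) <->
  (Z.abs (fst p) <= Z.of_nat N)%Z /\ (Z.abs (snd p) <= Z.of_nat N)%Z.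
Proof. destruct p as [a b]. unfold square. rewrite in_prod_iff, !in_zrange. reflexivity. Qed.

Lemma in_some_square (L : list (Z * Z)) : exists N, incl L (square N).
Proof.
  induction L as [|[a b] L [N IH]].
  - exists O. intros x [].
  - exists (N + Z.to_nat (Z.abs a) + Z.to_nat (Z.abs b))%nat. intros x [<-|Hx].
    + apply in_square. simpl. lia.
    + specialize (IH x Hx). apply in_square in IH. apply in_square. lia.
Qed.

Lemma square_mono N M : (N <= M)%nat -> incl (square N) (square M).
Proof. intros H p Hp. apply in_square in Hp. apply in_square. lia. Qed.

(** A finite set of indices containing a large square differs from a larger
    square only by indices outside the smaller one, whose total weight is small
    because it is p^2 - r^2 = (p - r) (p + r) for the partial sums r <= p of [a].
    The value 0 of [g] at the origin stands for the omitted term. *)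
Lemma is_usum_of_squares (g : Z -> Z -> C) (a : Z -> R) (m : nat -> nat) (f : Z * Z -> C) (l : C) :
  summable a -> (forall j, (j <= m j)%nat) ->
  (forall x y, (Cmod (g x y) <= a x * a y)%R) ->
  Clim (fun j => Zs (fun y => Zs (fun x => g x y) (m j)) (m j)) l ->
  g 0%Z 0%Z = 0 ->
  (forall p, p <> (0, 0)%Z -> f p = g (fst p) (snd p)) ->
  is_usum (fun p => p <> (0, 0)%Z) f l.
Proof.
  intros Ha Hm Hg Hl Hg0 Hf eps.
  pose proof Ha as [Ha0 [S HS]].
  assert (HS0 : (0 <= S)%R).
  { eapply Rle_trans; [|apply (HS O)]. apply rsum_nonneg; auto. }
  pose proof (cond_pos eps) as He.
  set (G := fun p : Z * Z => g (fst p) (snd p)).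
  set (A := fun p : Z * Z => (a (fst p) * a (snd p))%R).
  assert (HA : forall p, (0 <= A p)%R) by (intros p; apply Rmult_le_pos; auto).
  assert (HGA : forall p, (Cmod (G p) <= A p)%R) by (intros p; apply Hg).
  destruct (summable_tail a Ha (eps / (8 * (S + 1)))%R) as [N0 K0].
  { apply Rdiv_lt_0_compat; lra. }
  destruct (Hl (eps / 2)%R ltac:(lra)) as [N1 K1].
  set (j := (N0 + N1)%nat). specialize (K1 j ltac:(lia)).
  set (N := m j) in *. assert (HN : (N0 <= N)%nat) by (specialize (Hm j); lia).
  assert (nz : forall p : Z * Z, {p = (0, 0)%Z} + {p <> (0, 0)%Z})
    by (intros; decide equality; apply Z.eq_dec).
  set (isnz := fun p : Z * Z => if nz p then false else true).
  set (L0 := filter isnz (square N)).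
  assert (HfG : forall L, List.Forall (fun p => p <> (0, 0)%Z) L ->
            fold_right Cplus 0 (map f L) = lsum G L).
  { intros L HL. rewrite Forall_forall in HL. apply lsum_ext. intros p Hp. apply Hf, HL, Hp. }
  exists L0. split.
  { apply Forall_forall. intros p Hp. apply filter_In in Hp. destruct Hp as [_ Hp].
    unfold isnz in Hp. destruct (nz p); [discriminate|assumption]. }
  intros L PL NL I. rewrite HfG by exact PL.
  destruct (in_some_square L) as [M' HM'].
  set (M := (M' + N)%nat).
  assert (IM : incl L (square M)).
  { intros p Hp. apply (square_mono M' M); [unfold M; lia|apply HM', Hp]. }
  assert (IN : incl (square N) (square M)) by (apply square_mono; unfold M; lia).
  assert (ND : forall n, NoDup (square n)) by (intros; apply NoDup_list_prod; apply NoDup_zrange).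
  pose proof (split_by_list L (square M) NL (ND M) IM) as PLM.
  pose proof (split_by_list (square N) (square M) (ND N) (ND M) IN) as PNM.
  assert (SQ : lsum G (square N) = Zs (fun y => Zs (fun x => g x y) N) N).
  { rewrite Zs_swap. unfold square. rewrite (lsum_prod g). reflexivity. }
  rewrite <- SQ in K1.
  assert (RS : forall n, rsum A (square n) = (rsum a (zrange n) * rsum a (zrange n))%R)
    by (intros; apply rsum_prod).
  assert (RA : (rsum A (filter (fun p => negb (pair_in (square N) p)) (square M)) <= eps / 4)%R).
  { pose proof (rsum_perm A _ _ PNM) as Q. rewrite rsum_app, !RS in Q.
    set (t := rsum A (filter _ _)) in *.
    pose proof (HS M); pose proof (HS N).
    specialize (K0 M ltac:(unfold M; lia)) as K2.
    pose proof (rsum_zrange_mono a N0 N Ha0 HN).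
    pose proof (rsum_zrange_mono a N M Ha0 ltac:(unfold M; lia)).
    pose proof (rsum_nonneg a (zrange N) (fun n _ => Ha0 n)).
    set (p := rsum a (zrange M)) in *. set (r := rsum a (zrange N)) in *.
    replace t with ((p - r) * (p + r))%R by lra.
    apply Rle_trans with (eps / (8 * (S + 1)) * (2 * (S + 1)))%R.
    - apply Rmult_le_compat; lra.
    - right. field. lra. }
  set (B := fun p => if isnz p then A p else 0%R).
  assert (HB : forall p, (0 <= B p <= A p)%R).
  { intros p. unfold B. pose proof (HA p). destruct (isnz p); lra. }
  assert (HGB : forall p, (Cmod (G p) <= B p)%R).
  { intros p. unfold B, isnz. destruct (nz p) as [->|]; [|apply HGA].
    unfold G. simpl. rewrite Hg0, Cmod_0. lra. }
  pose proof (lsum_perm G _ _ PLM) as QL. pose proof (lsum_perm G _ _ PNM) as QN.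
  rewrite lsum_app in QL, QN.
  pose proof (lsum_bound G B (filter (fun p => negb (pair_in L p)) (square M)) (fun p _ => HGB p)) as B1.
  pose proof (lsum_bound G A (filter (fun p => negb (pair_in (square N) p)) (square M)) (fun p _ => HGA p)) as B2.
  assert (B3 : (rsum B (filter (fun p => negb (pair_in L p)) (square M))
                <= rsum A (filter (fun p => negb (pair_in (square N) p)) (square M)))%R).
  { eapply Rle_trans; [apply rsum_filter_le with (t := fun p => negb (pair_in (square N) p))|].
    - intros p; apply HB.
    - intros p _ Hp. unfold B. destruct (isnz p) eqn:Q; [right|now left].
      destruct (pair_in (square N) p) eqn:Q2; [|reflexivity].
      apply pair_in_spec in Q2.
      assert (In p L) by (apply I, filter_In; auto).
      apply pair_in_spec in H. rewrite H in Hp. discriminate.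
    - apply rsum_le. intros p _. apply HB. }
  set (x := lsum G (filter (fun p => negb (pair_in L p)) (square M))) in *.
  set (y := lsum G (filter (fun p => negb (pair_in (square N) p)) (square M))) in *.
  replace (lsum G L - l) with ((lsum G (square N) - l) + y + - x).
  - eapply Rle_lt_trans; [apply Cmod_tri3|]. rewrite Cmod_opp. lra.
  - replace (lsum G L) with (lsum G (square M) - x) by (rewrite QL; ring).
    rewrite QN. ring.
Qed.

(** * Partial fractions of the cotangent *)

Lemma RtoC_neq (x y : R) : x <> y -> RtoC x <> RtoC y.
Proof. intros H Q. apply RtoC_inj in Q. auto. Qed.

(** The expansions of the cotangent and of its derivative in partial fractions
    come from the division of the period by powers of 3: an odd number keeps the
    ranges of summation symmetric, and powers of a fixed number allow induction. *)
Definition omega : C := expi (/ 3).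

Lemma three_neq_0 : RtoC 3 <> 0.
Proof. apply RtoC_neq; lra. Qed.

Lemma omega_cube : omega * omega * omega = 1.
Proof.
  pose proof three_neq_0.
  unfold omega. rewrite <- !expi_plus. replace (/ 3 + / 3 + / 3) with (int_C 1); [apply expi_int|].
  unfold int_C. field; auto.
Qed.

Lemma omega_sum : 1 + omega + omega * omega = 0.
Proof.
  pose proof three_neq_0.
  assert (N : omega - 1 <> 0).
  { apply sub_neq_0. intros Q. unfold omega in Q. apply expi_eq_1 in Q. destruct Q as [n Hn].
    assert (Q : RtoC 1 = int_C (3 * n)).
    { unfold int_C in *. rewrite mult_IZR, RtoC_mult, <- Hn. field; auto. }
    unfold int_C in Q. apply RtoC_inj, eq_IZR in Q. lia. }
  replace (1 + omega + omega * omega) with ((omega * omega * omega - 1) / (omega - 1)) by (field; auto).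
  rewrite omega_cube. field; auto.
Qed.

Lemma expi_add_third (z : C) : expi ((z + 1) / 3) = expi (z / 3) * omega.
Proof.
  pose proof three_neq_0. unfold omega. rewrite <- expi_plus. f_equal. field; auto.
Qed.

Lemma expi_sub_third (z : C) : expi ((z - 1) / 3) = expi (z / 3) * (omega * omega).
Proof.
  pose proof three_neq_0. unfold omega. rewrite <- !expi_plus.
  replace (z / 3 + (/ 3 + / 3)) with ((z - 1) / 3 + int_C 1) by (unfold int_C; field; auto).
  rewrite expi_plus, expi_int. ring.
Qed.

Lemma expi_third_cube (z : C) : expi (z / 3) * expi (z / 3) * expi (z / 3) = expi z.
Proof. pose proof three_neq_0. rewrite <- !expi_plus. f_equal. field; auto. Qed.

(** The elementary symmetric functions of the three factors of [y ^ 3 - 1]. *)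
Lemma third_factors (y : C) :
  let a := y - 1 in let b := y * omega - 1 in let c := y * (omega * omega) - 1 in
  a * b * c = y * y * y - 1 /\ a * b + b * c + c * a = 3 /\ a + b + c = - (3).
Proof.
  cbv zeta. set (s := 1 + omega + omega * omega).
  assert (Hs : s = 0) by apply omega_sum. split; [|split].
  - transitivity (y * y * y * (omega * omega * omega) - y * y * (omega * s) + y * s - 1);
      [unfold s; ring|]. rewrite Hs, omega_cube. ring.
  - transitivity (y * y * (omega * s) - 2 * (y * s) + 3); [unfold s; ring|]. rewrite Hs. ring.
  - transitivity (y * s - 3); [unfold s; ring|]. rewrite Hs. ring.
Qed.

Lemma third_neq_1 (z : C) : expi z <> 1 ->
  expi (z / 3) - 1 <> 0 /\ expi ((z + 1) / 3) - 1 <> 0 /\ expi ((z - 1) / 3) - 1 <> 0.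
Proof.
  intros H. rewrite expi_add_third, expi_sub_third.
  destruct (third_factors (expi (z / 3))) as [P _]. rewrite expi_third_cube in P.
  apply sub_neq_0 in H. rewrite <- P in H.
  repeat split; intros Q; rewrite Q in H; apply H; ring.
Qed.

(** The power sums of the inverses of the three factors of y^3 - 1, from the
    elementary symmetric functions of the factors. *)
Lemma inv_third (z : C) : expi z <> 1 ->
  / (expi (z / 3) - 1) + / (expi ((z + 1) / 3) - 1) + / (expi ((z - 1) / 3) - 1) = 3 / (expi z - 1) /\
  / (expi (z / 3) - 1) * / (expi (z / 3) - 1) + / (expi ((z + 1) / 3) - 1) * / (expi ((z + 1) / 3) - 1)
  + / (expi ((z - 1) / 3) - 1) * / (expi ((z - 1) / 3) - 1)
  = 9 / ((expi z - 1) * (expi z - 1)) + 6 / (expi z - 1).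
Proof.
  intros H. destruct (third_neq_1 z H) as [A [B D]].
  rewrite expi_add_third, expi_sub_third in *.
  destruct (third_factors (expi (z / 3))) as [P [Q S]]. rewrite expi_third_cube in P.
  cbv zeta in *.
  set (a := expi (z / 3) - 1) in *. set (b := expi (z / 3) * omega - 1) in *.
  set (c := expi (z / 3) * (omega * omega) - 1) in *.
  assert (I : / a + / b + / c = 3 / (expi z - 1)).
  { rewrite <- P, <- Q. field; auto. }
  split; [exact I|].
  transitivity ((/ a + / b + / c) * (/ a + / b + / c) - 2 * (a + b + c) * / (a * b * c)).
  - field; auto.
  - rewrite I, S, P. field. apply sub_neq_0, H.
Qed.

Lemma cot_inv z : expi z <> 1 -> cot z = PI * Ci + 2 * PI * Ci * / (expi z - 1).
Proof. intros H. rewrite <- cot_lower by exact H. ring. Qed.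

Lemma csq_inv z : expi z <> 1 -> csq z = / (expi z - 1) + / (expi z - 1) * / (expi z - 1).
Proof.
  intros H. assert (expi z - 1 <> 0) by (apply sub_neq_0; auto).
  assert (1 - expi z <> 0) by (apply sub_neq_0; auto). unfold csq. field; auto.
Qed.

Lemma expi_third_neq_1 (z : C) : expi z <> 1 ->
  expi (z / 3) <> 1 /\ expi ((z + 1) / 3) <> 1 /\ expi ((z - 1) / 3) <> 1.
Proof.
  intros H. destruct (third_neq_1 z H) as [A [B D]].
  repeat split; intros Q; rewrite Q in *; [apply A|apply B|apply D]; ring.
Qed.

Lemma cot_third z : expi z <> 1 ->
  cot (z / 3) + cot ((z + 1) / 3) + cot ((z - 1) / 3) = 3 * cot z.
Proof.
  intros H. destruct (expi_third_neq_1 z H) as [A [B D]].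
  rewrite !cot_inv by assumption. destruct (inv_third z H) as [I _].
  transitivity (3 * (PI * Ci) + 2 * PI * Ci *
    (/ (expi (z / 3) - 1) + / (expi ((z + 1) / 3) - 1) + / (expi ((z - 1) / 3) - 1))); [ring|].
  rewrite I. unfold Cdiv. ring.
Qed.

Lemma csq_third z : expi z <> 1 ->
  csq (z / 3) + csq ((z + 1) / 3) + csq ((z - 1) / 3) = 9 * csq z.
Proof.
  intros H. destruct (expi_third_neq_1 z H) as [A [B D]].
  rewrite !csq_inv by assumption. destruct (inv_third z H) as [I J].
  set (a := / (expi (z / 3) - 1)) in *. set (b := / (expi ((z + 1) / 3) - 1)) in *.
  set (c := / (expi ((z - 1) / 3) - 1)) in *.
  transitivity ((a + b + c) + (a * a + b * b + c * c)); [ring|]. rewrite I, J.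
  field. apply sub_neq_0, H.
Qed.

(** [2 * tri j + 1 = 3 ^ j], so that the integers of absolute value at most
    [tri j] represent all residues modulo [3 ^ j]. *)
Fixpoint tri (j : nat) : nat := match j with O => O | S j' => (tri j' + 3 ^ j')%nat end.

Lemma tri_pow j : (2 * tri j + 1 = 3 ^ j)%nat.
Proof. induction j as [|j IH]; [reflexivity|]. cbn [tri]. rewrite Nat.pow_succ_r'. lia. Qed.

Lemma tri_ge j : (j <= tri j)%nat.
Proof. induction j as [|j IH]; [simpl; lia|]. cbn [tri]. pose proof (tri_pow j). lia. Qed.

Definition pow3 (j : nat) : C := int_C (Z.of_nat (3 ^ j)).

Lemma pow3_S j : pow3 (S j) = 3 * pow3 j.
Proof.
  unfold pow3, int_C. rewrite Nat.pow_succ_r', Nat2Z.inj_mul, mult_IZR, RtoC_mult. reflexivity.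
Qed.

Lemma Cmod_pow3 j : Cmod (pow3 j) = INR (3 ^ j).
Proof.
  unfold pow3, int_C. rewrite <- INR_IZR_INZ, Cmod_R. apply Rabs_pos_eq, pos_INR.
Qed.

Lemma pow3_ge j : (INR j + 1 <= INR (3 ^ j))%R.
Proof.
  rewrite <- S_INR. apply le_INR. pose proof (tri_ge j). pose proof (tri_pow j). lia.
Qed.

Lemma pow3_neq_0 j : pow3 j <> 0.
Proof.
  apply Cmod_gt_0. rewrite Cmod_pow3. pose proof (pow3_ge j). pose proof (pos_INR j). lra.
Qed.

(** The three blocks of length 3^j of the integers up to [tri (S j)]. *)
Lemma Zs_tri f j : Zs f (tri (S j)) =
  Zs (fun n => f n + f (n + Z.of_nat (3 ^ j))%Z + f (n - Z.of_nat (3 ^ j))%Z) (tri j).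
Proof.
  set (q := Z.of_nat (3 ^ j)). pose proof (tri_pow j) as Hq.
  unfold Zs. rewrite !lsum_plus.
  rewrite <- (lsum_map (fun n => n + q)%Z f), <- (lsum_map (fun n => n - q)%Z f), <- !lsum_app.
  apply lsum_perm, NoDup_Permutation.
  - apply NoDup_zrange.
  - assert (I1 : FinFun.Injective (fun n => n + q)%Z) by (intros x y H; lia).
    assert (I2 : FinFun.Injective (fun n => n - q)%Z) by (intros x y H; lia).
    pose proof (FinFun.Injective_map_NoDup I1 (NoDup_zrange (tri j))).
    pose proof (FinFun.Injective_map_NoDup I2 (NoDup_zrange (tri j))).
    apply NoDup_app; [apply NoDup_app; [apply NoDup_zrange|assumption|]|assumption|].
    + intros x. rewrite in_zrange, in_map_iff. intros Hx [y [<- Hy]]. apply in_zrange in Hy. lia.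
    + intros x. rewrite in_app_iff, in_zrange, !in_map_iff.
      intros [Hx|[z [<- Hz]]] [y [E1 Hy]]; apply in_zrange in Hy; try apply in_zrange in Hz; lia.
  - intros x. rewrite !in_app_iff, !in_map_iff, !in_zrange. cbn [tri]. split.
    + intros Hx. destruct (Z_le_gt_dec (Z.abs x) (Z.of_nat (tri j))); [tauto|].
      destruct (Z_le_gt_dec 0 x).
      * left; right. exists (x - q)%Z. rewrite in_zrange. lia.
      * right. exists (x + q)%Z. rewrite in_zrange. lia.
    + intros [[Hx|[y [<- Hy]]]|[y [<- Hy]]]; try apply in_zrange in Hy; lia.
Qed.

Lemma expi_div_pow3 z n j : expi z <> 1 -> expi ((z + int_C n) / pow3 j) <> 1.
Proof.
  intros H Q. apply expi_eq_1 in Q. destruct Q as [k Hk]. apply H, expi_eq_1.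
  exists (k * Z.of_nat (3 ^ j) - n)%Z.
  replace (int_C (k * Z.of_nat (3 ^ j) - n)) with (int_C k * pow3 j - int_C n).
  - rewrite <- Hk. field. apply pow3_neq_0.
  - unfold pow3, int_C. rewrite minus_IZR, mult_IZR, RtoC_minus, RtoC_mult. reflexivity.
Qed.

Lemma three_blocks z n j :
  (z + int_C n) / pow3 (S j) = (z + int_C n) / pow3 j / 3 /\
  (z + int_C (n + Z.of_nat (3 ^ j))) / pow3 (S j) = ((z + int_C n) / pow3 j + 1) / 3 /\
  (z + int_C (n - Z.of_nat (3 ^ j))) / pow3 (S j) = ((z + int_C n) / pow3 j - 1) / 3.
Proof.
  pose proof three_neq_0. pose proof (pow3_neq_0 j).
  rewrite pow3_S. unfold Z.sub. rewrite !int_C_plus, int_C_opp.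
  fold (pow3 j). repeat split; field; auto.
Qed.

Lemma cot_division z j : expi z <> 1 ->
  Zs (fun n => cot ((z + int_C n) / pow3 j)) (tri j) = pow3 j * cot z.
Proof.
  intros H. induction j as [|j IH].
  - rewrite Zs_O. unfold pow3, int_C. simpl. replace ((z + 0) / 1) with z by field. ring.
  - rewrite Zs_tri.
    replace (pow3 (S j) * cot z) with (3 * (pow3 j * cot z)) by (rewrite pow3_S; ring).
    rewrite <- IH. unfold Zs. rewrite <- lsum_scal.
    apply lsum_ext. intros n _.
    cbv beta. destruct (three_blocks z n j) as [-> [-> ->]]. apply cot_third, expi_div_pow3, H.
Qed.

Lemma csq_division z j : expi z <> 1 ->
  Zs (fun n => csq ((z + int_C n) / pow3 j)) (tri j) = pow3 j * pow3 j * csq z.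
Proof.
  intros H. induction j as [|j IH].
  - rewrite Zs_O. unfold pow3, int_C. simpl. replace ((z + 0) / 1) with z by field. ring.
  - rewrite Zs_tri.
    replace (pow3 (S j) * pow3 (S j) * csq z) with (9 * (pow3 j * pow3 j * csq z))
      by (rewrite pow3_S; ring).
    rewrite <- IH. unfold Zs. rewrite <- lsum_scal.
    apply lsum_ext. intros n _.
    cbv beta. destruct (three_blocks z n j) as [-> [-> ->]]. apply csq_third, expi_div_pow3, H.
Qed.

(** The two roots of unity which the induction of [csq_sum_roots] adds to the
    deleted term. *)
Lemma csq_omega : csq (1 / 3) = - / 3 /\ csq (- (1) / 3) = - / 3.
Proof.
  pose proof three_neq_0.
  replace (- (1) / 3) with (- (1 / 3)) by (field; auto). rewrite csq_opp.
  assert (N : 1 - omega <> 0).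
  { intros Q. assert (Q' : omega = 1) by (replace omega with (1 - (1 - omega)) by ring; rewrite Q; ring).
    pose proof omega_sum as S. rewrite Q' in S. apply three_neq_0.
    transitivity (RtoC 1 + 1 + 1 * 1); [ring|exact S]. }
  assert (Q : csq (1 / 3) = - / 3).
  { unfold csq. replace (1 / 3) with (/ 3) by (field; auto). fold omega.
    assert (S : (1 - omega) * (1 - omega) = - (3) * omega).
    { transitivity ((1 + omega + omega * omega) - 3 * omega); [ring|]. rewrite omega_sum. ring. }
    assert (omega <> 0) by apply expi_neq_0.
    rewrite S. field; auto. }
  auto.
Qed.

Definition nonzero_part (f : Z -> C) (n : Z) : C := if Z.eq_dec n 0 then 0 else f n.

Lemma expi_int_div_pow3 n j : n <> 0%Z -> (Z.abs n <= Z.of_nat (tri j))%Z -> expi (int_C n / pow3 j) <> 1.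
Proof.
  intros Hn Hb Q. apply expi_eq_1 in Q. destruct Q as [k Hk].
  assert (A : int_C n = int_C (k * Z.of_nat (3 ^ j))).
  { replace (int_C (k * Z.of_nat (3 ^ j))) with (int_C k * pow3 j)
      by (unfold pow3, int_C; rewrite mult_IZR, RtoC_mult; reflexivity).
    rewrite <- Hk. field. apply pow3_neq_0. }
  unfold int_C in A. apply RtoC_inj, eq_IZR in A. pose proof (tri_pow j).
  assert (k <> 0%Z) by (intros ->; apply Hn; rewrite A; reflexivity).
  rewrite A, Z.abs_mul in Hb. assert (1 <= Z.abs k)%Z by lia.
  rewrite (Z.abs_eq (Z.of_nat _)) in Hb by lia.
  assert (Z.of_nat (3 ^ j) = 2 * Z.of_nat (tri j) + 1)%Z by lia. nia.
Qed.

(** A finite form of the value of the Riemann zeta function at 2, which is needed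
    for the row of the lattice through 0. *)
Lemma csq_sum_roots j :
  Zs (nonzero_part (fun n => csq (int_C n / pow3 j))) (tri j) = (1 - pow3 j * pow3 j) / 12.
Proof.
  pose proof three_neq_0 as H3. assert (H12 : RtoC 12 <> 0) by (apply RtoC_neq; lra).
  induction j as [|j IH].
  - rewrite Zs_O. unfold nonzero_part, pow3, int_C. simpl. field; auto.
  - rewrite Zs_tri.
    assert (S : Zs (fun n => nonzero_part (fun n => csq (int_C n / pow3 (S j))) n
        + nonzero_part (fun n => csq (int_C n / pow3 (S j))) (n + Z.of_nat (3 ^ j))
        + nonzero_part (fun n => csq (int_C n / pow3 (S j))) (n - Z.of_nat (3 ^ j))) (tri j)
      = Zs (fun n => 9 * nonzero_part (fun n => csq (int_C n / pow3 j)) n) (tri j)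
        + Zs (fun n => if Z.eq_dec n 0 then - (2) / 3 else 0) (tri j)).
    { unfold Zs. rewrite <- lsum_plus. apply lsum_ext. intros n Hn. apply in_zrange in Hn.
      pose proof (tri_pow j) as T.
      destruct (three_blocks 0 n j) as [A [B D]]. rewrite (Cplus_0_l (int_C n)) in A, B, D. rewrite Cplus_0_l in B, D.
      unfold nonzero_part.
      destruct (Z.eq_dec (n + Z.of_nat (3 ^ j)) 0); [lia|].
      destruct (Z.eq_dec (n - Z.of_nat (3 ^ j)) 0); [lia|].
      rewrite A, B, D. destruct (Z.eq_dec n 0) as [->|N].
      - pose proof (pow3_neq_0 j).
        replace ((int_C 0 / pow3 j + 1) / 3) with (1 / 3) by (unfold int_C; field; auto).
        replace ((int_C 0 / pow3 j - 1) / 3) with (- (1) / 3) by (unfold int_C; field; auto).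
        destruct csq_omega as [-> ->]. field; auto.
      - rewrite csq_third by (apply expi_int_div_pow3; auto). ring. }
    rewrite S. clear S.
    assert (S0 : forall N c, Zs (fun n => if Z.eq_dec n 0 then c else 0) N = c).
    { induction N as [|N IHN]; intros c.
      - rewrite Zs_O. reflexivity.
      - rewrite Zs_S, IHN. destruct (Z.eq_dec (Z.of_nat (S N)) 0); [lia|].
        destruct (Z.eq_dec (- Z.of_nat (S N)) 0); [lia|]. ring. }
    rewrite S0. unfold Zs. rewrite lsum_scal. fold (Zs (nonzero_part (fun n => csq (int_C n / pow3 j))) (tri j)).
    rewrite IH, pow3_S. field; auto.
Qed.

(** * Bounds for the exponential near 0 *)

Lemma expi_minus_one_upper (Y : R) : exists K, (0 <= K)%R /\
  forall h, (Cmod h <= Y)%R -> (Cmod (expi h - 1) <= K * Cmod h)%R.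
Proof.
  exists (2 * (Cmod P2i * exp (2 * PI * Y)))%R. split.
  { pose proof (Cmod_ge_0 P2i). pose proof (exp_pos (2 * PI * Y)). nra. }
  intros h Hh. pose proof PI_RGT_0.
  pose proof (mean_value_inequality expi (fun y => P2i * expi y) 0 h (Cmod P2i * exp (2 * PI * Y))) as V.
  rewrite expi_0 in V. replace (h - 0) with h in V by ring. apply V.
  intros y Hy. replace (y - 0) with y in Hy by ring. split; [apply D_expi|].
  rewrite Cmod_mult, Cmod_expi. apply Rmult_le_compat_l; [apply Cmod_ge_0|]. apply exp_mono.
  pose proof (im_le_Cmod y). pose proof (Rle_abs (- Im y)). rewrite Rabs_Ropp in *.
  assert (0 <= PI * (Y + Im y))%R by (apply Rmult_le_pos; lra). lra.
Qed.

(** Any bound strictly between 1 / 2 and 1 would do instead of 3 / 4: sums over a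
    full period have arguments of real part up to about 1 / 2, and the next zero
    of the sine is at 1. *)
Lemma sin_lower : exists k, (0 < k)%R /\
  forall x, (Rabs x <= 3 / 4)%R -> (k * Rabs x <= Rabs (sin (PI * x)))%R.
Proof.
  pose proof PI_RGT_0 as Hpi.
  set (c := cos (3 * PI / 8)). assert (Hc : (0 < c)%R) by (apply cos_gt_0; lra).
  assert (P : forall x, (0 <= x <= 3 / 4)%R -> (PI * (c * c) * x <= sin (PI * x))%R).
  { intros x Hx. set (t := (PI * x / 2)%R).
    assert (Ht : (0 <= t <= 3 * PI / 8)%R).
    { unfold t. assert (0 <= PI * x)%R by (apply Rmult_le_pos; lra).
      assert (0 <= PI * (3 / 4 - x))%R by (apply Rmult_le_pos; lra). lra. }
    replace (PI * x)%R with (2 * t)%R by (unfold t; field).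
    replace (PI * (c * c) * x)%R with (2 * ((t * c) * c))%R by (unfold t; field).
    rewrite sin_2a, (Rmult_assoc 2 (sin t)). apply Rmult_le_compat_l; [lra|].
    assert (Hcos : (c <= cos t)%R) by (apply cos_decr_1; lra).
    assert (Hsin : (t * c <= sin t)%R).
    { destruct (Req_dec t 0) as [->|N]; [rewrite sin_0; lra|].
      destruct (MVT_cor2 sin cos 0 t) as [u [Hu1 Hu2]]; [lra|intros; apply derivable_pt_lim_sin|].
      rewrite sin_0, !Rminus_0_r in Hu1. rewrite Hu1.
      assert (c <= cos u)%R by (apply cos_decr_1; lra).
      rewrite Rmult_comm.
      apply Rmult_le_compat_r; lra. }
    apply Rmult_le_compat; [apply Rmult_le_pos; lra|lra|exact Hsin|exact Hcos]. }
  exists (PI * (c * c))%R. split; [apply Rmult_lt_0_compat; [lra|apply Rmult_lt_0_compat; lra]|]. intros x Hx.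
  destruct (Rle_lt_dec 0 x) as [H0|H0].
  - rewrite (Rabs_pos_eq x) in * by lra.
    eapply Rle_trans; [apply P; lra|apply Rle_abs].
  - rewrite (Rabs_left x) in * by lra.
    eapply Rle_trans; [apply P; lra|].
    replace (PI * - x)%R with (- (PI * x))%R by ring.
    rewrite sin_neg. rewrite <- Rabs_Ropp. apply Rle_abs.
Qed.

Lemma exp_lower (Y : R) : (0 <= Y)%R -> exists k, (0 < k)%R /\
  forall y, (Rabs y <= Y)%R -> (k * Rabs y <= Rabs (exp (- (2 * PI * y)) - 1))%R.
Proof.
  intros HY. pose proof PI_RGT_0 as Hpi.
  assert (HD : (1 <= 1 + 2 * PI * Y)%R) by nra.
  exists (2 * PI / (1 + 2 * PI * Y))%R. split; [apply Rdiv_lt_0_compat; lra|].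
  intros y Hy. destruct (Rle_lt_dec 0 y) as [H0|H0].
  - rewrite (Rabs_pos_eq y) in * by lra.
    assert (Hu : (0 <= 2 * PI * y)%R) by nra.
    assert (Hu' : (2 * PI * y <= 2 * PI * Y)%R) by nra.
    set (u := (2 * PI * y)%R) in *.
    pose proof (exp_ineq1_le u) as L. rewrite exp_Ropp.
    rewrite <- Rabs_Ropp. eapply Rle_trans; [|apply Rle_abs].
    apply Rle_trans with (1 - / (1 + u))%R.
    + replace (1 - / (1 + u))%R with (u / (1 + u))%R by (field; lra).
      replace (2 * PI / (1 + 2 * PI * Y) * y)%R with (u / (1 + 2 * PI * Y))%R by (unfold u; field; lra).
      apply Rmult_le_compat_l; [exact Hu|]. apply Rinv_le_contravar; lra.
    + assert (/ exp u <= / (1 + u))%R by (apply Rinv_le_contravar; lra). lra.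
  - rewrite (Rabs_left y) in * by lra.
    eapply Rle_trans; [|apply Rle_abs].
    pose proof (exp_ineq1_le (- (2 * PI * y))) as L.
    apply Rle_trans with (2 * PI * - y)%R; [|lra].
    apply Rmult_le_compat_r; [lra|].
    apply Rle_div_l; [lra|]. assert (0 <= 2 * PI * (2 * PI * Y))%R by (apply Rmult_le_pos; nra). lra.
Qed.

(** The distance from 1 splits into the change of modulus and the change of
    argument, which are bounded below separately. *)
Lemma expi_minus_one_sq h :
  (Cmod (expi h - 1) ^ 2 = (exp (- (2 * PI * Im h)) - 1) ^ 2
     + (2 * exp (- (PI * Im h)) * sin (PI * Re h)) ^ 2)%R.
Proof.
  rewrite Cmod2_alt. destruct h as [x y].
  assert (R1 : Re (expi (x, y) - 1) = (exp (- (2 * PI * y)) * cos (2 * (PI * x)) - 1)%R).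
  { unfold expi, C_exp, P2i, Re, Im. simpl.
    match goal with |- (exp ?a * cos ?b + _)%R = _ =>
      replace a with (- (2 * PI * y))%R by ring; replace b with (2 * (PI * x))%R by ring end. ring. }
  assert (I1 : Im (expi (x, y) - 1) = (exp (- (2 * PI * y)) * sin (2 * (PI * x)))%R).
  { unfold expi, C_exp, P2i, Re, Im. simpl.
    match goal with |- (exp ?a * sin ?b + _)%R = _ =>
      replace a with (- (2 * PI * y))%R by ring; replace b with (2 * (PI * x))%R by ring end. ring. }
  rewrite R1, I1. simpl Re. simpl Im.
  assert (X : exp (- (2 * PI * y)) = (exp (- (PI * y)) * exp (- (PI * y)))%R).
  { rewrite <- exp_plus. f_equal. ring. }
  rewrite cos_2a_sin, sin_2a. pose proof (sin2_cos2 (PI * x)) as T. unfold Rsqr in T.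
  set (s := sin (PI * x)) in *. set (c := cos (PI * x)) in *.
  set (e := exp (- (2 * PI * y))) in *. set (r := exp (- (PI * y))) in *.
  replace ((2 * r * s) ^ 2)%R with (4 * e * (s * s))%R by (rewrite X; ring).
  replace ((e * (2 * s * c)) ^ 2)%R with (4 * e * e * (s * s) * (c * c))%R by ring.
  replace (c * c)%R with (1 - s * s)%R by lra. ring.
Qed.

Lemma expi_minus_one_lower (Y : R) : (0 <= Y)%R -> exists k, (0 < k)%R /\
  forall h, (Rabs (Re h) <= 3 / 4)%R -> (Rabs (Im h) <= Y)%R ->
    (k * Cmod h <= Cmod (expi h - 1))%R.
Proof.
  intros HY. pose proof PI_RGT_0 as Hpi.
  destruct sin_lower as [k1 [Hk1 K1]]. destruct (exp_lower Y HY) as [k2 [Hk2 K2]].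
  set (m := (2 * exp (- (PI * Y)) * k1)%R).
  assert (Hm : (0 < m)%R).
  { unfold m. pose proof (exp_pos (- (PI * Y))). nra. }
  exists (Rmin m k2 / 2)%R. split.
  { pose proof (Rmin_pos m k2 Hm Hk2). lra. }
  intros h Hx Hy.
  pose proof (expi_minus_one_sq h) as S.
  set (d := Cmod (expi h - 1)) in *. assert (Hd : (0 <= d)%R) by apply Cmod_ge_0.
  assert (A : (k2 * Rabs (Im h) <= d)%R).
  { eapply Rle_trans; [apply K2, Hy|]. apply Rsqr_incr_0_var; [|exact Hd].
    rewrite <- Rsqr_abs. unfold Rsqr.
    pose proof (pow2_ge_0 (2 * exp (- (PI * Im h)) * sin (PI * Re h))). nra. }
  assert (B : (m * Rabs (Re h) <= d)%R).
  { apply Rle_trans with (Rabs (2 * exp (- (PI * Im h)) * sin (PI * Re h)))%R.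
    - rewrite !Rabs_mult, (Rabs_pos_eq 2), (Rabs_pos_eq (exp _)) by (try lra; left; apply exp_pos).
      unfold m. rewrite !Rmult_assoc. apply Rmult_le_compat_l; [lra|].
      apply Rmult_le_compat; [left; apply exp_pos| |apply exp_mono|apply K1, Hx].
      + pose proof (Rabs_pos (Re h)). nra.
      + pose proof (Rle_abs (Im h)). assert (0 <= PI * (Y - Im h))%R by (apply Rmult_le_pos; lra). lra.
    - apply Rsqr_incr_0_var; [|exact Hd]. rewrite <- Rsqr_abs. unfold Rsqr.
      pose proof (pow2_ge_0 (exp (- (2 * PI * Im h)) - 1)). nra. }
  pose proof (Cmod_le_Re_Im h). pose proof (Rabs_pos (Re h)); pose proof (Rabs_pos (Im h)).
  pose proof (Rmin_l m k2); pose proof (Rmin_r m k2). pose proof (Rmin_pos m k2 Hm Hk2).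
  set (k := Rmin m k2) in *.
  apply Rle_trans with (k / 2 * (Rabs (Re h) + Rabs (Im h)))%R.
  - apply Rmult_le_compat_l; lra.
  - assert (k * Rabs (Re h) <= m * Rabs (Re h))%R by (apply Rmult_le_compat_r; lra).
    assert (k * Rabs (Im h) <= k2 * Rabs (Im h))%R by (apply Rmult_le_compat_r; lra). lra.
Qed.

(** * Pointwise limits *)

Lemma Clim_comp (f : C -> C) (u : nat -> C) (x l : C) : DC f x l -> Clim u x ->
  Clim (fun n => f (u n)) (f x).
Proof.
  intros Hf Hu eps He. destruct (D_at_cont _ f x l Hf eps He) as [d [Hd K]].
  destruct (Hu d Hd) as [N HN]. exists N. intros n Hn. apply K, HN, Hn.
Qed.

(** Polarisation reduces the product to squares, which [Clim_comp] handles. *)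
Lemma Clim_mult u v l l' : Clim u l -> Clim v l' -> Clim (fun n => u n * v n) (l * l').
Proof.
  intros Hu Hv.
  assert (D : forall x, exists d, DC (fun w => w * w) x d).
  { intros x. exists (1 * x + x * 1). apply (D_at_mult _ (fun w => w) (fun w => w)); apply D_at_id. }
  destruct (D (l + l')) as [d1 H1]. destruct (D (l - l')) as [d2 H2].
  pose proof (Clim_comp _ _ _ _ H1 (Clim_plus _ _ _ _ Hu Hv)) as A.
  pose proof (Clim_comp _ _ _ _ H2 (Clim_minus _ _ _ _ Hu Hv)) as B.
  pose proof (Clim_scal (/ 4) _ _ (Clim_minus _ _ _ _ A B)) as K.
  eapply Clim_val; [apply (Clim_ext _ _ _) with (2 := K)|]; intros; cbv beta; field.
Qed.

Lemma Clim_div_pow3 s : Clim (fun j => s / pow3 j) 0.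
Proof.
  intros eps He. destruct (INR_unbounded (Cmod s / eps)) as [N HN]. exists N. intros n Hn.
  replace (s / pow3 n - 0) with (s / pow3 n) by ring.
  rewrite Cmod_div by apply pow3_neq_0. rewrite Cmod_pow3.
  pose proof (pow3_ge n). pose proof (pos_INR n). apply le_INR in Hn.
  apply Rlt_div_l; [lra|]. apply Rlt_div_l in HN; [|lra]. pose proof (Cmod_ge_0 s). nra.
Qed.

Lemma Clim_inv u (l : C) : l <> 0 -> Clim u l -> Clim (fun n => / u n) (/ l).
Proof. intros Hl H. exact (Clim_comp Cinv u l _ (D_at_inv l Hl) H). Qed.

(** The rescaled difference quotient of [expi]. *)
Lemma Clim_quotient (s : C) : s <> 0 -> Clim (fun j => pow3 j * (expi (s / pow3 j) - 1)) (s * P2i).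
Proof.
  intros Hs.
  assert (H : Clim (fun j => pow3 j * (expi (s / pow3 j) - 1) - s * P2i) 0).
  { intros eps He. pose proof (proj1 (Cmod_gt_0 s) Hs) as Hm.
    pose proof (D_expi 0) as D. rewrite expi_0, Cmult_1_r in D.
    destruct (D (eps / (2 * Cmod s))%R) as [d [Hd K]].
    { apply Rdiv_lt_0_compat; lra. }
    destruct (Clim_div_pow3 s d Hd) as [N HN]. exists N. intros n Hn.
    specialize (HN n Hn). specialize (K (s / pow3 n) HN). cbv beta in K.
    rewrite expi_0 in K. replace (s / pow3 n - 0) with (s / pow3 n) in K by ring.
    pose proof (pow3_neq_0 n) as Np.
    replace (pow3 n * (expi (s / pow3 n) - 1) - s * P2i - 0) with
      (pow3 n * (expi (s / pow3 n) - 1 - s / pow3 n * P2i)) by (field; auto).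
    rewrite Cmod_mult. rewrite Cmod_div in K by exact Np.
    pose proof (proj1 (Cmod_gt_0 _) Np) as Hp.
    apply Rle_lt_trans with (Cmod (pow3 n) * (eps / (2 * Cmod s) * (Cmod s / Cmod (pow3 n))))%R.
    - apply Rmult_le_compat_l; lra.
    - replace (Cmod (pow3 n) * (eps / (2 * Cmod s) * (Cmod s / Cmod (pow3 n))))%R with (eps / 2)%R
        by (field; split; lra). lra. }
  apply Clim_diff with (fun _ => s * P2i); [exact H|apply Clim_const].
Qed.

Lemma Clim_expi_div (s : C) : Clim (fun j => expi (s / pow3 j)) 1.
Proof.
  rewrite <- expi_0. apply (Clim_comp expi _ 0 (P2i * expi 0)); [apply D_expi|apply Clim_div_pow3].
Qed.

Lemma Cinv_0 : / RtoC 0 = 0.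
Proof. apply injective_projections; simpl; unfold Rdiv; ring. Qed.

Lemma Cinv_mul (a b : C) : / (a * b) = / a * / b.
Proof.
  destruct (Ceq_dec a 0) as [->|Ha]; [rewrite Cmult_0_l, Cinv_0; ring|].
  destruct (Ceq_dec b 0) as [->|Hb]; [rewrite Cmult_0_r, Cinv_0; ring|].
  field. auto.
Qed.

(** As the period 3^j grows, the cotangent tends to the function 1 / s. *)
Lemma Clim_cot_div (s : C) : s <> 0 -> Clim (fun j => cot (s / pow3 j) / pow3 j) (/ s).
Proof.
  intros Hs. pose proof P2i_neq_0 as NP.
  assert (N : s * P2i <> 0) by (apply Cmult_neq_0; auto).
  pose proof (Clim_mult _ _ _ _ (Clim_scal (PI * Ci) _ _
    (Clim_plus _ _ _ _ (Clim_expi_div s) (Clim_const 1)))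
    (Clim_inv _ _ N (Clim_quotient s Hs))) as K.
  eapply Clim_val; [apply (Clim_ext _ _ _) with (2 := K)|].
  - intros n. cbv beta. unfold cot, Cdiv. rewrite Cinv_mul. ring.
  - unfold P2i in *. assert (PI * Ci <> 0).
    { intros Q. apply NP. transitivity (2 * (PI * Ci)); [ring|]. rewrite Q; ring. }
    assert (RtoC PI <> 0) by (apply RtoC_neq; pose proof PI_RGT_0; lra).
    assert (Ci <> 0) by (intros Q; apply NP; rewrite Q; ring).
    field. auto.
Qed.

Lemma Clim_csq_div (s : C) : s <> 0 ->
  Clim (fun j => P2i * P2i * csq (s / pow3 j) / (pow3 j * pow3 j)) (/ (s * s)).
Proof.
  intros Hs. pose proof P2i_neq_0 as NP.
  assert (N : s * P2i <> 0) by (apply Cmult_neq_0; auto).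
  pose proof (Clim_inv _ _ N (Clim_quotient s Hs)) as Q.
  pose proof (Clim_scal (P2i * P2i) _ _ (Clim_mult _ _ _ _ (Clim_expi_div s) (Clim_mult _ _ _ _ Q Q))) as K.
  eapply Clim_val; [apply (Clim_ext _ _ _) with (2 := K)|].
  - intros n. cbv beta. unfold csq, Cdiv.
    replace ((1 - expi (s * / pow3 n)) * (1 - expi (s * / pow3 n))) with
      ((expi (s * / pow3 n) - 1) * (expi (s * / pow3 n) - 1)) by ring.
    rewrite !Cinv_mul. ring.
  - field. auto.
Qed.

(** * The row sums of the series of Weierstrass *)

(** Comparison with a telescoping sum, as for the next family. *)
Lemma summable_inverse_square : summable (fun n => / ((1 + IZR (Z.abs n)) * (1 + IZR (Z.abs n))))%R.
Proof.
  assert (P : forall n, (0 < 1 + IZR (Z.abs n))%R).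
  { intros n. assert (0 <= IZR (Z.abs n))%R by (apply IZR_le; lia). lra. }
  split.
  - intros n. left. apply Rinv_0_lt_compat. pose proof (P n). nra.
  - exists 3%R. intros N.
    assert (H : (rsum (fun n => / ((1 + IZR (Z.abs n)) * (1 + IZR (Z.abs n)))) (zrange N)
                 <= 1 + 2 * (1 - / (INR N + 1)))%R).
    { induction N as [|N IH].
      - unfold rsum. simpl. replace ((1 + 0) * (1 + 0))%R with 1%R by ring.
        rewrite Rplus_0_l. rewrite Rinv_1. lra.
      - rewrite rsum_zrange_S, Z.abs_opp, Z.abs_eq, <- INR_IZR_INZ by lia.
        rewrite S_INR. pose proof (pos_INR N). set (x := (INR N + 1)%R) in *.
        assert (/ ((1 + x) * (1 + x)) <= / x - / (x + 1))%R.
        { replace (/ x - / (x + 1))%R with (/ (x * (x + 1)))%R by (field; unfold x; lra).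
          apply Rinv_le_contravar; unfold x; nra. }
        lra. }
    pose proof (pos_INR N). assert (0 < / (INR N + 1))%R by (apply Rinv_0_lt_compat; lra). lra.
Qed.

(** The terms of the series of Weierstrass decay like the cube of the lattice
    point, which is dominated by a product of two such families. *)
Definition three_halves (n : Z) : R := / ((1 + IZR (Z.abs n)) * sqrt (1 + IZR (Z.abs n))).

Lemma summable_three_halves : summable three_halves.
Proof.
  assert (P : forall n, (0 < 1 + IZR (Z.abs n))%R).
  { intros n. assert (0 <= IZR (Z.abs n))%R by (apply IZR_le; lia). lra. }
  split.
  - intros n. left. apply Rinv_0_lt_compat. pose proof (P n). pose proof (sqrt_lt_R0 _ H). nra.
  - exists 5%R. intros N.
    assert (H : (rsum three_halves (zrange N) <= 1 + 4 * (1 - / sqrt (INR N + 1)))%R).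
    { induction N as [|N IH].
      - unfold rsum, three_halves. simpl. rewrite Rplus_0_l, !Rplus_0_r, sqrt_1, Rmult_1_l, Rinv_1. lra.
      - rewrite rsum_zrange_S. unfold three_halves at 2 3.
        rewrite Z.abs_opp, Z.abs_eq, <- INR_IZR_INZ by lia.
        rewrite S_INR. pose proof (pos_INR N). set (x := (INR N + 1)%R) in *.
        assert (Hx : (0 < x)%R) by (unfold x; lra).
        replace (1 + x)%R with (x + 1)%R by ring.
        pose proof (sqrt_lt_R0 x Hx) as Hp. pose proof (sqrt_lt_R0 (x + 1) ltac:(lra)) as Hr.
        pose proof (sqrt_sqrt x ltac:(lra)) as Ep. pose proof (sqrt_sqrt (x + 1) ltac:(lra)) as Er.
        set (p := sqrt x) in *. set (r := sqrt (x + 1)) in *.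
        assert (p <= r)%R by nra.
        assert (/ ((x + 1) * r) <= 2 * (/ p - / r))%R.
        { rewrite <- Er.
          replace (2 * (/ p - / r))%R with (2 * ((r * r - p * p) / ((r + p) * (p * r))))%R
            by (field; repeat split; nra).
          replace (r * r - p * p)%R with 1%R by lra.
          replace (2 * (1 / ((r + p) * (p * r))))%R with (/ ((r + p) * (p * r) / 2))%R
            by (field; repeat split; nra).
          apply Rinv_le_contravar.
          - apply Rdiv_lt_0_compat; [|lra]. repeat apply Rmult_lt_0_compat; lra.
          - apply Rle_div_l; [lra|].
            apply Rle_trans with ((2 * r) * (r * r))%R; [|right; ring].
            apply Rmult_le_compat; nra. }
        lra. }
    pose proof (pos_INR N).
    assert (0 < / sqrt (INR N + 1))%R by (apply Rinv_0_lt_compat, sqrt_lt_R0; lra). lra.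
Qed.

Definition is_origin (a b : Z) : bool := ((a =? 0) && (b =? 0))%Z%bool.

Lemma is_origin_spec a b : is_origin a b = true <-> a = 0%Z /\ b = 0%Z.
Proof. unfold is_origin. rewrite Bool.andb_true_iff, !Z.eqb_eq. reflexivity. Qed.

Definition weierstrass (z tau : C) (a b : Z) : C :=
  if is_origin a b then 0 else
    / (z - lat tau a b) + / lat tau a b + z / (lat tau a b * lat tau a b).

(** The summand with [1 / w] and its derivative replaced by the cotangent of
    period [3 ^ j] and its derivative; its sums over a period are elementary. *)
Definition approx (z tau : C) (b : Z) (j : nat) (a : Z) : C :=
  if is_origin a b then 0 else
    cot ((z - lat tau a b) / pow3 j) / pow3 j + cot (lat tau a b / pow3 j) / pow3 j
    + z * (P2i * P2i * csq (lat tau a b / pow3 j) / (pow3 j * pow3 j)).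

Lemma lattice_bounds tau z : (0 < Im tau)%R -> off_lattice tau z ->
  exists k, (0 < k)%R /\ forall a b, is_origin a b = false ->
    (k * (1 + size a b) <= Cmod (z - lat tau a b))%R /\
    (k * (1 + size a b) <= Cmod (lat tau a b))%R.
Proof.
  intros Ht Hoff.
  destruct (lattice_distance tau z Ht Hoff) as [k1 [P1 K1]].
  destruct (lat_norm tau Ht) as [k2 [P2 K2]].
  exists (Rmin k1 (k2 / 2)). split; [apply Rmin_pos; lra|]. intros a b H.
  pose proof (Rmin_l k1 (k2 / 2)); pose proof (Rmin_r k1 (k2 / 2)).
  assert (S1 : (1 <= size a b)%R).
  { unfold size. rewrite <- plus_IZR. apply IZR_le.
    destruct (Z.eq_dec a 0) as [->|]; [|lia]. destruct (Z.eq_dec b 0) as [->|]; [|lia].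
    discriminate. }
  split.
  - eapply Rle_trans; [|apply K1]. apply Rmult_le_compat_r; lra.
  - eapply Rle_trans; [|apply K2].
    apply Rle_trans with (k2 / 2 * (1 + size a b))%R; [apply Rmult_le_compat_r; lra|].
    nra.
Qed.

Lemma cot_sum x y : expi x <> 1 -> expi y <> 1 ->
  cot x + cot y = P2i * (expi (x + y) - 1) / ((expi x - 1) * (expi y - 1)).
Proof.
  intros Hx Hy. unfold cot, P2i. rewrite expi_plus.
  assert (expi x - 1 <> 0) by (apply sub_neq_0; auto).
  assert (expi y - 1 <> 0) by (apply sub_neq_0; auto).
  field. auto.
Qed.

(** The estimates behind the domination of [approx]: [q] is [3 ^ j], [d1] and
    [d2] are the distances of [z] and of 0 from the lattice point. *)
Lemma quotient_bound (x1 x2 k K d1 d2 q u : R) : (0 < k)%R -> (0 < q)%R -> (0 < d1)%R -> (0 < d2)%R ->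
  (0 <= u)%R -> (u <= K / q)%R -> (k * (d1 / q) <= x1)%R -> (k * (d2 / q) <= x2)%R ->
  (u / (x1 * x2) / q <= K / (k * k) * / (d1 * d2))%R.
Proof.
  intros Hk Hq H1 H2 Hu HK B1 B2.
  assert (Q1 : (0 < k * (d1 / q))%R) by (apply Rmult_lt_0_compat; [lra|apply Rdiv_lt_0_compat; lra]).
  assert (Q2 : (0 < k * (d2 / q))%R) by (apply Rmult_lt_0_compat; [lra|apply Rdiv_lt_0_compat; lra]).
  replace (K / (k * k) * / (d1 * d2))%R with (K / q / (k * (d1 / q) * (k * (d2 / q))) / q)%R
    by (field; lra).
  apply Rmult_le_compat_r; [left; apply Rinv_0_lt_compat, Hq|].
  apply Rmult_le_compat; [exact Hu| |exact HK|].
  - left. apply Rinv_0_lt_compat, Rmult_lt_0_compat; lra.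
  - apply Rinv_le_contravar; [apply Rmult_lt_0_compat; lra|].
    apply Rmult_le_compat; lra.
Qed.

(** The zeros of [expi - 1] are simple, so that in the strip where |Re| is at most
    3 / 4 it is bounded above and below by multiples of the argument.  For large
    [j] both arguments, w / 3^j and (z - w) / 3^j, lie in this strip, as |a| is
    at most half of the period. *)
Lemma approx_dominated z tau b : (0 < Im tau)%R -> off_lattice tau z ->
  exists C0 J, (0 <= C0)%R /\ forall j a, (J <= j)%nat -> (Z.abs a <= Z.of_nat (tri j))%Z ->
    (Cmod (approx z tau b j a) <= C0 * / ((1 + IZR (Z.abs a)) * (1 + IZR (Z.abs a))))%R.
Proof.
  intros Ht Hoff. pose proof PI_RGT_0 as Hpi.
  destruct (lattice_bounds tau z Ht Hoff) as [d [Hd D]].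
  set (Y := (Cmod z + IZR (Z.abs b) * Cmod tau)%R).
  assert (Hb0 : (0 <= IZR (Z.abs b))%R) by (apply IZR_le; lia).
  pose proof (Cmod_ge_0 z) as Hz0. pose proof (Cmod_ge_0 tau) as Htau0.
  assert (HbT : (0 <= IZR (Z.abs b) * Cmod tau)%R) by (apply Rmult_le_pos; lra).
  assert (HY : (0 <= Y)%R) by (unfold Y; lra).
  destruct (expi_minus_one_upper Y) as [K [HK U]].
  destruct (expi_minus_one_lower Y HY) as [k [Hk L]].
  destruct (INR_unbounded (4 * Y)) as [J HJ].
  set (p0 := Cmod P2i). assert (Hp0 : (0 <= p0)%R) by apply Cmod_ge_0.
  set (e0 := exp (2 * PI * Y)). assert (He0 : (0 < e0)%R) by apply exp_pos.
  set (C1 := (p0 * K * Cmod z / (k * k) * / (d * d))%R).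
  set (C2 := (Cmod z * (p0 * p0 * e0 / (k * k) * / (d * d)))%R).
  assert (Hdd : (0 < / (d * d))%R) by (apply Rinv_0_lt_compat; nra).
  assert (Hkk : (0 < / (k * k))%R) by (apply Rinv_0_lt_compat; nra).
  assert (HC1 : (0 <= C1)%R).
  { unfold C1, Rdiv. repeat apply Rmult_le_pos; lra. }
  assert (HC2 : (0 <= C2)%R).
  { unfold C2, Rdiv. repeat apply Rmult_le_pos; lra. }
  exists (C1 + C2)%R, J. split; [lra|]. intros j a Hj Ha.
  set (n := (1 + IZR (Z.abs a))%R).
  assert (Hn : (1 <= n)%R) by (unfold n; assert (0 <= IZR (Z.abs a))%R by (apply IZR_le; lia); lra).
  assert (Hnn : (0 < / (n * n))%R) by (apply Rinv_0_lt_compat; nra).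
  unfold approx. destruct (is_origin a b) eqn:Ho.
  { rewrite Cmod_0. apply Rmult_le_pos; lra. }
  destruct (D a b Ho) as [D1 D2].
  set (w := lat tau a b) in *. set (p := pow3 j).
  pose proof (pow3_neq_0 j) as Np. fold p in Np.
  pose proof (proj1 (Cmod_gt_0 p) Np) as Hq.
  assert (Hqj : (INR j + 1 <= Cmod p)%R) by (unfold p; rewrite Cmod_pow3; apply pow3_ge).
  assert (Hq4 : (4 * Y <= Cmod p)%R) by (apply le_INR in Hj; lra).
  assert (Hq1 : (1 <= Cmod p)%R) by (pose proof (pos_INR j); lra).
  assert (Hsize : (n <= 1 + size a b)%R) by (unfold n, size; lra).
  assert (E1 : (d * n <= Cmod (z - w))%R) by (eapply Rle_trans; [|exact D1]; apply Rmult_le_compat_l; lra).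
  assert (E2 : (d * n <= Cmod w)%R) by (eapply Rle_trans; [|exact D2]; apply Rmult_le_compat_l; lra).
  assert (Hdn : (0 < d * n)%R) by (apply Rmult_lt_0_compat; lra).
  assert (Ha2 : (IZR (Z.abs a) <= Cmod p / 2)%R).
  { unfold p. rewrite Cmod_pow3, <- tri_pow, plus_INR, mult_INR. simpl INR.
    apply IZR_le in Ha. rewrite <- INR_IZR_INZ in Ha. lra. }
  (* both arguments lie in the strip where the lower bound of [expi - 1] holds *)
  assert (Strip : forall v, (Cmod v <= Y)%R -> forall s : R, (s = 1 \/ s = -1)%R ->
    (Rabs (Re ((v + s * int_C a) / p)) <= 3 / 4)%R /\ (Rabs (Im ((v + s * int_C a) / p)) <= Y)%R).
  { intros v Hv s Hs.
    assert (Hs1 : Rabs s = 1%R) by (destruct Hs as [-> | ->]; [apply Rabs_R1|rewrite Rabs_left; lra]).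
    assert (Fp : (v + s * int_C a) / p = (/ Cmod p)%R * (v + s * int_C a)).
    { unfold p, pow3, int_C. rewrite Cmod_R, Rabs_pos_eq by (apply IZR_le; lia).
      rewrite RtoC_inv; [unfold Cdiv; ring|].
      intros Q. apply Np. unfold p, pow3, int_C. now rewrite Q. }
    rewrite Fp. clear Fp.
    assert (Hi : (0 < / Cmod p)%R) by (apply Rinv_0_lt_compat, Hq).
    replace (Re ((/ Cmod p)%R * (v + s * int_C a))) with (/ Cmod p * (Re v + s * IZR a))%R
      by (unfold Re, int_C; simpl; ring).
    replace (Im ((/ Cmod p)%R * (v + s * int_C a))) with (/ Cmod p * Im v)%R
      by (unfold Im, int_C; simpl; ring).
    rewrite !Rabs_mult, (Rabs_pos_eq (/ Cmod p)) by lra. split.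
    - apply Rle_trans with (/ Cmod p * (Y + Cmod p / 2))%R.
      + apply Rmult_le_compat_l; [lra|]. eapply Rle_trans; [apply Rabs_triang|].
        rewrite Rabs_mult, Hs1, <- abs_IZR, Rmult_1_l.
        pose proof (re_le_Cmod v). lra.
      + apply Rle_trans with (/ Cmod p * (Cmod p * (3 / 4)))%R.
        * apply Rmult_le_compat_l; lra.
        * rewrite <- Rmult_assoc, Rinv_l by lra. lra.
    - apply Rle_trans with (1 * Y)%R; [|lra].
      apply Rmult_le_compat; [lra|apply Rabs_pos| |].
      + rewrite <- Rinv_1. apply Rinv_le_contravar; lra.
      + pose proof (im_le_Cmod v). lra. }
  assert (Bbt : Cmod (int_C b * tau) = (IZR (Z.abs b) * Cmod tau)%R).
  { rewrite Cmod_mult. unfold int_C. now rewrite Cmod_R, <- abs_IZR. }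
  assert (L1 : (k * (Cmod (z - w) / Cmod p) <= Cmod (expi ((z - w) / p) - 1))%R).
  { rewrite <- Cmod_div by exact Np.
    destruct (Strip (z - int_C b * tau)) with (s := (-1)%R) as [S1 S2].
    - unfold Cminus. eapply Rle_trans; [apply Cmod_triangle|]. rewrite Cmod_opp, Bbt. unfold Y. lra.
    - now right.
    - replace (z - int_C b * tau + (-1)%R * int_C a) with (z - w) in S1, S2
        by (unfold w, lat; replace (RtoC (-1)) with (- RtoC 1) by (rewrite <- RtoC_opp; reflexivity); ring).
      apply L; assumption. }
  assert (L2 : (k * (Cmod w / Cmod p) <= Cmod (expi (w / p) - 1))%R).
  { rewrite <- Cmod_div by exact Np.
    destruct (Strip (int_C b * tau)) with (s := 1%R) as [S1 S2].
    - rewrite Bbt. unfold Y. lra.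
    - now left.
    - replace (int_C b * tau + 1%R * int_C a) with w in S1, S2 by (unfold w, lat; ring).
      apply L; assumption. }
  assert (L3 : (Cmod (expi (w / p)) <= e0)%R).
  { rewrite Cmod_expi. apply exp_mono.
    destruct (Strip (int_C b * tau)) with (s := 1%R) as [S1 S2].
    - rewrite Bbt. unfold Y. lra.
    - now left.
    - replace (int_C b * tau + 1%R * int_C a) with w in S1, S2 by (unfold w, lat; ring).
      pose proof (Rle_abs (- Im (w / p))). rewrite Rabs_Ropp in *.
      assert (0 <= PI * (Y + Im (w / p)))%R by (apply Rmult_le_pos; lra). lra. }
  assert (Hw0 : (0 < Cmod w)%R) by lra. assert (Hzw0 : (0 < Cmod (z - w))%R) by lra.
  assert (NE : forall v, (0 < Cmod v)%R -> (k * (Cmod v / Cmod p) <= Cmod (expi (v / p) - 1))%R ->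
            expi (v / p) <> 1 /\ expi (v / p) - 1 <> 0).
  { intros v Hv Hl. assert (expi (v / p) - 1 <> 0).
    { apply Cmod_gt_0. eapply Rlt_le_trans; [|exact Hl].
      apply Rmult_lt_0_compat; [lra|apply Rdiv_lt_0_compat; lra]. }
    split; [|assumption]. intros Q. apply H. rewrite Q. ring. }
  destruct (NE _ Hzw0 L1) as [N1 M1]. destruct (NE _ Hw0 L2) as [N2 M2].
  assert (Hdnn : (/ ((d * n) * (d * n)) = / (d * d) * / (n * n))%R) by (field; split; lra).
  eapply Rle_trans; [apply Cmod_triangle|]. rewrite Rmult_plus_distr_r. apply Rplus_le_compat.
  - replace (cot ((z - w) / p) / p + cot (w / p) / p) with ((cot ((z - w) / p) + cot (w / p)) / p)
      by (field; auto).
    rewrite cot_sum by assumption.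
    replace ((z - w) / p + w / p) with (z / p) by (field; auto).
    rewrite Cmod_div by exact Np.
    rewrite Cmod_div, !Cmod_mult by (apply Cmult_neq_0; assumption). fold p0.
    eapply Rle_trans.
    + apply (quotient_bound _ _ k (p0 * (K * Cmod z)) (Cmod (z - w)) (Cmod w)); try eassumption.
      * apply Rmult_le_pos; [lra|apply Cmod_ge_0].
      * unfold Rdiv. rewrite Rmult_assoc. apply Rmult_le_compat_l; [lra|].
        rewrite Rmult_assoc. change (Cmod z * / Cmod p)%R with (Cmod z / Cmod p)%R.
        rewrite <- Cmod_div by exact Np. apply U.
        rewrite Cmod_div by exact Np. apply Rle_div_l; [lra|]. unfold Y. nra.
    + unfold C1.
      apply Rle_trans with (p0 * (K * Cmod z) / (k * k) * / (d * n * (d * n)))%R.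
      * apply Rmult_le_compat_l.
        -- unfold Rdiv. repeat apply Rmult_le_pos; lra.
        -- apply Rinv_le_contravar; [nra|]. apply Rmult_le_compat; lra.
      * rewrite Hdnn. right. unfold Rdiv. ring.
  - rewrite Cmod_mult. unfold C2. rewrite Rmult_assoc. apply Rmult_le_compat_l; [lra|].
    unfold csq.
    replace (P2i * P2i * (expi (w / p) / ((1 - expi (w / p)) * (1 - expi (w / p)))) / (p * p)) with
      (P2i * P2i * expi (w / p) / p / ((expi (w / p) - 1) * (expi (w / p) - 1)) / p).
    2:{ assert (1 - expi (w / p) <> 0) by (apply sub_neq_0; auto). field. auto. }
    rewrite Cmod_div by exact Np.
    rewrite Cmod_div by (apply Cmult_neq_0; assumption).
    rewrite Cmod_div by exact Np. rewrite !Cmod_mult. fold p0.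
    eapply Rle_trans.
    + apply (quotient_bound _ _ k (p0 * p0 * e0) (Cmod w) (Cmod w)); try eassumption.
      * apply Rmult_le_pos; [|left; apply Rinv_0_lt_compat, Hq].
        apply Rmult_le_pos; [nra|apply Cmod_ge_0].
      * unfold Rdiv. apply Rmult_le_compat_r; [left; apply Rinv_0_lt_compat, Hq|].
        apply Rmult_le_compat_l; [nra|exact L3].
    + apply Rle_trans with (p0 * p0 * e0 / (k * k) * / (d * n * (d * n)))%R.
      * apply Rmult_le_compat_l.
        -- unfold Rdiv. repeat apply Rmult_le_pos; lra.
        -- apply Rinv_le_contravar; [nra|]. apply Rmult_le_compat; lra.
      * rewrite Hdnn. right. unfold Rdiv. ring.
Qed.

(** * The zeta function as a sum of cotangents *)

Lemma off_origin tau z a b : off_lattice tau z -> z - lat tau a b <> 0.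
Proof.
  intros H. apply sub_neq_0. intros Q. apply off_lattice_iff in H. apply H. now exists a, b.
Qed.

Lemma lat_neq_0 tau a b : (0 < Im tau)%R -> is_origin a b = false -> lat tau a b <> 0.
Proof.
  intros Ht Ho Q. destruct (lat_norm tau Ht) as [k [Hk K]]. specialize (K a b).
  rewrite Q, Cmod_0 in K. unfold size in K. rewrite <- plus_IZR in K.
  assert (1 <= IZR (Z.abs a + Z.abs b))%R; [|nra].
  apply IZR_le. destruct (Z.eq_dec a 0) as [->|]; [|lia]. destruct (Z.eq_dec b 0) as [->|]; [|lia].
  discriminate.
Qed.

Lemma approx_limit z tau b a : (0 < Im tau)%R -> off_lattice tau z ->
  Clim (fun j => approx z tau b j a) (weierstrass z tau a b).
Proof.
  intros Ht Hoff. unfold approx, weierstrass. destruct (is_origin a b) eqn:Ho; [apply Clim_const|].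
  pose proof (lat_neq_0 tau a b Ht Ho). pose proof (off_origin tau z a b Hoff).
  apply Clim_plus; [apply Clim_plus; apply Clim_cot_div; assumption|].
  apply Clim_scal, Clim_csq_div. assumption.
Qed.

Lemma approx_tannery z tau b l : (0 < Im tau)%R -> off_lattice tau z ->
  Clim (fun j => Zs (approx z tau b j) (tri j)) l ->
  Clim (fun j => Zs (fun a => weierstrass z tau a b) (tri j)) l.
Proof.
  intros Ht Hoff Hl. destruct (approx_dominated z tau b Ht Hoff) as [C0 [J [HC B]]].
  pose proof (tannery (approx z tau b) (fun a => weierstrass z tau a b)
    (fun n => C0 * / ((1 + IZR (Z.abs n)) * (1 + IZR (Z.abs n))))%R tri J
    (summable_scal _ _ HC summable_inverse_square) tri_ge B
    (fun a => approx_limit z tau b a Ht Hoff)) as T.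
  apply Clim_ext with (fun j => Zs (approx z tau b j) (tri j)
    - (Zs (approx z tau b j) (tri j) - Zs (fun a => weierstrass z tau a b) (tri j))).
  - intros; ring.
  - eapply Clim_val; [apply Clim_minus; [exact Hl|exact T]|ring].
Qed.

Lemma expi_int_tau b tau : (0 < Im tau)%R -> b <> 0%Z -> expi (int_C b * tau) <> 1.
Proof.
  intros Ht Hb Q. apply expi_eq_1 in Q. destruct Q as [n Hn].
  apply (f_equal Im) in Hn. unfold Im, int_C in Hn. simpl in Hn.
  assert (IZR b <> 0)%R by (apply not_0_IZR; exact Hb).
  change (snd tau) with (Im tau) in Hn. nra.
Qed.

Lemma row_limit_nonzero z tau b : (0 < Im tau)%R -> off_lattice tau z -> b <> 0%Z ->
  Clim (fun j => Zs (fun a => weierstrass z tau a b) (tri j))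
    (cot (z - int_C b * tau) + cot (int_C b * tau) + z * (P2i * P2i * csq (int_C b * tau))).
Proof.
  intros Ht Hoff Hb. apply approx_tannery; auto.
  eapply Clim_ext; [|apply Clim_const]. intros j. symmetry. cbv beta.
  pose proof (pow3_neq_0 j) as Np.
  assert (N1 : expi (z - int_C b * tau) <> 1).
  { replace (z - int_C b * tau) with (z + int_C (- b) * tau) by (rewrite int_C_opp; ring). apply Hoff. }
  assert (N2 : expi (int_C b * tau) <> 1) by (apply expi_int_tau; auto).
  transitivity (/ pow3 j * Zs (fun n => cot ((z - int_C b * tau + int_C n) / pow3 j)) (tri j)
    + / pow3 j * Zs (fun n => cot ((int_C b * tau + int_C n) / pow3 j)) (tri j)
    + z * (P2i * P2i / (pow3 j * pow3 j)) * Zs (fun n => csq ((int_C b * tau + int_C n) / pow3 j)) (tri j)).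
  - rewrite <- (Zs_neg (fun n => cot ((z - int_C b * tau + int_C n) / pow3 j))).
    unfold Zs. rewrite <- !lsum_scal, <- !lsum_plus. apply lsum_ext. intros a _.
    unfold approx. assert (Ho : is_origin a b = false).
    { destruct (is_origin a b) eqn:Q; [|reflexivity]. apply is_origin_spec in Q. tauto. }
    rewrite Ho. unfold lat. rewrite int_C_opp.
    replace (z - (int_C a + int_C b * tau)) with (z - int_C b * tau + - int_C a) by ring.
    rewrite (Cplus_comm (int_C a)). field. auto.
  - rewrite !cot_division, csq_division by assumption. field. auto.
Qed.

Lemma Zs_nonzero_part f N : Zs (nonzero_part f) N = Zs f N - f 0%Z.
Proof.
  induction N as [|N IH]; [rewrite !Zs_O; unfold nonzero_part; simpl; ring|].
  rewrite !Zs_S, IH. unfold nonzero_part.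
  destruct (Z.eq_dec (Z.of_nat (S N)) 0); [lia|].
  destruct (Z.eq_dec (- Z.of_nat (S N)) 0); [lia|]. ring.
Qed.

(** In the row through 0 the omitted term produces 1 / z, the odd terms cancel,
    and [csq_sum_roots] supplies the constant. *)
Lemma row_limit_zero z tau : (0 < Im tau)%R -> off_lattice tau z ->
  Clim (fun j => Zs (fun a => weierstrass z tau a 0) (tri j))
    (cot z - / z - z * (P2i * P2i / 12)).
Proof.
  intros Ht Hoff. apply approx_tannery; auto.
  assert (Ez : expi z <> 1).
  { replace z with (z + int_C 0 * tau) by (unfold int_C; ring). apply Hoff. }
  assert (Hz : z <> 0) by (intros Q; apply Ez; rewrite Q; apply expi_0).
  assert (H12 : RtoC 12 <> 0) by (apply RtoC_neq; lra).
  apply Clim_ext with (fun j => cot z - cot (z / pow3 j) / pow3 j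
    + z * (P2i * P2i / 12) * (/ (pow3 j) * / (pow3 j) - 1)).
  - intros j. symmetry. pose proof (pow3_neq_0 j) as Np.
    assert (Odd : Zs (nonzero_part (fun n => cot (int_C n / pow3 j))) (tri j) = 0).
    { set (f := nonzero_part (fun n => cot (int_C n / pow3 j))).
      assert (Q : Zs f (tri j) = - (1) * Zs f (tri j)).
      { rewrite <- (Zs_neg f) at 1. unfold Zs. rewrite <- lsum_scal. apply lsum_ext.
        intros n Hn. apply in_zrange in Hn. unfold f, nonzero_part.
        destruct (Z.eq_dec (- n) 0); destruct (Z.eq_dec n 0); try lia; [ring|].
        rewrite int_C_opp. replace (- int_C n / pow3 j) with (- (int_C n / pow3 j)) by (field; auto).
        rewrite cot_opp by (apply expi_int_div_pow3; auto). ring. }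
      replace (Zs f (tri j)) with ((Zs f (tri j) - - (1) * Zs f (tri j)) / 2) by field.
      rewrite <- Q. field. }
    transitivity (/ pow3 j * Zs (nonzero_part (fun n => cot ((z + int_C n) / pow3 j))) (tri j)
      + / pow3 j * Zs (nonzero_part (fun n => cot (int_C n / pow3 j))) (tri j)
      + z * (P2i * P2i / (pow3 j * pow3 j)) * Zs (nonzero_part (fun n => csq (int_C n / pow3 j))) (tri j)).
    + rewrite <- (Zs_neg (nonzero_part (fun n => cot ((z + int_C n) / pow3 j)))).
      unfold Zs. rewrite <- !lsum_scal, <- !lsum_plus. apply lsum_ext. intros a _.
      unfold approx, nonzero_part, is_origin.
      destruct (Z.eq_dec a 0) as [->|Na]; [simpl; ring|].
      destruct (Z.eq_dec (- a) 0); [lia|]. rewrite (proj2 (Z.eqb_neq a 0) Na). simpl.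
      unfold lat. rewrite int_C_opp.
      replace (int_C a + int_C 0 * tau) with (int_C a) by (unfold int_C; ring).
      unfold Cminus. field. auto.
    + rewrite Odd, csq_sum_roots, Zs_nonzero_part, cot_division by exact Ez.
      replace (z + int_C 0) with z by (unfold int_C; ring). field. auto.
  - pose proof (Clim_div_pow3 1) as I.
    eapply Clim_val.
    + apply Clim_plus.
      * apply Clim_minus; [apply Clim_const|apply Clim_cot_div, Hz].
      * apply Clim_scal, Clim_minus; [|apply Clim_const].
        apply (Clim_ext _ _ _) with (2 := Clim_mult _ _ _ _ I I).
        intros; cbv beta. unfold Cdiv. ring.
    + cbv beta. field. auto.
Qed.

Lemma weierstrass_dominated z tau : (0 < Im tau)%R -> off_lattice tau z ->
  exists C0, (0 <= C0)%R /\ forall a b,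
    (Cmod (weierstrass z tau a b) <= C0 * (three_halves a * three_halves b))%R.
Proof.
  intros Ht Hoff. destruct (lattice_bounds tau z Ht Hoff) as [d [Hd D]].
  pose proof (Cmod_ge_0 z) as Hz.
  assert (Hd3 : (0 < / (d * d * d))%R) by (apply Rinv_0_lt_compat; repeat apply Rmult_lt_0_compat; lra).
  exists (Cmod z * Cmod z * / (d * d * d))%R. split; [nra|]. intros a b.
  unfold weierstrass. unfold three_halves.
  assert (Hx : (1 <= 1 + IZR (Z.abs a))%R) by (assert (0 <= IZR (Z.abs a))%R by (apply IZR_le; lia); lra).
  assert (Hy : (1 <= 1 + IZR (Z.abs b))%R) by (assert (0 <= IZR (Z.abs b))%R by (apply IZR_le; lia); lra).
  destruct (is_origin a b) eqn:Ho.
  { rewrite Cmod_0. apply Rmult_le_pos; [nra|].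
    assert (P : forall x, (1 <= x)%R -> (0 <= / (x * sqrt x))%R).
    { intros x Hx'. left. apply Rinv_0_lt_compat. pose proof (sqrt_lt_R0 x ltac:(lra)). nra. }
    apply Rmult_le_pos; apply P; assumption. }
  destruct (D a b Ho) as [D1 D2].
  assert (Hs : (1 + IZR (Z.abs a) <= 1 + size a b /\ 1 + IZR (Z.abs b) <= 1 + size a b)%R) by (unfold size; lra).
  set (x := (1 + IZR (Z.abs a))%R) in *. set (y := (1 + IZR (Z.abs b))%R) in *.
  set (s := (1 + size a b)%R) in *. set (w := lat tau a b) in *.
  pose proof (lat_neq_0 tau a b Ht Ho) as Nw. pose proof (off_origin tau z a b Hoff) as Nz.
  fold w in Nw, Nz.
  replace (/ (z - w) + / w + z / (w * w)) with (z * z / (w * w * (z - w))) by (field; auto).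
  rewrite Cmod_div, !Cmod_mult by (repeat apply Cmult_neq_0; assumption).
  unfold Rdiv. rewrite (Rmult_assoc (Cmod z * Cmod z)). apply Rmult_le_compat_l; [nra|].
  pose proof (sqrt_lt_R0 x ltac:(lra)) as Qx. pose proof (sqrt_lt_R0 y ltac:(lra)) as Qy.
  pose proof (sqrt_lt_R0 s ltac:(lra)) as Qs. pose proof (sqrt_sqrt s ltac:(lra)) as Es.
  pose proof (sqrt_le_1_alt x s ltac:(lra)) as Lx. pose proof (sqrt_le_1_alt y s ltac:(lra)) as Ly.
  replace (/ (d * d * d) * (/ (x * sqrt x) * / (y * sqrt y)))%R with
    (/ (d * d * d * ((x * sqrt x) * (y * sqrt y))))%R by (field; repeat split; lra).
  assert (Hxx : (0 < x * sqrt x)%R) by nra. assert (Hyy : (0 < y * sqrt y)%R) by nra.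
  apply Rinv_le_contravar.
  - apply Rmult_lt_0_compat; [repeat apply Rmult_lt_0_compat; lra|nra].
  - apply Rle_trans with (d * d * d * (s * s * s))%R.
    + apply Rmult_le_compat_l; [repeat apply Rmult_le_pos; lra|].
      apply Rle_trans with ((s * sqrt s) * (s * sqrt s))%R.
      * apply Rmult_le_compat; try lra; apply Rmult_le_compat; lra.
      * right. transitivity (s * s * (sqrt s * sqrt s))%R; [ring|rewrite Es; ring].
    + replace (d * d * d * (s * s * s))%R with ((d * s) * (d * s) * (d * s))%R by ring.
      assert (0 <= d * s)%R by (apply Rmult_le_pos; lra).
      apply Rmult_le_compat; [nra|lra| |lra]. apply Rmult_le_compat; lra.
Qed.

Definition lambert (tau : C) : C := Zsum (nonzero_part (fun b => csq (int_C b * tau))).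

Lemma csq_tau_bound tau : (0 < Im tau)%R -> exists (N0 : nat) K s, (0 <= K)%R /\ (0 < s)%R /\
  forall n, (Z.of_nat N0 < Z.abs n)%Z -> (Cmod (csq (int_C n * tau)) <= K * geo s n)%R.
Proof.
  intros Ht. destruct (translate_bounds (Im tau) 0 0 Ht) as [N0 [K [s [HK [Hs H]]]]].
  pose proof P2i_neq_0 as NP. pose proof (proj1 (Cmod_gt_0 _) NP) as HP.
  exists N0, (K * / (Cmod P2i * Cmod P2i))%R, s.
  assert (Hi : (0 < / (Cmod P2i * Cmod P2i))%R) by (apply Rinv_0_lt_compat; nra).
  split; [apply Rmult_le_pos; lra|]. split; [exact Hs|]. intros n Hn.
  destruct (H 0 tau n) as [_ [B _]]; [lra|simpl; rewrite Rabs_R0; lra|exact Hn|].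
  rewrite Cplus_0_l, cotd_1, Cmod_mult, Cmod_opp, Cmod_mult in B.
  replace (Cmod (csq (int_C n * tau))) with
    (/ (Cmod P2i * Cmod P2i) * (Cmod P2i * Cmod P2i * Cmod (csq (int_C n * tau))))%R by (field; lra).
  rewrite (Rmult_comm K), (Rmult_assoc _ K). apply Rmult_le_compat_l; lra.
Qed.

Lemma lambert_converges tau : (0 < Im tau)%R ->
  Clim (Zs (nonzero_part (fun b => csq (int_C b * tau)))) (lambert tau).
Proof.
  intros Ht.
  destruct (csq_tau_bound tau Ht) as [N0 [K [s [HK [Hs B]]]]].
  destruct (summable_converges (nonzero_part (fun b => csq (int_C b * tau)))
    (fun n => K * geo s n)%R N0) as [l Hl].
  - apply summable_scal; [exact HK|apply summable_geo, Hs].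
  - intros n Hn. unfold nonzero_part. destruct (Z.eq_dec n 0); [lia|]. apply B, Hn.
  - exact (Zsum_correct _ l Hl).
Qed.

(** The rows of the lattice sum are cotangents up to terms linear in [z]; the
    constants of opposite rows cancel. *)
Lemma zeta_Rho z tau : (0 < Im tau)%R -> off_lattice tau z ->
  zeta z tau = Rho 0 0 z tau + z * (P2i * P2i * (lambert tau - / 12)).
Proof.
  intros Ht Hoff.
  assert (H12 : RtoC 12 <> 0) by (apply RtoC_neq; lra).
  assert (Ez : expi z <> 1).
  { replace z with (z + int_C 0 * tau) by (unfold int_C; ring). apply Hoff. }
  assert (Hz : z <> 0) by (intros Q; apply Ez; rewrite Q; apply expi_0).
  set (row := fun b => if Z.eq_dec b 0 then cot z - / z - z * (P2i * P2i / 12) else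
    cot (z - int_C b * tau) + cot (int_C b * tau) + z * (P2i * P2i * csq (int_C b * tau))).
  assert (Hrow : forall b, Clim (fun j => Zs (fun a => weierstrass z tau a b) (tri j)) (row b)).
  { intros b. unfold row. destruct (Z.eq_dec b 0) as [->|N].
    - apply row_limit_zero; assumption.
    - apply row_limit_nonzero; assumption. }
  destruct (weierstrass_dominated z tau Ht Hoff) as [C0 [HC D]].
  assert (Hsum : forall N, Zs row N = Zs (rho_term 0 0 z tau) N - / z - z * (P2i * P2i / 12)
     + z * (P2i * P2i) * Zs (nonzero_part (fun b => csq (int_C b * tau))) N).
  { induction N as [|N IH].
    - rewrite !Zs_O. unfold row, nonzero_part, rho_term. simpl.
      replace (z + int_C 0 * tau) with z by (unfold int_C; ring). ring.
    - rewrite !Zs_S, IH. unfold row, nonzero_part, rho_term. cbn [Nat.add Cpow cotd].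
      destruct (Z.eq_dec (Z.of_nat (S N)) 0); [lia|].
      destruct (Z.eq_dec (- Z.of_nat (S N)) 0); [lia|].
      rewrite int_C_opp.
      replace (- int_C (Z.of_nat (S N)) * tau) with (- (int_C (Z.of_nat (S N)) * tau)) by ring.
      rewrite csq_opp, (cot_opp (int_C (Z.of_nat (S N)) * tau)) by (apply expi_int_tau; auto).
      replace (z - - (int_C (Z.of_nat (S N)) * tau)) with (z + int_C (Z.of_nat (S N)) * tau) by ring.
      replace (z + - (int_C (Z.of_nat (S N)) * tau)) with (z - int_C (Z.of_nat (S N)) * tau) by ring.
      ring. }
  assert (Hl : Clim (fun j => Zs row (tri j))
    (Rho 0 0 z tau - / z - z * (P2i * P2i / 12) + z * (P2i * P2i) * lambert tau)).
  { apply (Clim_subseq (Zs row) _ tri tri_ge).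
    apply Clim_ext with (2 := Clim_plus _ _ _ _
      (Clim_minus _ _ _ _ (Clim_minus _ _ _ _ (Rho_converges 0 0 z tau Ht) (Clim_const (/ z)))
        (Clim_const (z * (P2i * P2i / 12))))
      (Clim_scal (z * (P2i * P2i)) _ _ (lambert_converges tau Ht))).
    intros N. symmetry. apply Hsum. }
  assert (S1 : summable (fun n => (1 + C0) * three_halves n)%R).
  { apply summable_scal; [lra|apply summable_three_halves]. }
  assert (D1 : forall a b, (Cmod (weierstrass z tau a b) <=
     (1 + C0) * three_halves a * ((1 + C0) * three_halves b))%R).
  { intros a b. eapply Rle_trans; [apply D|].
    pose proof (proj1 summable_three_halves a). pose proof (proj1 summable_three_halves b).
    assert (0 <= three_halves a * three_halves b)%R by (apply Rmult_le_pos; assumption).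
    replace ((1 + C0) * three_halves a * ((1 + C0) * three_halves b))%R with
      ((1 + C0) * (1 + C0) * (three_halves a * three_halves b))%R by ring.
    apply Rmult_le_compat_r; [assumption|nra]. }
  pose proof (Clim_diff _ _ _ (square_sums (weierstrass z tau) _ tri row S1 tri_ge D1 Hrow) Hl) as Sq.
  unfold zeta.
  rewrite (usum_eq _ _ (Rho 0 0 z tau - / z - z * (P2i * P2i / 12) + z * (P2i * P2i) * lambert tau)).
  - field. auto.
  - apply (is_usum_of_squares (weierstrass z tau) _ tri _ _ S1 tri_ge D1 Sq); [reflexivity|].
    intros [a b] Hp. cbn [fst snd]. unfold weierstrass, lat.
    destruct (is_origin a b) eqn:Ho; [|reflexivity].
    apply is_origin_spec in Ho. destruct Ho; subst; contradiction.
Qed.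

(** * The Lambert series *)

Lemma Zs_positive (f : Z -> C) N : (forall n, (n <= 0)%Z -> f n = 0) ->
  Zs f (S N) = Zs f N + f (Z.of_nat (S N)).
Proof. intros H. rewrite Zs_S, (H (- Z.of_nat (S N))%Z) by lia. ring. Qed.

Lemma expi_nat_tau n tau : expi (int_C (Z.of_nat n) * tau) = Cpow (expi tau) n.
Proof.
  induction n as [|n IH].
  - simpl. replace (int_C 0 * tau) with (RtoC 0) by (unfold int_C; simpl; ring). apply expi_0.
  - rewrite Nat2Z.inj_succ, <- Z.add_1_l, int_C_plus. cbn [Cpow].
    replace ((int_C 1 + int_C (Z.of_nat n)) * tau) with (tau + int_C (Z.of_nat n) * tau)
      by (unfold int_C; simpl; ring).
    rewrite expi_plus, IH. reflexivity.
Qed.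

Lemma Cmod_expi_tau_lt_1 tau : (0 < Im tau)%R -> (Cmod (expi tau) < 1)%R.
Proof.
  intros Ht. rewrite Cmod_expi, <- exp_0. apply exp_increasing. pose proof PI_RGT_0. nra.
Qed.

Lemma Clim_pow (y : C) : (Cmod y < 1)%R ->
  Clim (fun n => Cpow y n) 0 /\ Clim (fun n => INR n * Cpow y n) 0.
Proof.
  intros Hy. pose proof (Cmod_ge_0 y) as H0.
  (* compare with a geometric sequence of ratio [exp (- s)] *)
  set (r := ((Cmod y + 1) / 2)%R).
  assert (Hr : (0 < r < 1)%R) by (unfold r; lra).
  set (s := (- ln r)%R).
  assert (Hs : (0 < s)%R).
  { unfold s. assert (ln r < ln 1)%R by (apply ln_increasing; lra). rewrite ln_1 in H. lra. }
  assert (Es : exp (- s) = r) by (unfold s; rewrite Ropp_involutive; apply exp_ln; lra).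
  destruct (geo_poly s 1 Hs) as [K [s' [HK [Hs' P]]]].
  assert (B : forall n, (Cmod (Cpow y n) <= geo s (Z.of_nat n))%R).
  { intros n. rewrite Cmod_pow, geo_nat, Es. apply pow_incr. unfold r. lra. }
  split; intros eps He.
  - destruct (geo_small s 1 (eps / 2) Hs ltac:(lra)) as [N H]. exists (S N). intros n Hn.
    specialize (H (Z.of_nat n) ltac:(lia)). specialize (B n).
    replace (Cpow y n - 0) with (Cpow y n) by ring. lra.
  - destruct (geo_small s' K (eps / 2) Hs' ltac:(lra)) as [N H]. exists (S N). intros n Hn.
    specialize (H (Z.of_nat n) ltac:(lia)). specialize (B n). specialize (P (Z.of_nat n)).
    replace (INR n * Cpow y n - 0) with (INR n * Cpow y n) by ring.
    rewrite Cmod_mult, Cmod_R, (Rabs_pos_eq (INR n)) by apply pos_INR.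
    rewrite Z.abs_eq, <- INR_IZR_INZ, pow_1 in P by lia.
    pose proof (Rmult_le_compat_l (INR n) _ _ (pos_INR n) B). lra.
Qed.

(** The double series whose sums over [a] and over [b] are the two sides of
    [g1_lambert]. *)
Definition lambert_term (tau : C) (a b : Z) : C :=
  if ((0 <? a) && (0 <? b))%Z%bool then int_C a * expi (int_C (a * b) * tau) else 0.

Definition positive_part (f : Z -> C) (n : Z) : C := if (0 <? n)%Z then f n else 0.

Lemma positive_part_neg f n : (n <= 0)%Z -> positive_part f n = 0.
Proof. intros H. unfold positive_part. rewrite (proj2 (Z.ltb_ge 0 n) H). reflexivity. Qed.

Lemma positive_part_S f N : positive_part f (Z.of_nat (S N)) = f (Z.of_nat (S N)).
Proof. reflexivity. Qed.

Lemma expi_int_tau_lt_1 b tau : (0 < Im tau)%R -> (0 < b)%Z -> (Cmod (expi (int_C b * tau)) < 1)%R.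
Proof.
  intros Ht Hb. apply Cmod_expi_tau_lt_1.
  replace (Im (int_C b * tau)) with (IZR b * Im tau)%R by (unfold int_C, Im; simpl; ring).
  apply Rmult_lt_0_compat; [apply IZR_lt, Hb|exact Ht].
Qed.

Lemma lambert_row_a tau b : (0 < Im tau)%R ->
  Clim (Zs (fun a => lambert_term tau a b)) (positive_part (fun b => csq (int_C b * tau)) b).
Proof.
  intros Ht. destruct (Z_lt_le_dec 0 b) as [Hb|Hb].
  2:{ rewrite positive_part_neg by exact Hb.
      apply Clim_ext with (fun _ => 0); [|apply Clim_const]. intros N.
      unfold Zs. rewrite (lsum_ext _ (fun _ => 0)); [symmetry; apply lsum_zero|].
      intros a _. unfold lambert_term. rewrite (proj2 (Z.ltb_ge 0 b) Hb), Bool.andb_false_r. reflexivity. }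
  unfold positive_part. rewrite (proj2 (Z.ltb_lt 0 b) Hb).
  set (y := expi (int_C b * tau)).
  assert (Hy : (Cmod y < 1)%R) by (apply expi_int_tau_lt_1; assumption).
  assert (Ny : 1 - y <> 0).
  { apply sub_neq_0. intros Q. rewrite <- Q, Cmod_1 in Hy. lra. }
  destruct (Clim_pow y Hy) as [L0 L1].
  assert (F : forall N, Zs (fun a => lambert_term tau a b) N =
    (y - y * (INR N * Cpow y N) - y * Cpow y N + y * y * (INR N * Cpow y N)) / ((1 - y) * (1 - y))).
  { induction N as [|N IH].
    - rewrite Zs_O. change (lambert_term tau 0 b) with (RtoC 0). cbn [Cpow INR]. field. auto.
    - rewrite Zs_positive.
      + rewrite IH. unfold lambert_term.
        rewrite (proj2 (Z.ltb_lt 0 b) Hb), (proj2 (Z.ltb_lt 0 (Z.of_nat (S N)))) by lia. simpl andb.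
        replace (expi (int_C (Z.of_nat (S N) * b) * tau)) with (Cpow y (S N)).
        * replace (int_C (Z.of_nat (S N))) with (INR N + 1).
          -- rewrite S_INR, RtoC_plus. cbn [Cpow]. field. auto.
          -- unfold int_C. rewrite <- INR_IZR_INZ, S_INR, RtoC_plus. reflexivity.
        * unfold y. rewrite <- expi_nat_tau. f_equal. unfold int_C. rewrite mult_IZR, RtoC_mult. ring.
      + intros n Hn. unfold lambert_term. rewrite (proj2 (Z.ltb_ge 0 n) Hn). reflexivity. }
  eapply Clim_val.
  - apply Clim_ext with (2 := Clim_scal (/ ((1 - y) * (1 - y))) _ _
    (Clim_plus _ _ _ _ (Clim_minus _ _ _ _ (Clim_minus _ _ _ _ (Clim_const y) (Clim_scal y _ _ L1))
      (Clim_scal y _ _ L0)) (Clim_scal (y * y) _ _ L1))).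
    intros N. cbv beta. rewrite F. unfold Cdiv. ring.
  - unfold csq. fold y. field. auto.
Qed.

Lemma lambert_row_b tau a : (0 < Im tau)%R ->
  Clim (Zs (fun b => lambert_term tau a b))
    (positive_part (fun a => int_C a * expi (int_C a * tau) / (1 - expi (int_C a * tau))) a).
Proof.
  intros Ht. destruct (Z_lt_le_dec 0 a) as [Ha|Ha].
  2:{ rewrite positive_part_neg by exact Ha.
      apply Clim_ext with (fun _ => 0); [|apply Clim_const]. intros N.
      unfold Zs. rewrite (lsum_ext _ (fun _ => 0)); [symmetry; apply lsum_zero|].
      intros b _. unfold lambert_term. rewrite (proj2 (Z.ltb_ge 0 a) Ha). reflexivity. }
  unfold positive_part. rewrite (proj2 (Z.ltb_lt 0 a) Ha).
  set (y := expi (int_C a * tau)).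
  assert (Hy : (Cmod y < 1)%R) by (apply expi_int_tau_lt_1; assumption).
  assert (Ny : 1 - y <> 0).
  { apply sub_neq_0. intros Q. rewrite <- Q, Cmod_1 in Hy. lra. }
  destruct (Clim_pow y Hy) as [L0 _].
  assert (F : forall N, Zs (fun b => lambert_term tau a b) N =
    int_C a / (1 - y) * (y - y * Cpow y N)).
  { induction N as [|N IH].
    - rewrite Zs_O. unfold lambert_term. rewrite Bool.andb_false_r. simpl. ring.
    - rewrite Zs_positive.
      + rewrite IH. unfold lambert_term.
        rewrite (proj2 (Z.ltb_lt 0 a) Ha), (proj2 (Z.ltb_lt 0 (Z.of_nat (S N)))) by lia. simpl andb.
        replace (expi (int_C (a * Z.of_nat (S N)) * tau)) with (Cpow y (S N)).
        * cbn [Cpow]. field. auto.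
        * unfold y. rewrite <- expi_nat_tau. f_equal. unfold int_C. rewrite mult_IZR, RtoC_mult. ring.
      + intros n Hn. unfold lambert_term. rewrite (proj2 (Z.ltb_ge 0 n) Hn), Bool.andb_false_r. reflexivity. }
  eapply Clim_val.
  - apply Clim_ext with (2 := Clim_scal (int_C a / (1 - y)) _ _
      (Clim_minus _ _ _ _ (Clim_const y) (Clim_scal y _ _ L0))).
    intros N. cbv beta. rewrite F. reflexivity.
  - field. auto.
Qed.

(** For positive integers a b >= a + b - 1 separates the exponent. *)
Lemma lambert_term_dominated tau : (0 < Im tau)%R -> exists al, summable al /\
  forall a b, (Cmod (lambert_term tau a b) <= al a * al b)%R.
Proof.
  intros Ht. pose proof PI_RGT_0 as Hpi.
  set (s := (2 * PI * Im tau)%R). assert (Hs : (0 < s)%R) by (unfold s; nra).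
  destruct (geo_poly s 1 Hs) as [K [s' [HK [Hs' P]]]].
  set (M := (1 + exp s * K)%R).
  assert (HM : (0 <= exp s * K)%R) by (apply Rmult_le_pos; [left; apply exp_pos|lra]).
  assert (G : forall t n, (0 < geo t n)%R) by (intros; apply geo_pos).
  exists (fun n => M * (geo s n + geo s' n))%R. split.
  - apply summable_scal; [unfold M; lra|].
    destruct (summable_geo s Hs) as [_ [S1 H1]]. destruct (summable_geo s' Hs') as [_ [S2 H2]].
    split; [intros n; left; pose proof (G s n); pose proof (G s' n); lra|].
    exists (S1 + S2)%R. intros N. rewrite rsum_plus. apply Rplus_le_compat; auto.
  - intros a b. pose proof (G s a); pose proof (G s b); pose proof (G s' a); pose proof (G s' b).
    assert (Pos : (exp s * K * (geo s' a * geo s b) <=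
      M * (geo s a + geo s' a) * (M * (geo s b + geo s' b)))%R).
    { replace (M * (geo s a + geo s' a) * (M * (geo s b + geo s' b)))%R with
        ((M * M) * ((geo s a + geo s' a) * (geo s b + geo s' b)))%R by ring.
      apply Rmult_le_compat; [exact HM|nra|unfold M; nra|].
      apply Rmult_le_compat; lra. }
    unfold lambert_term. destruct ((0 <? a) && (0 <? b))%Z%bool eqn:Q.
    + apply andb_prop in Q. destruct Q as [Qa Qb]. apply Z.ltb_lt in Qa. apply Z.ltb_lt in Qb.
      eapply Rle_trans; [|exact Pos].
      rewrite Cmod_mult, Cmod_expi. unfold int_C at 1. rewrite Cmod_R, <- abs_IZR.
      replace (Im (int_C (a * b) * tau)) with (IZR (a * b) * Im tau)%R
        by (unfold int_C, Im; simpl; ring).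
      specialize (P a). rewrite pow_1 in P.
      apply Rle_trans with (IZR (Z.abs a) * (exp s * (geo s a * geo s b)))%R.
      * apply Rmult_le_compat_l; [apply IZR_le; lia|]. unfold geo. rewrite <- !exp_plus.
        apply exp_mono. rewrite !Z.abs_eq by lia.
        assert (IZR a + IZR b - 1 <= IZR (a * b))%R.
        { rewrite <- plus_IZR, <- minus_IZR. apply IZR_le. nia. }
        replace (2 * PI * (IZR (a * b) * Im tau))%R with (s * IZR (a * b))%R by (unfold s; ring).
        nra.
      * replace (IZR (Z.abs a) * (exp s * (geo s a * geo s b)))%R with
          (exp s * geo s b * (IZR (Z.abs a) * geo s a))%R by ring.
        replace (exp s * K * (geo s' a * geo s b))%R with (exp s * geo s b * (K * geo s' a))%R by ring.
        apply Rmult_le_compat_l; [|exact P].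
        apply Rmult_le_pos; [left; apply exp_pos|lra].
    + rewrite Cmod_0. eapply Rle_trans; [|exact Pos].
      apply Rmult_le_pos; [exact HM|nra].
Qed.

Lemma Clim_is_series (a : nat -> C) l : Clim (fun N => sum_n (G := C_NormedModule) a N) l ->
  is_series (K := C_AbsRing) (V := C_NormedModule) a l.
Proof.
  intros H P HP. apply locally_C_Cmod in HP. destruct HP as [d [Hd K]].
  destruct (H d Hd) as [N HN]. exists N. intros n Hn. apply K, HN, Hn.
Qed.

Lemma C_series_eq (a : nat -> C) l : Clim (fun N => sum_n (G := C_NormedModule) a N) l ->
  C_series a = l.
Proof.
  intros H. apply (iota_unique (V := C_CompleteNormedModule)).
  - intros y Hy. exact (filterlim_locally_unique (V := C_CompleteNormedModule) _ _ _ Hy (Clim_is_series a l H)).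
  - exact (Clim_is_series a l H).
Qed.

(** The double series is summed in two ways: over [a] it gives the derivatives of
    the cotangent, over [b] the series that defines [g1]. *)
Lemma g1_lambert tau : (0 < Im tau)%R -> g1 tau = P2i * P2i * (lambert tau - / 12).
Proof.
  intros Ht.
  destruct (lambert_term_dominated tau Ht) as [al [Sal D]].
  set (r1 := positive_part (fun b => csq (int_C b * tau))).
  set (r2 := positive_part (fun a => int_C a * expi (int_C a * tau) / (1 - expi (int_C a * tau)))).
  pose proof (square_sums (lambert_term tau) al (fun N => N) r1 Sal (fun j => le_n j) D
    (fun b => lambert_row_a tau b Ht)) as A.
  pose proof (square_sums (fun b a => lambert_term tau a b) al (fun N => N) r2 Sal (fun j => le_n j)
    (fun b a => Rle_trans _ _ _ (D a b) (Req_le _ _ (Rmult_comm _ _)))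
    (fun a => lambert_row_b tau a Ht)) as B.
  assert (L1 : Clim (Zs r1) (lambert tau * / 2)).
  { eapply Clim_val; [|apply Cmult_comm].
    apply Clim_ext with (2 := Clim_scal (/ 2) _ _ (lambert_converges tau Ht)).
    intros N. cbv beta.
    assert (Q : Zs (nonzero_part (fun b => csq (int_C b * tau))) N = 2 * Zs r1 N).
    { induction N as [|N IH].
      - rewrite !Zs_O. change (RtoC 0 = 2 * 0). ring.
      - rewrite Zs_S, (Zs_positive r1) by apply positive_part_neg. rewrite IH.
        unfold r1. rewrite positive_part_S. unfold nonzero_part.
        destruct (Z.eq_dec (Z.of_nat (S N)) 0); [lia|].
        destruct (Z.eq_dec (- Z.of_nat (S N)) 0); [lia|].
        rewrite int_C_opp.
        replace (- int_C (Z.of_nat (S N)) * tau) with (- (int_C (Z.of_nat (S N)) * tau)) by ring.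
        rewrite csq_opp. ring. }
    rewrite Q. field. }
  assert (L2 : Clim (Zs r2) (lambert tau * / 2)).
  { apply Clim_ext with (fun N =>
      Zs (fun y => Zs (fun x => lambert_term tau x y) N) N
      - (Zs (fun y => Zs (fun x => lambert_term tau y x) N) N - Zs r2 N)).
    { intros N. rewrite (Zs_swap (lambert_term tau)). ring. }
    eapply Clim_val; [apply Clim_minus; [apply (Clim_diff _ _ _ A L1)|exact B]|ring]. }
  unfold g1. change (C_exp (2 * PI * Ci * tau)) with (expi tau).
  rewrite (C_series_eq _ (lambert tau * / 2)).
  - assert (H12 : RtoC 12 <> 0) by (apply RtoC_neq; lra).
    assert (Hsq : Ci * Ci = - (1)) by (apply injective_projections; simpl; ring).
    replace (P2i * P2i) with (4 * (PI * PI) * (Ci * Ci)) by (unfold P2i; ring).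
    rewrite Hsq. field.
  - apply Clim_ext with (fun N => Zs r2 (S N)).
    + induction n as [|N IH].
      * rewrite sum_O. rewrite Zs_positive by apply positive_part_neg. rewrite Zs_O.
        unfold r2. rewrite positive_part_S, expi_nat_tau, positive_part_neg by lia.
        unfold int_C. rewrite <- INR_IZR_INZ. ring.
      * rewrite sum_Sn, <- IH, Zs_positive by apply positive_part_neg.
        unfold r2 at 2. rewrite positive_part_S, expi_nat_tau.
        unfold int_C. rewrite <- INR_IZR_INZ. reflexivity.
    + apply (Clim_subseq (Zs r2) _ S); [lia|exact L2].
Qed.

(** The linear terms of [zeta_Rho] and of [q] are the same, since [g1] is the
    quasi-period of [zeta] while the period 1 of [Rho 0 0] is exact. *)
Lemma zeta_Rho_g1 z tau : (0 < Im tau)%R -> off_lattice tau z ->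
  zeta z tau = Rho 0 0 z tau + g1 tau * z.
Proof.
  intros Ht Hoff. rewrite (zeta_Rho z tau Ht Hoff), (g1_lambert tau Ht). ring.
Qed.

(** All coefficients of the bracket are thus values of one odd function and of
    its derivatives, and linear terms have disappeared. *)
Lemma q_Rho u v tau : (0 < Im tau)%R -> off_lattice tau (v - u) -> off_lattice tau u ->
  q u v tau = Rho 0 0 (v - u) tau + Rho 0 0 u tau.
Proof.
  intros Ht H1 H2. unfold q. rewrite !zeta_Rho_g1 by assumption. ring.
Qed.

(** * Differential polynomials *)

(** The three generators of a Jacobi identity; each of them comes with a
    spectral parameter and with a test function. *)
Inductive slot := SU | SV | SW.

Definition slot_eqb (f g : slot) : bool :=
  match f, g with SU, SU | SV, SV | SW, SW => true | _, _ => false end.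

Lemma slot_eqb_spec f g : slot_eqb f g = true <-> f = g.
Proof. destruct f, g; simpl; split; congruence. Qed.

(** A spectral parameter, or the point 0. *)
Definition point := option slot.

Definition point_eqb (p q : point) : bool :=
  match p, q with
  | None, None => true
  | Some f, Some g => slot_eqb f g
  | _, _ => false
  end.

(** The derivatives of order [i] in the spectral parameter and [k] along the loop
    of the field e in the slot [f] ([AE]), those of tau ([AT]), the values of
    [Rho i k] at differences of points ([AR]), the derivatives of the test
    functions ([AX]), and the constants lambda ([AL]) and 2 pi i ([AP]). *)
Inductive atom :=
  | AE (f : slot) (i k : nat)
  | AT (k : nat)
  | AR (p q : point) (i k : nat)
  | AX (n : slot) (k : nat)
  | AL
  | AP.

Inductive dpoly :=
  | Cst (z : Z)
  | At (a : atom)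
  | Add (p q : dpoly)
  | Mul (p q : dpoly)
  | Opp (p : dpoly).

Declare Scope dpoly_scope.
Delimit Scope dpoly_scope with dp.
Bind Scope dpoly_scope with dpoly.
Notation "p + q" := (Add p q) : dpoly_scope.
Notation "p * q" := (Mul p q) : dpoly_scope.
Notation "- p" := (Opp p) : dpoly_scope.
Notation "p - q" := (Add p (Opp q)) : dpoly_scope.

Fixpoint den (val : atom -> C) (p : dpoly) : C :=
  match p with
  | Cst z => int_C z
  | At a => val a
  | Add p q => den val p + den val q
  | Mul p q => den val p * den val q
  | Opp p => - den val p
  end.

(** Sum and product with the trivial cases removed, so that iterated formal
    derivatives stay small. *)
Definition add (p q : dpoly) : dpoly :=
  match p, q with Cst 0, _ => q | _, Cst 0 => p | _, _ => Add p q end.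
Definition mul (p q : dpoly) : dpoly :=
  match p, q with Cst 0, _ => Cst 0 | _, Cst 0 => Cst 0 | _, _ => Mul p q end.
Definition opp (p : dpoly) : dpoly := match p with Cst 0 => Cst 0 | _ => Opp p end.

Lemma int_C_0 : int_C 0 = 0.
Proof. reflexivity. Qed.

Lemma add_cases p q :
  (p = Cst 0 /\ add p q = q) \/ (q = Cst 0 /\ add p q = p) \/ add p q = Add p q.
Proof. destruct p as [[]| | | |], q as [[]| | | |]; simpl; auto. Qed.

Lemma mul_cases p q :
  ((p = Cst 0 \/ q = Cst 0) /\ mul p q = Cst 0) \/ mul p q = Mul p q.
Proof. destruct p as [[]| | | |], q as [[]| | | |]; simpl; auto. Qed.

Lemma opp_cases p : (p = Cst 0 /\ opp p = Cst 0) \/ opp p = Opp p.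
Proof. destruct p as [[]| | | |]; simpl; auto. Qed.

Ltac zero_cases :=
  match goal with
  | |- context [add ?p ?q] => destruct (add_cases p q) as [[-> ->]|[[-> ->]| ->]]
  | |- context [mul ?p ?q] => destruct (mul_cases p q) as [[[-> | ->] ->]| ->]
  | |- context [opp ?p] => destruct (opp_cases p) as [[-> ->]| ->]
  end.

Lemma den_add val p q : den val (add p q) = den val p + den val q.
Proof. zero_cases; simpl; rewrite ?int_C_0; ring. Qed.

Lemma den_mul val p q : den val (mul p q) = den val p * den val q.
Proof. zero_cases; simpl; rewrite ?int_C_0; ring. Qed.

Lemma den_opp val p : den val (opp p) = - den val p.
Proof. zero_cases; simpl; rewrite ?int_C_0; ring. Qed.

Fixpoint deriv (d : atom -> dpoly) (p : dpoly) : dpoly :=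
  match p with
  | Cst _ => Cst 0
  | At a => d a
  | Add p q => add (deriv d p) (deriv d q)
  | Mul p q => add (mul (deriv d p) q) (mul p (deriv d q))
  | Opp p => opp (deriv d p)
  end.

Fixpoint all_atoms (P : atom -> Prop) (p : dpoly) : Prop :=
  match p with
  | Cst _ => True
  | At a => P a
  | Add p q | Mul p q => all_atoms P p /\ all_atoms P q
  | Opp p => all_atoms P p
  end.

Lemma all_atoms_impl (P Q : atom -> Prop) p :
  (forall a, P a -> Q a) -> all_atoms P p -> all_atoms Q p.
Proof. intros H. induction p; simpl; intuition. Qed.

Lemma all_atoms_add P p q : all_atoms P p -> all_atoms P q -> all_atoms P (add p q).
Proof. zero_cases; simpl; tauto. Qed.

Lemma all_atoms_mul P p q : all_atoms P p -> all_atoms P q -> all_atoms P (mul p q).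
Proof. zero_cases; simpl; tauto. Qed.

Lemma all_atoms_opp P p : all_atoms P p -> all_atoms P (opp p).
Proof. zero_cases; simpl; tauto. Qed.

Lemma all_atoms_deriv P d p :
  (forall a, P a -> all_atoms P (d a)) -> all_atoms P p -> all_atoms P (deriv d p).
Proof.
  intros H. induction p; simpl; intros; auto.
  - apply all_atoms_add; tauto.
  - apply all_atoms_add; apply all_atoms_mul; tauto.
  - apply all_atoms_opp; tauto.
Qed.

(** The chain rule: all derivatives below, in the loop variable, in a spectral
    parameter and along a variation of the fields, are instances. *)
Lemma D_den {T} (i : T -> C) (val : T -> atom -> C) (x : T) (d : atom -> dpoly) p :
  all_atoms (fun a => D_at i (fun y => val y a) x (den (val x) (d a))) p ->
  D_at i (fun y => den (val y) p) x (den (val x) (deriv d p)).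
Proof.
  induction p; simpl; intros H.
  - rewrite int_C_0. apply D_at_const.
  - exact H.
  - rewrite den_add. apply D_at_plus; tauto.
  - rewrite den_add, !den_mul. apply (D_at_mult i (fun y => den (val y) p1) (fun y => den (val y) p2)); tauto.
  - rewrite den_opp. apply D_at_opp; tauto.
Qed.

Lemma den_ext (val val' : atom -> C) p :
  all_atoms (fun a => val a = val' a) p -> den val p = den val' p.
Proof.
  induction p; simpl; intros H; auto; try (destruct H); rewrite ?IHp1, ?IHp2, ?IHp; auto.
Qed.

Lemma den_deriv_add val d p q :
  den val (deriv d (add p q)) = den val (deriv d p) + den val (deriv d q).
Proof. zero_cases; simpl; rewrite ?den_add, ?int_C_0; ring. Qed.

Lemma den_deriv_mul val d p q :
  den val (deriv d (mul p q)) = den val (deriv d p) * den val q + den val p * den val (deriv d q).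
Proof. zero_cases; simpl; rewrite ?den_add, ?den_mul, ?int_C_0; ring. Qed.

Lemma den_deriv_opp val d p : den val (deriv d (opp p)) = - den val (deriv d p).
Proof. zero_cases; simpl; rewrite ?den_opp, ?int_C_0; ring. Qed.

(** The commutator of two derivations is a derivation, so it is enough that it
    vanishes on the atoms. *)
Lemma den_deriv_comm val d1 d2 p :
  (forall a, den val (deriv d1 (d2 a)) = den val (deriv d2 (d1 a))) ->
  den val (deriv d1 (deriv d2 p)) = den val (deriv d2 (deriv d1 p)).
Proof.
  intros H. induction p; simpl.
  - reflexivity.
  - apply H.
  - rewrite !den_deriv_add, IHp1, IHp2. reflexivity.
  - rewrite !den_deriv_add, !den_deriv_mul, IHp1, IHp2. ring.
  - rewrite !den_deriv_opp, IHp. reflexivity.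
Qed.

(** ** Deciding identities between differential polynomials *)

Definition atom_eqb (a b : atom) : bool :=
  match a, b with
  | AE f i k, AE f' i' k' => slot_eqb f f' && Nat.eqb i i' && Nat.eqb k k'
  | AT k, AT k' => Nat.eqb k k'
  | AR p q i k, AR p' q' i' k' => point_eqb p p' && point_eqb q q' && Nat.eqb i i' && Nat.eqb k k'
  | AX n k, AX n' k' => slot_eqb n n' && Nat.eqb k k'
  | AL, AL | AP, AP => true
  | _, _ => false
  end%bool.

Lemma point_eqb_spec p q : point_eqb p q = true <-> p = q.
Proof.
  destruct p as [f|], q as [g|]; simpl; split; try congruence.
  - intros H. apply slot_eqb_spec in H. congruence.
  - intros H. apply slot_eqb_spec. congruence.
Qed.

Lemma atom_eqb_eq a b : atom_eqb a b = true -> a = b.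
Proof.
  destruct a, b; simpl; try discriminate; rewrite ?Bool.andb_true_iff, ?Nat.eqb_eq;
    intuition (repeat match goal with
    | H : slot_eqb _ _ = true |- _ => apply slot_eqb_spec in H
    | H : point_eqb _ _ = true |- _ => apply point_eqb_spec in H end; congruence).
Qed.

Fixpoint atoms (p : dpoly) (L : list atom) : list atom :=
  match p with
  | Cst _ => L
  | At a => if existsb (atom_eqb a) L then L else a :: L
  | Add p q | Mul p q => atoms p (atoms q L)
  | Opp p => atoms p L
  end.

Fixpoint position (a : atom) (L : list atom) : positive :=
  match L with
  | [] => 1
  | b :: L' => if atom_eqb a b then 1 else Pos.succ (position a L')
  end.

Definition atom_at (L : list atom) (n : positive) : atom := nth (pred (Pos.to_nat n)) L AL.

Fixpoint normal (L : list atom) (p : dpoly) : Pol Z :=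
  match p with
  | Cst z => Pc z
  | At a => mk_X 0%Z 1%Z (position a L)
  | Add p q => Padd 0%Z Z.add Z.eqb (normal L p) (normal L q)
  | Mul p q => Pmul 0%Z 1%Z Z.add Z.mul Z.eqb (normal L p) (normal L q)
  | Opp p => Popp Z.opp (normal L p)
  end.

(** Equality of the normal forms of the [ring] tactic with integer coefficients;
    as a boolean function it is evaluated on whole Jacobiators. *)
Definition identical (p q : dpoly) : bool :=
  let L := atoms p (atoms q []) in
  Peq Z.eqb (normal L p) (normal L q).

Lemma C_ring_th : ring_theory (RtoC 0) (RtoC 1) Cplus Cmult Cminus Copp (@eq C).
Proof. constructor; intros; ring. Qed.

Lemma C_morph : ring_morph (RtoC 0) (RtoC 1) Cplus Cmult Cminus Copp (@eq C)
  0%Z 1%Z Z.add Z.mul Z.sub Z.opp Z.eqb int_C.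
Proof.
  constructor; intros; unfold int_C; try reflexivity.
  - now rewrite plus_IZR, RtoC_plus.
  - now rewrite minus_IZR, RtoC_minus.
  - now rewrite mult_IZR, RtoC_mult.
  - now rewrite opp_IZR, RtoC_opp.
  - apply Z.eqb_eq in H. now subst.
Qed.

Lemma C_ring_ext : ring_eq_ext Cplus Cmult Copp (@eq C).
Proof. constructor; intros ? ? H; try intros ? ? H'; subst; reflexivity. Qed.

Lemma atom_at_position a L : In a L -> atom_at L (position a L) = a.
Proof.
  induction L as [|b L IH]; intros H; [destruct H|]. simpl.
  destruct (atom_eqb a b) eqn:Q.
  - apply atom_eqb_eq in Q. now subst.
  - destruct H as [->|H].
    + exfalso. assert (R : forall n, Nat.eqb n n = true) by apply Nat.eqb_refl.
      assert (S : forall f, slot_eqb f f = true) by (intros; now apply slot_eqb_spec).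
      assert (T : forall p, point_eqb p p = true) by (intros; now apply point_eqb_spec).
      destruct a; simpl in Q; rewrite ?R, ?S, ?T in Q; discriminate.
    + unfold atom_at in *. rewrite Pos2Nat.inj_succ. simpl.
      pose proof (Pos2Nat.is_pos (position a L)).
      destruct (Pos.to_nat (position a L)); [lia|]. simpl in *. auto.
Qed.

Lemma atoms_incl p L a : In a L -> In a (atoms p L).
Proof.
  revert L. induction p; simpl; intros L H; auto.
  destruct (existsb (atom_eqb a0) L); [exact H|now right].
Qed.

Lemma atoms_complete p L : all_atoms (fun a => In a (atoms p L)) p.
Proof.
  revert L. induction p; simpl; intros L; auto.
  - destruct (existsb (atom_eqb a) L) eqn:Q; [|now left].
    apply existsb_exists in Q. destruct Q as [b [Hb E1]]. apply atom_eqb_eq in E1. now subst.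
  - split; [apply IHp1|]. eapply all_atoms_impl; [|apply (IHp2 L)].
    intros a Ha. now apply atoms_incl.
  - split; [apply IHp1|]. eapply all_atoms_impl; [|apply (IHp2 L)].
    intros a Ha. now apply atoms_incl.
Qed.

Lemma normal_correct val L p : all_atoms (fun a => In a L) p ->
  Pphi Cplus Cmult int_C (fun n => val (atom_at L n)) (normal L p) = den val p.
Proof.
  induction p; simpl; intros H.
  - reflexivity.
  - rewrite <- (mkX_ok RelationClasses.eq_equivalence C_ring_ext (Rth_ARth RelationClasses.eq_equivalence C_ring_ext C_ring_th) C_morph).
    unfold Env.nth. now rewrite atom_at_position.
  - rewrite (Padd_ok RelationClasses.eq_equivalence C_ring_ext (Rth_ARth RelationClasses.eq_equivalence C_ring_ext C_ring_th) C_morph).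
    rewrite IHp1, IHp2; tauto.
  - rewrite (Pmul_ok RelationClasses.eq_equivalence C_ring_ext (Rth_ARth RelationClasses.eq_equivalence C_ring_ext C_ring_th) C_morph).
    rewrite IHp1, IHp2; tauto.
  - rewrite (Popp_ok RelationClasses.eq_equivalence C_ring_ext (Rth_ARth RelationClasses.eq_equivalence C_ring_ext C_ring_th) C_morph).
    rewrite IHp; tauto.
Qed.

Lemma identical_correct p q : identical p q = true -> forall val, den val p = den val q.
Proof.
  intros H val. unfold identical in H. set (L := atoms p (atoms q [])) in *.
  rewrite <- (normal_correct val L p), <- (normal_correct val L q).
  - apply (Peq_ok RelationClasses.eq_equivalence C_ring_ext C_morph). exact H.
  - eapply all_atoms_impl; [|apply (atoms_complete q [])]. intros a Ha. now apply atoms_incl.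
  - apply atoms_complete.
Qed.

(** * The bracket as a differential polynomial *)

Definition d_x (a : atom) : dpoly :=
  match a with
  | AE f i k => At (AE f i (S k))
  | AT k => At (AT (S k))
  | AR p q i k => At (AR p q i (S k)) * At (AT 1)
  | AX n k => At (AX n (S k))
  | AL | AP => Cst 0
  end%dp.

Definition d_s (f : slot) (a : atom) : dpoly :=
  match a with
  | AE g i k => if slot_eqb f g then At (AE g (S i) k) else Cst 0
  | AR p q i k =>
      add (if point_eqb p (Some f) then At (AR p q (S i) k) else Cst 0)
          (if point_eqb q (Some f) then Opp (At (AR p q (S i) k)) else Cst 0)
  | _ => Cst 0
  end.

Notation Dx := (deriv d_x).
Notation Ds f := (deriv (d_s f)).

Definition rank (p : point) : nat :=
  match p with Some SU => 0 | Some SV => 1 | Some SW => 2 | None => 3 end.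

(** The value of [Rho i k] at the difference [p - q]; parity is used to keep
    one atom for each pair of opposite arguments. *)
Definition rho (p q : point) (i k : nat) : dpoly :=
  if Nat.leb (rank p) (rank q) then At (AR p q i k)
  else if Nat.even i then Opp (At (AR q p i k)) else At (AR q p i k).

Definition at_e f i k := At (AE f i k).
Definition at_t k := At (AT k).
Definition at_x n k := At (AX n k).

Definition q_ (f g : slot) (k : nat) : dpoly := (rho (Some g) (Some f) 0 k + rho (Some f) None 0 k)%dp.

Definition k1_ (f g : slot) : dpoly :=
  (q_ g f 0 * at_e f 1 0 * at_e g 0 0 + q_ f g 0 * at_e f 0 0 * at_e g 1 0 + At AL * at_e f 1 0 * at_e g 1 0)%dp.

Definition k0_ (f g : slot) : dpoly :=
  (q_ g f 1 * at_e f 1 0 * at_e g 0 0 * at_t 1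
   + rho (Some f) (Some g) 1 0 * (at_e f 0 0 * at_e g 0 1 - at_e g 0 0 * at_e f 0 1)
   + q_ g f 0 * at_e f 1 0 * at_e g 0 1
   + q_ f g 0 * at_e f 0 0 * at_e g 1 1
   + At AL * at_e f 1 0 * at_e g 1 1)%dp.

Inductive gen := GT (f : slot) | GE (f : slot).

Definition slot_of (A : gen) : slot := match A with GT f | GE f => f end.

(** The test function of [A] sits in the slot of [A]; derivatives of the delta
    function have been moved to it by parts, as in [smear]. *)
Definition bracket_ (A B : gen) : dpoly :=
  match A, B with
  | GT _, GT _ => Cst 0
  | GT n, GE g => Opp (At AP * at_e g 0 0 * at_x n 1)
  | GE f, GT _ => Opp (Dx (At AP * at_e f 0 0 * at_x f 0))
  | GE f, GE g => k0_ f g * at_x f 0 - Dx (k1_ f g * at_x f 0)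
  end%dp.

(** The variation of the fields and of their derivatives along the Hamiltonian
    vector field of [A]. *)
Definition vary (A : gen) (a : atom) : dpoly :=
  match a with
  | AE g i k => Nat.iter i (Ds g) (Nat.iter k Dx (bracket_ A (GE g)))
  | AT k => Nat.iter k Dx (bracket_ A (GT SU))
  | AR p q i k => At (AR p q i (S k)) * bracket_ A (GT SU)
  | AX _ _ | AL | AP => Cst 0
  end%dp.

Definition double_ (A B C' : gen) : dpoly :=
  (at_x (slot_of C') 0 * deriv (vary A) (bracket_ B C'))%dp.

Definition jacobiator (A B C' : gen) : dpoly :=
  (double_ A B C' + double_ B C' A + double_ C' A B)%dp.

(** Integration by parts.  For [p] linear in the derivatives of order at most 2
    of the test function [n], [p] minus the derivative of [primitive n p] is a
    multiple of the test function itself.  Such an expression integrates to 0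
    for all test functions only if it vanishes. *)
Definition d_test (n : slot) (k : nat) (a : atom) : dpoly :=
  if atom_eqb a (AX n k) then Cst 1 else Cst 0.

Definition primitive (n : slot) (p : dpoly) : dpoly :=
  (at_x n 0 * deriv (d_test n 1) p + at_x n 1 * deriv (d_test n 2) p
   - at_x n 0 * Dx (deriv (d_test n 2) p))%dp.

(** Vanishes by [Rho_addition] for the arguments [p - q] and [q - r]. *)
Definition addition_ (p q r : point) : dpoly :=
  (At AP * (rho p q 0 1 - rho q r 0 1)
   - rho p q 1 0 * (rho p r 0 0 - rho q r 0 0)
   - rho q r 1 0 * (rho p q 0 0 - rho p r 0 0))%dp.

(** The addition theorem implies that this does not depend on the middle point
    [q]; [split_] compares two of them. *)
Definition mixed_ (p q r : point) : dpoly :=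
  (rho p q 1 0 * (rho q r 0 1 - rho p r 0 1)
   + rho q r 1 0 * (rho p q 0 1 - rho p r 0 1)
   - rho p r 1 1 * (rho p q 0 0 + rho q r 0 0))%dp.

Definition split_ (p q r s : point) : dpoly := (mixed_ p q s - mixed_ p r s)%dp.

(** The part of the Jacobi identity which is not formal: a combination of
    instances of the addition theorem and of [split_], with the densities of the generators [f]
    and [g], multiplied by their test functions, as coefficients. *)
Definition obstruction (f g h : slot) : dpoly :=
  ((addition_ (Some f) (Some g) (Some h) - addition_ None (Some g) (Some f))
     * Dx (at_x f 0 * at_e f 0 0) * (at_x g 0 * at_e g 0 0)
   + (addition_ None (Some f) (Some g) - addition_ (Some g) (Some f) (Some h))
     * (at_x f 0 * at_e f 0 0) * Dx (at_x g 0 * at_e g 0 0)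
   + at_t 1 * split_ (Some f) (Some h) None (Some g) * (at_x f 0 * at_e f 0 0) * (at_x g 0 * at_e g 0 0))%dp.

(** A Jacobian determinant in the spectral parameter [h] and the loop variable:
    the only form in which [obstruction] enters the Jacobiator. *)
Definition jacobian (f g h : slot) : dpoly :=
  (at_x h 0 * (at_e h 1 0 * Dx (obstruction f g h) - at_e h 0 1 * Ds h (obstruction f g h)))%dp.

Definition jacobians : dpoly := (jacobian SU SV SW + jacobian SV SW SU + jacobian SW SU SV)%dp.

(** The heart of the Jacobi identity.  With [tau] among the generators no
    property of [Rho] besides its parity is used, as the next lemmas show. *)
Lemma jacobiator_EEE :
  let p := jacobiator (GE SU) (GE SV) (GE SW) in
  identical p (jacobians + Dx (primitive SW (p - jacobians))) = true.
Proof. vm_compute. reflexivity. Qed.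

Lemma jacobiator_EET :
  let p := jacobiator (GE SU) (GE SV) (GT SW) in identical p (Dx (primitive SW p)) = true.
Proof. vm_compute. reflexivity. Qed.

Lemma jacobiator_ETT :
  let p := jacobiator (GE SU) (GT SV) (GT SW) in identical p (Dx (primitive SW p)) = true.
Proof. vm_compute. reflexivity. Qed.

Lemma jacobiator_TTT :
  let p := jacobiator (GT SU) (GT SV) (GT SW) in identical p (Dx (primitive SW p)) = true.
Proof. vm_compute. reflexivity. Qed.

Lemma anticommutator_EE :
  let p := (at_x SV 0 * bracket_ (GE SU) (GE SV) + at_x SU 0 * bracket_ (GE SV) (GE SU))%dp in
  identical p (Dx (primitive SV p)) = true.
Proof. vm_compute. reflexivity. Qed.

Lemma anticommutator_ET :
  let p := (at_x SV 0 * bracket_ (GE SU) (GT SV) + at_x SU 0 * bracket_ (GT SV) (GE SU))%dp in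
  identical p (Dx (primitive SV p)) = true.
Proof. vm_compute. reflexivity. Qed.

Lemma anticommutator_TT :
  let p := (at_x SV 0 * bracket_ (GT SU) (GT SV) + at_x SU 0 * bracket_ (GT SV) (GT SU))%dp in
  identical p (Dx (primitive SV p)) = true.
Proof. vm_compute. reflexivity. Qed.

(** Eliminating the [tau]-derivatives from [split_] by [addition_] leaves
    relations between the values of [Rho 0 0] and its derivatives in [z], which
    follow from [addition_] and its derivatives again. *)
Definition split_certificate (a b c : point) (g : slot) : dpoly :=
  let d := Some g in
  (rho a b 1 0 * (addition_ c d b - addition_ c d a)
   + rho b d 1 0 * (addition_ d a c - addition_ b a c)
   + rho a c 1 0 * (addition_ b d a - addition_ c d b)
   + rho c d 1 0 * (addition_ b a c - addition_ d a b)
   - (rho a b 0 0 + rho b d 0 0) * Ds g (addition_ d a c)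
   - (rho d c 0 0 - rho a c 0 0) * Ds g (addition_ d a b))%dp.

Lemma split_certified :
  List.forallb (fun x => match x with (f, g, h) =>
     identical (At AP * split_ (Some f) (Some h) None (Some g))
       (split_certificate (Some f) (Some h) None g) end)
    [(SU, SV, SW); (SV, SW, SU); (SW, SU, SV)] = true.
Proof. vm_compute. reflexivity. Qed.

(** * Evaluation of differential polynomials *)

(** The jets of the spectral field in the slot [f] are meaningful at the spectral
    parameters in [dom f]. *)
Record env := Env {
  sp : slot -> C;
  dom : slot -> C -> Prop;
  jet : slot -> nat -> nat -> C -> R -> C;
  tjet : nat -> R -> C;
  xjet : slot -> nat -> R -> C;
  lam : C }.

Definition pt (s : slot -> C) (p : point) : C := match p with Some f => s f | None => 0 end.

Definition val (v : env) (x : R) (a : atom) : C :=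
  match a with
  | AE f i k => jet v f i k (sp v f) x
  | AT k => tjet v k x
  | AR p q i k => Rho i k (pt (sp v) p - pt (sp v) q) (tjet v 0 x)
  | AX n k => xjet v n k x
  | AL => lam v
  | AP => P2i
  end.

Definition upd (s : slot -> C) (f : slot) (w : C) : slot -> C :=
  fun g => if slot_eqb g f then w else s g.

Definition set_sp (v : env) (s : slot -> C) : env := Env s (dom v) (jet v) (tjet v) (xjet v) (lam v).

Definition at_ (v : env) (f : slot) (w : C) : env := set_sp v (upd (sp v) f w).

Lemma upd_same s f w : upd s f w f = w.
Proof. unfold upd. now rewrite (proj2 (slot_eqb_spec f f) eq_refl). Qed.

Lemma upd_other s f w g : g <> f -> upd s f w g = s g.
Proof.
  intros H. unfold upd. destruct (slot_eqb g f) eqn:Q; [|reflexivity].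
  apply slot_eqb_spec in Q. contradiction.
Qed.

Lemma upd_id s f g : upd s f (s f) g = s g.
Proof.
  unfold upd. destruct (slot_eqb g f) eqn:Q; [|reflexivity]. apply slot_eqb_spec in Q. now subst.
Qed.

(** [S] selects the slots which carry a field [e]; with two of them all
    differences of their spectral parameters and 0 have to avoid the lattice. *)
Definition admissible_pair (S : slot -> bool) (p q : point) : bool :=
  match p, q with
  | Some f, Some g => S f && S g && negb (slot_eqb f g)
  | Some f, None | None, Some f =>
      S f && existsb (fun g => S g && negb (slot_eqb f g)) [SU; SV; SW]
  | None, None => false
  end%bool.

Definition admissible (S : slot -> bool) (a : atom) : bool :=
  match a with
  | AE f _ _ => S f
  | AR p q _ _ => admissible_pair S p q
  | _ => true
  end.

Definition adm (S : slot -> bool) : dpoly -> Prop := all_atoms (fun a => admissible S a = true).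

Fixpoint admb (S : slot -> bool) (p : dpoly) : bool :=
  match p with
  | Cst _ => true
  | At a => admissible S a
  | Add p q | Mul p q => admb S p && admb S q
  | Opp p => admb S p
  end%bool.

Lemma admb_adm S p : admb S p = true -> adm S p.
Proof.
  unfold adm. induction p; simpl; intros H; auto; apply Bool.andb_true_iff in H; tauto.
Qed.

Lemma adm_Dx S p : adm S p -> adm S (Dx p).
Proof. apply all_atoms_deriv. intros [f i k|k|p' q i k|n k| |]; simpl; auto. Qed.

Lemma adm_Ds S f p : adm S p -> adm S (Ds f p).
Proof.
  apply all_atoms_deriv. intros [g i k|k|p' q i k|n k| |]; simpl; auto.
  - destruct (slot_eqb f g); simpl; auto.
  - intros H. apply all_atoms_add; [destruct (point_eqb p' (Some f))|destruct (point_eqb q (Some f))];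
      simpl; auto.
Qed.

Definition valid_jet (J : nat -> nat -> C -> R -> C) (w : C) (x : R) : Prop :=
  forall i k, DC (fun w' => J i k w' x) w (J (S i) k w x) /\ DR (fun y => J i k w y) x (J i (S k) w x).

Record good (S : slot -> bool) (v : env) (x : R) : Prop := Good {
  good_open : forall f w, S f = true -> dom v f w ->
    exists d : R, (0 < d)%R /\ forall w', (Cmod (w' - w) < d)%R -> dom v f w';
  good_sp : forall f, S f = true -> dom v f (sp v f);
  good_jet : forall f w, S f = true -> dom v f w -> valid_jet (jet v f) w x;
  good_tau : forall k, DR (tjet v k) x (tjet v (Datatypes.S k) x);
  good_Im : (0 < Im (tjet v 0 x))%R;
  good_test : forall n k, DR (xjet v n k) x (xjet v n (Datatypes.S k) x);
  good_off : forall p q, admissible_pair S p q = true ->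
    off_lattice (tjet v 0 x) (pt (sp v) p - pt (sp v) q) }.

Lemma D_x_den S v x p : good S v x -> adm S p ->
  DR (fun y => den (val v y) p) x (den (val v x) (Dx p)).
Proof.
  intros G A. apply D_den. eapply all_atoms_impl; [|exact A].
  intros [f i k|k|p' q i k|n k| |] H; simpl in *.
  - apply (good_jet _ _ _ G f _ H), (good_sp _ _ _ G f H).
  - apply (good_tau _ _ _ G).
  - eapply D_at_val.
    + apply (D_at_comp RtoC (fun t => Rho i k (pt (sp v) p' - pt (sp v) q) t) (tjet v 0) x).
      * apply D_Rho_tau; [apply (good_Im _ _ _ G)|apply (good_off _ _ _ G), H].
      * apply (good_tau _ _ _ G).
    + ring.
  - apply (good_test _ _ _ G).
  - apply D_at_const.
  - apply D_at_const.
Qed.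

Lemma D_upd s f w p : DC (fun w => pt (upd s f w) p) w (if point_eqb p (Some f) then 1 else 0).
Proof.
  destruct p as [g|]; simpl; [|apply D_at_const]. destruct (slot_eqb g f) eqn:Q.
  - apply slot_eqb_spec in Q. subst.
    apply D_at_ext with (f := fun w => w); [intros; now rewrite upd_same|apply D_at_id].
  - apply D_at_ext with (f := fun w => s g); [|apply D_at_const].
    intros y. unfold upd. now rewrite Q.
Qed.

Lemma pt_upd_id s f p : pt (upd s f (s f)) p = pt s p.
Proof. destruct p; simpl; [apply upd_id|reflexivity]. Qed.

Lemma val_upd_id v x f a : val (at_ v f (sp v f)) x a = val v x a.
Proof. destruct a; simpl; rewrite ?upd_id, ?pt_upd_id; reflexivity. Qed.

Lemma den_val_ext val1 val2 p : (forall a, val1 a = val2 a) -> den val1 p = den val2 p.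
Proof.
  intros H. apply den_ext. induction p; simpl; auto.
Qed.

Lemma D_s_den S v x f p : good S v x -> adm S p ->
  DC (fun w => den (val (at_ v f w) x) p) (sp v f) (den (val v x) (Ds f p)).
Proof.
  intros G A.
  eapply D_at_val; [|apply den_val_ext; intros; apply val_upd_id with (f := f)].
  apply (D_den (fun z => z) (fun w => val (at_ v f w) x) (sp v f) (d_s f) p).
  eapply all_atoms_impl; [|exact A].
  intros [g i k|k|p' q i k|n k| |] H; simpl in *; rewrite ?int_C_0; try apply D_at_const.
  - destruct (slot_eqb f g) eqn:Q.
    + apply slot_eqb_spec in Q. subst g. simpl. rewrite upd_same.
      apply D_at_ext with (f := fun w => jet v f i k w x); [intros; now rewrite upd_same|].
      apply (good_jet _ _ _ G f _ H), (good_sp _ _ _ G f H).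
    + simpl. rewrite int_C_0. apply D_at_ext with (f := fun w => jet v g i k (sp v g) x); [|apply D_at_const].
      intros w. rewrite upd_other; [reflexivity|]. intros ->.
      rewrite (proj2 (slot_eqb_spec f f) eq_refl) in Q. discriminate.
  - eapply D_at_val.
    + apply (D_at_comp (fun z => z) (fun z => Rho i k z (tjet v 0 x))
        (fun w => pt (upd (sp v) f w) p' - pt (upd (sp v) f w) q)).
      * rewrite !pt_upd_id. apply D_Rho_z; [apply (good_Im _ _ _ G)|apply (good_off _ _ _ G), H].
      * apply D_at_minus; apply D_upd.
    + rewrite den_add. destruct (point_eqb p' (Some f)), (point_eqb q (Some f)); simpl;
        rewrite ?int_C_0, ?pt_upd_id; ring.
Qed.

(** The mixed derivatives of all atoms are symmetric. *)
Lemma D_x_D_s_comm v x f p : den (val v x) (Dx (Ds f p)) = den (val v x) (Ds f (Dx p)).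
Proof.
  apply den_deriv_comm. intros [g i k|k|p' q i k|n k| |]; simpl; try reflexivity.
  - destruct (slot_eqb f g); reflexivity.
  - rewrite den_add, den_deriv_add.
    destruct (point_eqb p' (Some f)), (point_eqb q (Some f)); simpl;
      rewrite ?den_add, ?den_mul, ?den_opp; simpl; rewrite ?int_C_0; ring.
Qed.

Lemma at_at v f w w' : at_ (at_ v f w) f w' = at_ v f w'.
Proof.
  unfold at_, set_sp. simpl. f_equal. apply functional_extensionality. intros g. unfold upd.
  now destruct (slot_eqb g f).
Qed.

(** The number of points is finite, so one radius serves all pairs. *)
Lemma all_pairs (P : point -> point -> R -> Prop) :
  (forall p q r r', (r' <= r)%R -> P p q r -> P p q r') ->
  (forall p q, exists r : R, (0 < r)%R /\ P p q r) ->
  exists r : R, (0 < r)%R /\ forall p q, P p q r.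
Proof.
  intros M H.
  assert (one : forall Q : point -> R -> Prop, (forall p r r', (r' <= r)%R -> Q p r -> Q p r') ->
    (forall p, exists r : R, (0 < r)%R /\ Q p r) -> exists r : R, (0 < r)%R /\ forall p, Q p r).
  { intros Q MQ HQ.
    destruct (HQ None) as [r0 [P0 Q0]], (HQ (Some SU)) as [r1 [P1 Q1]],
      (HQ (Some SV)) as [r2 [P2 Q2]], (HQ (Some SW)) as [r3 [P3 Q3]].
    exists (Rmin (Rmin r0 r1) (Rmin r2 r3)). split; [repeat apply Rmin_case; assumption|].
    pose proof (Rmin_l (Rmin r0 r1) (Rmin r2 r3)). pose proof (Rmin_r (Rmin r0 r1) (Rmin r2 r3)).
    pose proof (Rmin_l r0 r1). pose proof (Rmin_r r0 r1).
    pose proof (Rmin_l r2 r3). pose proof (Rmin_r r2 r3).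
    intros [[]|]; [apply (MQ _ r1)|apply (MQ _ r2)|apply (MQ _ r3)|apply (MQ _ r0)]; auto; lra. }
  apply (one (fun p r => forall q, P p q r)).
  - intros p r r' L K q. eapply M; eauto.
  - intros p. apply one; [|apply H]. intros q r r'. apply M.
Qed.

(** The modulus moves together with the parameter, both when the point moves
    along the loop and when the fields are varied. *)
Lemma good_nbhd S v x f : good S v x -> exists d : R, (0 < d)%R /\
  forall w t, (Cmod (w - sp v f) < d)%R -> (Cmod (t - tjet v 0 x) < d)%R ->
    (0 < Im t)%R /\ (S f = true -> dom v f w) /\
    forall p q, admissible_pair S p q = true ->
      off_lattice t (pt (upd (sp v) f w) p - pt (upd (sp v) f w) q).
Proof.
  intros G.
  assert (H1 : exists d : R, (0 < d)%R /\ forall t, (Cmod (t - tjet v 0 x) < d)%R -> (0 < Im t)%R).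
  { exists (Im (tjet v 0 x)). split; [apply (good_Im _ _ _ G)|]. intros t H.
    pose proof (Rle_trans _ _ _ (Rmax_r _ _) (Rmax_Cmod (t - tjet v 0 x))) as B.
    change (snd (t - tjet v 0 x)) with (Im t - Im (tjet v 0 x))%R in B.
    pose proof (good_Im _ _ _ G). unfold Rabs in B. destruct (Rcase_abs _) in B; lra. }
  assert (H2 : exists d : R, (0 < d)%R /\ forall w, (Cmod (w - sp v f) < d)%R -> S f = true -> dom v f w).
  { destruct (S f) eqn:Q.
    - destruct (good_open _ _ _ G f (sp v f) Q (good_sp _ _ _ G f Q)) as [d [Hd H]].
      exists d. split; [exact Hd|]. intros; auto.
    - exists 1%R. split; [lra|discriminate]. }
  assert (H3 : exists d : R, (0 < d)%R /\ forall p q, admissible_pair S p q = true ->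
    forall w t, (Cmod (w - sp v f) < d)%R -> (Cmod (t - tjet v 0 x) < d)%R ->
      off_lattice t (pt (upd (sp v) f w) p - pt (upd (sp v) f w) q)).
  { apply all_pairs; [intros p q r r' L H A w t L1 L2; apply H; auto; lra|].
    intros p q. destruct (admissible_pair S p q) eqn:Q; [|exists 1%R; split; [lra|discriminate]].
    destruct (off_lattice_open _ _ (good_Im _ _ _ G) (good_off _ _ _ G p q Q)) as [d [Hd H]].
    exists (Rmin d (d / 2)). split; [apply Rmin_case; lra|]. intros _ w t L1 L2.
    pose proof (Rmin_l d (d / 2)). pose proof (Rmin_r d (d / 2)).
    refine (proj1 (H _ _ _ _)); [|lra].
    assert (B : forall r, (Cmod (pt (upd (sp v) f w) r - pt (sp v) r) < d / 2)%R).
    { intros [g|]; simpl; unfold upd; [destruct (slot_eqb g f) eqn:Qg|].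
      - apply slot_eqb_spec in Qg. subst. lra.
      - replace (sp v g - sp v g) with (RtoC 0) by ring. rewrite Cmod_0. lra.
      - replace (0 - 0) with (RtoC 0) by ring. rewrite Cmod_0. lra. }
    pose proof (B p) as Bp. pose proof (B q) as Bq.
    replace (_ - _) with ((pt (upd (sp v) f w) p - pt (sp v) p) + - (pt (upd (sp v) f w) q - pt (sp v) q)) by ring.
    eapply Rle_lt_trans; [apply Cmod_triangle|]. rewrite Cmod_opp. lra. }
  destruct H1 as [d1 [P1 Q1]], H2 as [d2 [P2 Q2]], H3 as [d3 [P3 Q3]].
  exists (Rmin d1 (Rmin d2 d3)). split; [repeat apply Rmin_case; assumption|].
  pose proof (Rmin_l d1 (Rmin d2 d3)). pose proof (Rmin_r d1 (Rmin d2 d3)).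
  pose proof (Rmin_l d2 d3). pose proof (Rmin_r d2 d3).
  intros w t L1 L2. split; [apply Q1; lra|split; [apply Q2; lra|]]. intros p q A. apply Q3; auto; lra.
Qed.

Lemma good_at S v x f : good S v x -> exists d : R, (0 < d)%R /\
  forall w, (Cmod (w - sp v f) < d)%R -> good S (at_ v f w) x.
Proof.
  intros G. destruct (good_nbhd S v x f G) as [d [Hd H]]. exists d. split; [exact Hd|]. intros w L.
  destruct (H w (tjet v 0 x) L) as [_ [H2 H3]].
  { replace (_ - _) with (RtoC 0) by ring. rewrite Cmod_0. lra. }
  destruct G as [G1 G2 G3 G4 G5 G6 G7]. constructor; simpl; auto.
  intros g Sg. unfold upd. destruct (slot_eqb g f) eqn:Q; [|auto].
  apply slot_eqb_spec in Q. subst. auto.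
Qed.

(** For polynomials that agree only as functions of admissible parameters, such
    as the instances of the addition theorem and 0, formal derivatives cannot be
    compared formally; they are compared as derivatives of equal functions. *)
Lemma den_D_s_congr S v x f p p' : good S v x -> adm S p -> adm S p' ->
  (forall w, good S (at_ v f w) x -> den (val (at_ v f w) x) p = den (val (at_ v f w) x) p') ->
  den (val v x) (Ds f p) = den (val v x) (Ds f p').
Proof.
  intros G A A' H. destruct (good_at S v x f G) as [d [Hd Hg]].
  eapply DC_unique2; [apply (D_s_den S v x f p G A)|].
  eapply D_at_ext_loc with (d := d); [exact Hd| |apply (D_s_den S v x f p' G A')].
  intros w L. symmetry. apply H, Hg, L.
Qed.

Lemma adm_D_s_iter S f i p : adm S p -> adm S (Nat.iter i (Ds f) p).
Proof. induction i; simpl; auto. intros. now apply adm_Ds, IHi. Qed.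

Lemma adm_D_x_iter S k p : adm S p -> adm S (Nat.iter k Dx p).
Proof. induction k; simpl; auto. intros. now apply adm_Dx, IHk. Qed.

Lemma D_x_D_s_iter S v x f i p : good S v x -> adm S p ->
  den (val v x) (Dx (Nat.iter i (Ds f) p)) = den (val v x) (Nat.iter i (Ds f) (Dx p)).
Proof.
  intros G A. revert v G. induction i; intros v G; [reflexivity|]. simpl.
  rewrite D_x_D_s_comm. apply (den_D_s_congr S); auto.
  - now apply adm_Dx, adm_D_s_iter.
  - now apply adm_D_s_iter, adm_Dx.
Qed.

(** * The obstruction vanishes *)

(** Distributes [den] over the visible operations only: named differential
    polynomials stay folded. *)
Ltac den_visible :=
  repeat match goal with
  | |- context [den ?v (Add ?p ?q)] => change (den v (Add p q)) with (den v p + den v q)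
  | |- context [den ?v (Mul ?p ?q)] => change (den v (Mul p q)) with (den v p * den v q)
  | |- context [den ?v (Opp ?p)] => change (den v (Opp p)) with (- den v p)
  end.

Lemma admissible_pair_sym S p q : admissible_pair S p q = admissible_pair S q p.
Proof. destruct p as [[]|], q as [[]|]; simpl; auto using Bool.andb_comm; destruct (S SU), (S SV), (S SW); reflexivity. Qed.

Lemma den_rho S v x p q i k : good S v x -> admissible_pair S p q = true ->
  den (val v x) (rho p q i k) = Rho i k (pt (sp v) p - pt (sp v) q) (tjet v 0 x).
Proof.
  intros G A. unfold rho. destruct (Nat.leb (rank p) (rank q)); [reflexivity|].
  replace (pt (sp v) p - pt (sp v) q) with (- (pt (sp v) q - pt (sp v) p)) by ring.
  rewrite Rho_opp; [|apply (good_Im _ _ _ G)|apply (good_off _ _ _ G); now rewrite admissible_pair_sym].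
  replace (Cpow (- (1)) (Datatypes.S i)) with (if Nat.even i then - (1) else RtoC 1).
  - destruct (Nat.even i); simpl; ring.
  - induction i; [simpl; ring|]. rewrite Nat.even_succ, <- Nat.negb_even.
    change (Cpow (- (1)) (Datatypes.S (Datatypes.S i))) with ((- (1)) * Cpow (- (1)) (Datatypes.S i)).
    rewrite <- IHi. destruct (Nat.even i); simpl; ring.
Qed.

Lemma addition_zero S v x p q r : good S v x -> admissible_pair S p q = true ->
  admissible_pair S q r = true -> admissible_pair S p r = true ->
  den (val v x) (addition_ p q r) = 0.
Proof.
  intros G A1 A2 A3. unfold addition_. den_visible. change (den (val v x) (At AP)) with P2i.
  rewrite !(den_rho S v x _ _ _ _ G) by assumption.
  pose proof (good_off _ _ _ G _ _ A1) as O1. pose proof (good_off _ _ _ G _ _ A2) as O2.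
  pose proof (good_off _ _ _ G _ _ A3) as O3.
  replace (pt (sp v) p - pt (sp v) r) with ((pt (sp v) p - pt (sp v) q) + (pt (sp v) q - pt (sp v) r)) in * by ring.
  pose proof (Rho_addition _ _ _ (good_Im _ _ _ G) O1 O2 O3) as H.
  set (a := pt (sp v) p - pt (sp v) q) in *. set (b := pt (sp v) q - pt (sp v) r) in *.
  transitivity (P2i * (Rho 0 1 a (tjet v 0 x) - Rho 0 1 b (tjet v 0 x))
    - (Rho 1 0 a (tjet v 0 x) * (Rho 0 0 (a + b) (tjet v 0 x) - Rho 0 0 b (tjet v 0 x))
       + Rho 1 0 b (tjet v 0 x) * (Rho 0 0 a (tjet v 0 x) - Rho 0 0 (a + b) (tjet v 0 x)))); [ring|].
  rewrite H. ring.
Qed.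

Definition every_slot (f : slot) := true.

Lemma distinct_admissible p q : p <> q -> admissible_pair every_slot p q = true.
Proof. destruct p as [[]|], q as [[]|]; simpl; congruence. Qed.

Lemma all_addition v x p q r : good every_slot v x -> p <> q -> q <> r -> p <> r ->
  den (val v x) (addition_ p q r) = 0.
Proof. intros. apply (addition_zero every_slot); auto using distinct_admissible. Qed.

Lemma adm_rho S p q i k : admissible_pair S p q = true -> adm S (rho p q i k).
Proof.
  intros H. unfold rho. destruct (Nat.leb _ _); [exact H|].
  rewrite admissible_pair_sym in H. destruct (Nat.even i); exact H.
Qed.

Lemma all_addition_D v x f p q r : good every_slot v x -> p <> q -> q <> r -> p <> r ->
  den (val v x) (Ds f (addition_ p q r)) = 0.
Proof.
  intros G H1 H2 H3. rewrite (den_D_s_congr every_slot v x f _ (Cst 0) G); [reflexivity| |exact I|].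
  - repeat split; auto; apply adm_rho, distinct_admissible; auto.
  - intros w Gw. now rewrite all_addition.
Qed.

Definition cyclic (f g h : slot) : Prop := In (f, g, h) [(SU, SV, SW); (SV, SW, SU); (SW, SU, SV)].

(* The rewriting below must match these polynomials by name. *)
Local Opaque addition_ rho deriv.

(** [split_certificate] is a combination of instances of the addition theorem
    and of their derivatives. *)
Lemma cyclic_split v x f g h : good every_slot v x -> cyclic f g h ->
  den (val v x) (split_ (Some f) (Some h) None (Some g)) = 0.
Proof.
  intros G Cy.
  assert (E1 : P2i * den (val v x) (split_ (Some f) (Some h) None (Some g)) = 0).
  { assert (B := proj1 (forallb_forall _ _) split_certified _ Cy). cbv beta iota in B.
    change (P2i * _) with (den (val v x) (At AP * split_ (Some f) (Some h) None (Some g))%dp).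
    rewrite (identical_correct _ _ B). unfold split_certificate.
    assert (f <> g /\ g <> h /\ f <> h) as (N1 & N2 & N3).
    { destruct Cy as [Q|[Q|[Q|[]]]]; inversion Q; subst; repeat split; discriminate. }
    den_visible.
    rewrite !all_addition, !all_addition_D by (auto; congruence). ring. }
  destruct (Ceq_dec (den (val v x) (split_ (Some f) (Some h) None (Some g))) 0) as [Z|Z]; [exact Z|].
  exfalso. apply (Cmult_neq_0 P2i _ P2i_neq_0 Z E1).
Qed.

Lemma obstruction_zero v x f g h : good every_slot v x -> cyclic f g h ->
  den (val v x) (obstruction f g h) = 0.
Proof.
  intros G Cy.
    assert (f <> g /\ g <> h /\ f <> h) as (N1 & N2 & N3).
    { destruct Cy as [Q|[Q|[Q|[]]]]; inversion Q; subst; repeat split; discriminate. }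
  unfold obstruction. den_visible.
  rewrite !all_addition, cyclic_split by (auto; congruence). ring.
Qed.

Local Opaque obstruction.

(** A function that vanishes identically has vanishing derivatives; this is why
    the addition theorem is needed at all nearby parameters. *)
Lemma jacobian_zero v z f g h : (forall x, good every_slot v x) -> cyclic f g h ->
  den (val v z) (jacobian f g h) = 0.
Proof.
  intros G Cy.
  assert (A : adm every_slot (obstruction f g h)).
  { apply admb_adm. destruct Cy as [Q|[Q|[Q|[]]]]; inversion Q; subst; vm_compute; reflexivity. }
  assert (Hx : den (val v z) (Dx (obstruction f g h)) = 0).
  { rewrite <- (DR_unique _ _ _ (D_x_den every_slot v z _ (G z) A)). apply DR_unique.
    apply D_at_ext with (f := fun _ => RtoC 0); [intros y; now rewrite obstruction_zero|apply D_at_const]. }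
  assert (Hs : den (val v z) (Ds h (obstruction f g h)) = 0).
  { rewrite (den_D_s_congr every_slot v z h _ (Cst 0) (G z)); [reflexivity|exact A|exact I|].
    intros w Gw. now rewrite obstruction_zero. }
  unfold jacobian. den_visible. rewrite Hx, Hs. ring.
Qed.

Local Opaque jacobian.

Lemma jacobians_zero v z : (forall x, good every_slot v x) -> den (val v z) jacobians = 0.
Proof.
  intros G. unfold jacobians. den_visible.
  rewrite !jacobian_zero by (unfold cyclic; simpl; auto). ring.
Qed.
Local Transparent addition_ rho deriv obstruction jacobian.

(** * The bracket of two generators *)

Definition realize (v : env) (A : gen) : generator :=
  match A with GT _ => Tau | GE f => E (sp v f) end.

Definition compatible (S : slot -> bool) (A B : gen) : bool :=
  match A, B with
  | GT _, GT _ => true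
  | GT _, GE f | GE f, GT _ => S f
  | GE f, GE g => S f && S g && negb (slot_eqb f g)
  end%bool.

(** Near the point [z] of the loop the jets in [v] are those of the fields [F].
    A neighbourhood is needed because the bracket contains derivatives, and the
    restriction to it makes the notion stable under small variations. *)
Record represents (S : slot -> bool) (v : env) (F : fields) (z d : R) : Prop := Represents {
  rep_good : forall x, (Rabs (x - z) < d)%R -> good S v x;
  rep_tau : forall x, (Rabs (x - z) < d)%R -> tau_ F x = tjet v 0 x;
  rep_e : forall x f w, (Rabs (x - z) < d)%R -> S f = true -> dom v f w ->
    e_ F w x = jet v f 0 0 w x }.

Section Brackets.

Variables (S : slot -> bool) (v : env) (F : fields) (z d : R).
Hypothesis R0 : represents S v F z d.

Let near (x : R) : Prop := (Rabs (x - z) < d)%R.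

Lemma near_nbhd x : near x -> exists r : R, (0 < r)%R /\
  forall y, (Cmod (RtoC y - RtoC x) < r)%R -> near y.
Proof.
  unfold near. intros H. exists (d - Rabs (x - z))%R. split; [lra|]. intros y L.
  rewrite Cmod_RtoC_minus in L. pose proof (Rabs_triang (y - x) (x - z)) as T.
  replace (y - x + (x - z))%R with (y - z)%R in T by ring. lra.
Qed.

Lemma rep_e_u f w x : near x -> S f = true -> dom v f w -> e_u F w x = jet v f 1 0 w x.
Proof.
  intros N Sf Hw. apply DC_unique.
  pose proof (rep_good _ _ _ _ _ R0 x N) as G.
  destruct (good_open _ _ _ G f w Sf Hw) as [r [Hr O]].
  apply D_at_ext_loc with (f := fun w' => jet v f 0 0 w' x) (d := r); [exact Hr| |apply (good_jet _ _ _ G f w Sf Hw)].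
  intros w' L. symmetry. apply (rep_e _ _ _ _ _ R0); auto.
Qed.

Lemma rep_e_x f w x : near x -> S f = true -> dom v f w -> e_x F w x = jet v f 0 1 w x.
Proof.
  intros N Sf Hw. apply DR_unique.
  pose proof (rep_good _ _ _ _ _ R0 x N) as G.
  destruct (near_nbhd x N) as [r [Hr O]].
  apply D_at_ext_loc with (f := fun y => jet v f 0 0 w y) (d := r); [exact Hr| |apply (good_jet _ _ _ G f w Sf Hw)].
  intros y L. symmetry. apply (rep_e _ _ _ _ _ R0); auto. now apply O.
Qed.

Lemma rep_e_ux f w x : near x -> S f = true -> dom v f w -> e_ux F w x = jet v f 1 1 w x.
Proof.
  intros N Sf Hw. apply DC_unique.
  pose proof (rep_good _ _ _ _ _ R0 x N) as G.
  destruct (good_open _ _ _ G f w Sf Hw) as [r [Hr O]].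
  apply D_at_ext_loc with (f := fun w' => jet v f 0 1 w' x) (d := r); [exact Hr| |apply (good_jet _ _ _ G f w Sf Hw)].
  intros w' L. symmetry. apply rep_e_x; auto.
Qed.

Lemma rep_tau_x x : near x -> R_derive (tau_ F) x = tjet v 1 x.
Proof.
  intros N. apply DR_unique. destruct (near_nbhd x N) as [r [Hr O]].
  apply D_at_ext_loc with (f := tjet v 0) (d := r); [exact Hr| |apply (good_tau _ _ _ (rep_good _ _ _ _ _ R0 x N))].
  intros y L. symmetry. apply (rep_tau _ _ _ _ _ R0). now apply O.
Qed.

Lemma pair_ff f g : S f = true -> S g = true -> f <> g -> admissible_pair S (Some f) (Some g) = true.
Proof.
  intros Sf Sg N. simpl. rewrite Sf, Sg. destruct (slot_eqb f g) eqn:Q; [|reflexivity].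
  now apply slot_eqb_spec in Q.
Qed.

Lemma pair_f0 f g : S f = true -> S g = true -> f <> g -> admissible_pair S (Some f) None = true.
Proof.
  intros Sf Sg N. unfold admissible_pair. rewrite Sf. apply existsb_exists. exists g. split.
  - destruct g; simpl; auto.
  - rewrite Sg. destruct (slot_eqb f g) eqn:Q; [apply slot_eqb_spec in Q; congruence|reflexivity].
Qed.

Lemma den_q f g k x : near x -> S f = true -> S g = true -> f <> g ->
  den (val v x) (q_ f g k) = Rho 0 k (sp v g - sp v f) (tjet v 0 x) + Rho 0 k (sp v f) (tjet v 0 x).
Proof.
  intros N Sf Sg D. pose proof (rep_good _ _ _ _ _ R0 x N) as G. unfold q_. den_visible.
  rewrite !(den_rho S v x _ _ _ _ G) by eauto using pair_ff, pair_f0.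
  simpl pt. now replace (sp v f - 0) with (sp v f) by ring.
Qed.

Lemma q_nbhd f g x : near x -> S f = true -> S g = true -> f <> g -> exists r : R, (0 < r)%R /\
  forall w t, (Cmod (w - sp v g) < r)%R -> (Cmod (t - tjet v 0 x) < r)%R ->
    q (sp v f) w t = Rho 0 0 (w - sp v f) t + Rho 0 0 (sp v f) t.
Proof.
  intros N Sf Sg D. pose proof (rep_good _ _ _ _ _ R0 x N) as G.
  destruct (good_nbhd S v x g G) as [r [Hr O]]. exists r. split; [exact Hr|]. intros w t L1 L2.
  destruct (O w t L1 L2) as [It [_ O']].
  pose proof (O' _ _ (pair_ff g f Sg Sf (not_eq_sym D))) as A.
  pose proof (O' _ _ (pair_f0 f g Sf Sg D)) as B.
  simpl in A, B. rewrite upd_same, upd_other in A by congruence.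
  rewrite upd_other in B by congruence. replace (sp v f - 0) with (sp v f) in B by ring.
  now apply q_Rho.
Qed.

Lemma Cmod_self (c : C) (r : R) : (0 < r)%R -> (Cmod (c - c) < r)%R.
Proof. intros H. replace (c - c) with (RtoC 0) by ring. now rewrite Cmod_0. Qed.

Lemma den_q0 f g x : near x -> S f = true -> S g = true -> f <> g ->
  q (sp v f) (sp v g) (tjet v 0 x) = den (val v x) (q_ f g 0).
Proof.
  intros N Sf Sg D. destruct (q_nbhd f g x N Sf Sg D) as [r [Hr O]].
  rewrite den_q, O; auto using Cmod_self.
Qed.

Lemma den_q_tau f g x : near x -> S f = true -> S g = true -> f <> g ->
  q_tau (sp v f) (sp v g) (tjet v 0 x) = den (val v x) (q_ f g 1).
Proof.
  intros N Sf Sg D. destruct (q_nbhd f g x N Sf Sg D) as [r [Hr O]].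
  pose proof (rep_good _ _ _ _ _ R0 x N) as G.
  pose proof (good_off _ _ _ G _ _ (pair_ff g f Sg Sf (not_eq_sym D))) as A.
  pose proof (good_off _ _ _ G _ _ (pair_f0 f g Sf Sg D)) as B. simpl in A, B.
  replace (sp v f - 0) with (sp v f) in B by ring.
  rewrite den_q by auto. apply DC_unique.
  apply D_at_ext_loc with (f := fun t => Rho 0 0 (sp v g - sp v f) t + Rho 0 0 (sp v f) t) (d := r); [exact Hr| |].
  - intros t L. symmetry. apply O; auto using Cmod_self.
  - apply D_at_plus; apply D_Rho_tau; auto using (good_Im _ _ _ G).
Qed.

Lemma den_q_2 f g x : near x -> S f = true -> S g = true -> f <> g ->
  q_2 (sp v f) (sp v g) (tjet v 0 x) = den (val v x) (rho (Some g) (Some f) 1 0).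
Proof.
  intros N Sf Sg D. destruct (q_nbhd f g x N Sf Sg D) as [r [Hr O]].
  pose proof (rep_good _ _ _ _ _ R0 x N) as G.
  pose proof (good_off _ _ _ G _ _ (pair_ff g f Sg Sf (not_eq_sym D))) as A. simpl in A.
  rewrite (den_rho S v x _ _ _ _ G) by auto using pair_ff. simpl pt. apply DC_unique.
  apply D_at_ext_loc with (f := fun w => Rho 0 0 (w - sp v f) (tjet v 0 x) + Rho 0 0 (sp v f) (tjet v 0 x)) (d := r); [exact Hr| |].
  - intros w L. symmetry. apply O; auto using Cmod_self.
  - eapply D_at_val; [apply D_at_plus; [|apply D_at_const]|].
    + apply (D_at_comp (fun w => w) (fun y => Rho 0 0 y (tjet v 0 x)) (fun w => w - sp v f)).
      * apply D_Rho_z; [apply (good_Im _ _ _ G)|exact A].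
      * apply D_at_minus; [apply D_at_id|apply D_at_const].
    + ring.
Qed.

(** The derivative inside [smear] exists, so the total operator [R_derive] has the
    value of the formal derivative. *)
Lemma smear_den (K : kernel) (p0 p1 : dpoly) (n : slot) :
  near z -> adm S (p1 * at_x n 0)%dp ->
  k0 K z z = den (val v z) p0 ->
  (forall x, near x -> k1 K x z = den (val v x) p1) ->
  smear K (xjet v n 0) z = den (val v z) (p0 * at_x n 0 - Dx (p1 * at_x n 0))%dp.
Proof.
  intros N A H0 H1. unfold smear. rewrite H0.
  rewrite (DR_unique _ _ (den (val v z) (Dx (p1 * at_x n 0)%dp))); [reflexivity|].
  destruct (near_nbhd z N) as [r [Hr O]].
  apply D_at_ext_loc with (f := fun x => den (val v x) (p1 * at_x n 0)%dp) (d := r); [exact Hr| |].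
  - intros x L. simpl. rewrite H1; auto.
  - apply D_x_den with (S := S); [apply (rep_good _ _ _ _ _ R0), N|exact A].
Qed.

(** All derivatives in the kernels exist at a point that is off the poles, and
    [q] is expressed by [Rho] in a neighbourhood, hence so are its derivatives. *)
Lemma gen_bracket_den A B : (0 < d)%R -> compatible S A B = true ->
  gen_bracket (elliptic_bracket (lam v)) (realize v A) (realize v B) (xjet v (slot_of A) 0) F z
  = den (val v z) (bracket_ A B).
Proof.
  intros Hd Cp. assert (N : near z) by (unfold near; rewrite Rminus_diag, Rabs_R0; lra).
  pose proof (rep_good _ _ _ _ _ R0 z N) as G.
  unfold gen_bracket. destruct A as [n|f], B as [m|g]; simpl in Cp; simpl realize; simpl slot_of.
  - simpl. rewrite int_C_0. unfold smear. simpl.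
    rewrite (DR_unique _ _ 0); [ring|].
    apply D_at_ext with (f := fun _ => RtoC 0); [intros; ring|apply D_at_const].
  - unfold elliptic_bracket, bracket_, smear, tau_e_kernel. simpl.
    rewrite (rep_e _ _ _ _ _ R0) with (f := g) by auto using (good_sp _ _ _ G).
    rewrite (DR_unique _ _ (P2i * jet v g 0 0 (sp v g) z * xjet v n 1 z)).
    + ring.
    + apply D_at_scal, (good_test _ _ _ G).
  - unfold elliptic_bracket, skew, tau_e_kernel, bracket_.
    rewrite (smear_den _ (Cst 0) (At AP * at_e f 0 0)%dp f N).
    + den_visible. change (den (val v z) (Cst 0)) with (RtoC 0). ring.
    + repeat split; exact Cp.
    + change (- 0 = RtoC 0). ring.
    + intros x Hx. simpl. now rewrite (rep_e _ _ _ _ _ R0) with (f := f) by auto using (good_sp _ _ _ G).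
  - apply Bool.andb_true_iff in Cp. destruct Cp as [Cp D]. apply Bool.andb_true_iff in Cp.
    destruct Cp as [Sf Sg]. assert (f <> g).
    { intros ->. rewrite (proj2 (slot_eqb_spec g g) eq_refl) in D. discriminate. }
    unfold elliptic_bracket, bracket_. apply smear_den; [exact N| | |].
    + repeat split; try apply adm_rho; eauto using pair_ff, pair_f0.
    + unfold e_e_kernel, k0_. cbv beta iota zeta delta [k0]. den_visible.
      rewrite !(rep_tau _ _ _ _ _ R0), rep_tau_x by exact N.
      rewrite den_q_tau, den_q_2, !den_q0 by auto.
      rewrite (rep_e_u f (sp v f)), (rep_e_ux g (sp v g)), (rep_e_x f (sp v f)), (rep_e_x g (sp v g)), (rep_e _ _ _ _ _ R0 z f (sp v f)), (rep_e _ _ _ _ _ R0 z g (sp v g))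
        by (first [exact N | assumption | apply (good_sp _ _ _ G); assumption]).
      simpl (den (val v z) (at_e _ _ _)). simpl (den (val v z) (at_t _)). simpl (den (val v z) (At AL)). ring.
    + intros x Hx. pose proof (rep_good _ _ _ _ _ R0 x Hx) as Gx. unfold e_e_kernel, k1_. cbv beta iota zeta delta [k1]. den_visible.
      rewrite !(rep_tau _ _ _ _ _ R0) by exact Hx.
      rewrite !den_q0 by auto.
      rewrite (rep_e_u f (sp v f)), (rep_e_u g (sp v g)), (rep_e _ _ _ _ _ R0 x f (sp v f)), (rep_e _ _ _ _ _ R0 x g (sp v g))
        by (first [exact Hx | assumption | apply (good_sp _ _ _ Gx); assumption]).
      reflexivity.
Qed.

End Brackets.

(** * The variation along a Hamiltonian vector field *)

Lemma adm_sub S p q : adm S p -> adm S q -> adm S (p - q)%dp.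
Proof. split; assumption. Qed.

Lemma adm_bracket S A B : compatible S A B = true -> adm S (bracket_ A B).
Proof.
  intros Cp. destruct A as [n|f], B as [m|g]; simpl in Cp.
  - exact I.
  - repeat split; exact Cp.
  - apply (adm_Dx S (At AP * at_e f 0 0 * at_x f 0)%dp). repeat split; exact Cp.
  - apply Bool.andb_true_iff in Cp. destruct Cp as [Cp D]. apply Bool.andb_true_iff in Cp.
    destruct Cp as [Sf Sg]. assert (f <> g).
    { intros ->. rewrite (proj2 (slot_eqb_spec g g) eq_refl) in D. discriminate. }
    assert (K0 : adm S (k0_ f g * at_x f 0)%dp)
      by (repeat split; try apply adm_rho; eauto using pair_ff, pair_f0).
    assert (K1 : adm S (k1_ f g * at_x f 0)%dp)
      by (repeat split; try apply adm_rho; eauto using pair_ff, pair_f0).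
    exact (adm_sub S _ _ K0 (adm_Dx S _ K1)).
Qed.

Lemma compatible_T S A f B : compatible S A B = true -> compatible S A (GT f) = true.
Proof.
  destruct A, B; simpl; auto. intros H. apply Bool.andb_true_iff in H. destruct H as [H _].
  now apply Bool.andb_true_iff in H.
Qed.

Definition active (B C' : gen) (f : slot) : bool :=
  (match B with GE g => slot_eqb f g | GT _ => false end
   || match C' with GE g => slot_eqb f g | GT _ => false end)%bool.

(** The fields moved by [s] along the Hamiltonian vector field of [A].  Its
    component at a spectral parameter [w] is the bracket of [A] with the
    generator at [w], so the jet in [w] comes from the values of [at_ v f w]. *)
Definition shifted (v : env) (A : gen) (r : R) (s : C) : env :=
  Env (sp v) (fun f w => (Cmod (w - sp v f) < r)%R)
    (fun f i k w x => jet v f i k w x + s * den (val (at_ v f w) x) (vary A (AE f i k)))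
    (fun k x => tjet v k x + s * den (val v x) (vary A (AT k)))
    (xjet v) (lam v).

Lemma D_s_den_at S v x f w p : good S (at_ v f w) x -> adm S p ->
  DC (fun w' => den (val (at_ v f w') x) p) w (den (val (at_ v f w) x) (Ds f p)).
Proof.
  intros G A. pose proof (D_s_den S (at_ v f w) x f p G A) as D.
  replace (sp (at_ v f w) f) with w in D by (symmetry; apply upd_same).
  eapply D_at_ext; [|exact D]. intros w'. cbv beta. now rewrite at_at.
Qed.

Section Variation.

Variables (S : slot -> bool) (v : env) (F : fields) (A : gen).
Hypothesis G : forall x, good S v x.
Hypothesis F_tau : forall x, tau_ F x = tjet v 0 x.
Hypothesis F_e : forall x f w, S f = true -> dom v f w -> e_ F w x = jet v f 0 0 w x.

Let X := ham_field (elliptic_bracket (lam v)) (realize v A) (xjet v (slot_of A) 0) F.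

Lemma D_tau_cont z (eps : R) : (0 < eps)%R -> exists d : R, (0 < d)%R /\
  forall x, (Rabs (x - z) < d)%R -> (Cmod (tjet v 0 x - tjet v 0 z) < eps)%R.
Proof.
  intros He. destruct (D_at_cont _ _ _ _ (good_tau _ _ _ (G z) 0) eps He) as [d [Hd H]].
  exists d. split; [exact Hd|]. intros x L. apply H. now rewrite Cmod_RtoC_minus.
Qed.

Lemma good_at_near z : exists d : R, (0 < d)%R /\ forall f w x,
  (Cmod (w - sp v f) < d)%R -> (Rabs (x - z) < d)%R -> good S (at_ v f w) x.
Proof.
  assert (K : forall f, exists d : R, (0 < d)%R /\ forall w x,
    (Cmod (w - sp v f) < d)%R -> (Rabs (x - z) < d)%R -> good S (at_ v f w) x).
  { intros f. destruct (good_nbhd S v z f (G z)) as [d [Hd H]].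
    destruct (D_tau_cont z d Hd) as [d' [Hd' H']].
    exists (Rmin d d'). split; [now apply Rmin_case|]. intros w x L1 L2.
    pose proof (Rmin_l d d'). pose proof (Rmin_r d d').
    destruct (H w (tjet v 0 x)) as [J1 [J2 J3]]; [lra|apply H'; lra|].
    destruct (G x) as [G1 G2 G3 G4 G5 G6 G7]. constructor; simpl; auto.
    intros g Sg. unfold upd. destruct (slot_eqb g f) eqn:Q; [|auto].
    apply slot_eqb_spec in Q. subst. auto. }
  destruct (K SU) as [d1 [P1 K1]], (K SV) as [d2 [P2 K2]], (K SW) as [d3 [P3 K3]].
  exists (Rmin d1 (Rmin d2 d3)). split; [repeat apply Rmin_case; assumption|].
  pose proof (Rmin_l d1 (Rmin d2 d3)). pose proof (Rmin_r d1 (Rmin d2 d3)).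
  pose proof (Rmin_l d2 d3). pose proof (Rmin_r d2 d3).
  intros [] w x L1 L2; [apply K1|apply K2|apply K3]; lra.
Qed.

Lemma X_tau y f : compatible S A (GT f) = true -> tau_ X y = den (val v y) (bracket_ A (GT SU)).
Proof.
  intros Cp. apply (gen_bracket_den S v F y 1) with (B := GT SU); [|lra|exact Cp].
  constructor; auto.
Qed.

Lemma X_e z r f w y : compatible S A (GE f) = true ->
  (forall x, (Rabs (x - z) < r)%R -> good S (at_ v f w) x) -> (Rabs (y - z) < r)%R ->
  e_ X w y = den (val (at_ v f w) y) (bracket_ A (GE f)).
Proof.
  intros Cp H L.
  rewrite <- (gen_bracket_den S (at_ v f w) F y (r - Rabs (y - z))) with (A := A) (B := GE f);
    [|constructor; simpl; auto|lra|exact Cp].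
  - simpl realize. unfold at_. simpl. rewrite upd_same. unfold X. simpl.
    destruct A as [n|g]; simpl; [reflexivity|].
    rewrite upd_other; [reflexivity|]. intros ->. simpl in Cp.
    rewrite (proj2 (slot_eqb_spec f f) eq_refl), Bool.andb_false_r in Cp. discriminate.
  - intros x Lx. apply H. pose proof (Rabs_triang (x - y) (y - z)) as T.
    replace (x - y + (y - z))%R with (x - z)%R in T by ring. lra.
Qed.

(** For small [s] the moved fields stay in the upper half plane and off the
    poles.  Poles matter only for the generators [B] and [C'] of the inner
    bracket, hence the smaller set [S'] of slots. *)
Lemma shifted_good S' z : (forall f, S' f = true -> S f = true /\ compatible S A (GE f) = true) ->
  compatible S A (GT SU) = true ->
  exists r : R, (0 < r)%R /\ forall s, (Cmod s < r)%R ->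
    represents S' (shifted v A r s) (Defs.shift F X s) z r.
Proof.
  intros HS HT. set (xt := fun x => den (val v x) (bracket_ A (GT SU))).
  destruct (good_at_near z) as [r0 [Hr0 H0]].
  destruct (good_nbhd S v z SU (G z)) as [d [Hd H]].
  destruct (D_tau_cont z (d / 2)) as [r1 [Hr1 H1]]; [lra|].
  destruct (D_at_cont _ xt z _ (D_x_den S v z _ (G z) (adm_bracket S _ _ HT)) 1) as [r2 [Hr2 H2]]; [lra|].
  set (M := (Cmod (xt z) + 1)%R). assert (HM : (0 < M)%R) by (pose proof (Cmod_ge_0 (xt z)); unfold M; lra).
  exists (Rmin (Rmin r0 r1) (Rmin r2 (d / 2 / M))). set (r := Rmin _ _).
  assert (r <= r0 /\ r <= r1 /\ r <= r2 /\ r <= d / 2 / M)%R as (L0 & L1 & L2 & L3).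
  { pose proof (Rmin_l (Rmin r0 r1) (Rmin r2 (d / 2 / M))). pose proof (Rmin_r (Rmin r0 r1) (Rmin r2 (d / 2 / M))).
    pose proof (Rmin_l r0 r1). pose proof (Rmin_r r0 r1).
    pose proof (Rmin_l r2 (d / 2 / M)). pose proof (Rmin_r r2 (d / 2 / M)). unfold r. lra. }
  assert (Hr : (0 < r)%R).
  { unfold r. repeat apply Rmin_case; auto. apply Rdiv_lt_0_compat; lra. }
  split; [exact Hr|]. intros s Hs.
  assert (Pair : forall p q, admissible_pair S' p q = true -> admissible_pair S p q = true).
  { intros p q. destruct p as [f|], q as [g|]; unfold admissible_pair; auto.
    - rewrite !Bool.andb_true_iff. intros [[Sf Sg] N]. repeat split; auto; now apply HS.
    - rewrite !Bool.andb_true_iff, !existsb_exists. intros [Sf [g [I Q]]].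
      apply Bool.andb_true_iff in Q. destruct Q as [Sg Q]. split; [now apply HS|].
      exists g. split; [exact I|]. apply Bool.andb_true_iff. split; [now apply HS|exact Q].
    - rewrite !Bool.andb_true_iff, !existsb_exists. intros [Sf [g' [I Q]]].
      apply Bool.andb_true_iff in Q. destruct Q as [Sg Q]. split; [now apply HS|].
      exists g'. split; [exact I|]. apply Bool.andb_true_iff. split; [now apply HS|exact Q]. }
  constructor.
  - intros x Lx.
    assert (T : (Cmod (tjet (shifted v A r s) 0 x - tjet v 0 z) < d)%R).
    { simpl. fold (xt x).
      replace (tjet v 0 x + s * xt x - tjet v 0 z) with ((tjet v 0 x - tjet v 0 z) + s * xt x) by ring.
      eapply Rle_lt_trans; [apply Cmod_triangle|]. rewrite Cmod_mult.
      assert (B1 : (Cmod (tjet v 0 x - tjet v 0 z) < d / 2)%R) by (apply H1; lra).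
      assert (B2 : (Cmod (xt x) <= M)%R).
      { assert (B : (Cmod (xt x - xt z) < 1)%R) by (apply H2; rewrite Cmod_RtoC_minus; lra).
        pose proof (Cmod_sub_triangle (xt x) (xt z)). unfold M. lra. }
      assert (B3 : (Cmod s * Cmod (xt x) <= d / 2)%R).
      { apply Rle_trans with (d / 2 / M * M)%R; [|right; field; lra].
        apply Rmult_le_compat; auto using Cmod_ge_0. lra. }
      lra. }
    destruct (H (sp v SU) (tjet (shifted v A r s) 0 x)) as [It [_ O]]; [now apply Cmod_self|exact T|].
    constructor.
    + simpl. intros f w _ L. exists (r - Cmod (w - sp v f))%R. split; [lra|]. intros w' L'.
      replace (w' - sp v f) with ((w' - w) + (w - sp v f)) by ring.
      eapply Rle_lt_trans; [apply Cmod_triangle|]. lra.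
    + simpl. intros. now apply Cmod_self.
    + simpl. intros f w Sf L i k. destruct (HS f Sf) as [Sf' Cp].
      assert (Gw : good S (at_ v f w) x) by (apply H0; lra).
      assert (dom v f w) by (pose proof (good_sp _ _ _ Gw f Sf') as D; simpl in D; now rewrite upd_same in D).
      destruct (good_jet _ _ _ (G x) f w Sf' H3 i k) as [J1 J2].
      pose proof (adm_D_x_iter S k _ (adm_bracket S _ _ Cp)) as Ak.
      split.
      * apply D_at_plus; [exact J1|]. apply D_at_scal.
        apply (D_s_den_at S v x f w _ Gw (adm_D_s_iter S f i _ Ak)).
      * apply D_at_plus; [exact J2|]. apply D_at_scal.
        eapply D_at_val; [apply (D_x_den S (at_ v f w) x _ Gw (adm_D_s_iter S f i _ Ak))|].
        now apply (D_x_D_s_iter S).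
    + simpl. intros k. apply D_at_plus; [apply (good_tau _ _ _ (G x))|]. apply D_at_scal.
      apply (D_x_den S v x _ (G x)), adm_D_x_iter, adm_bracket, HT.
    + exact It.
    + simpl. apply (good_test _ _ _ (G x)).
    + intros p q Ap. specialize (O p q (Pair p q Ap)). rewrite !pt_upd_id in O. exact O.
  - intros x Lx. change (tau_ F x + s * tau_ X x = tjet v 0 x + s * den (val v x) (bracket_ A (GT SU))).
    now rewrite F_tau, (X_tau x SU HT).
  - intros x f w Lx Sf Lw. simpl in Lw. destruct (HS f Sf) as [Sf' Cp].
    assert (Gw : forall y, (Rabs (y - z) < r)%R -> good S (at_ v f w) y) by (intros; apply H0; lra).
    change (e_ F w x + s * e_ X w x
      = jet v f 0 0 w x + s * den (val (at_ v f w) x) (bracket_ A (GE f))).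
    rewrite (X_e z r f w x Cp Gw Lx).
    rewrite (F_e x f); [reflexivity|exact Sf'|].
    pose proof (good_sp _ _ _ (Gw x Lx) f Sf') as D. simpl in D. now rewrite upd_same in D.
Qed.

Lemma val_shifted_0 r z a : val (shifted v A r 0) z a = val v z a.
Proof.
  destruct a; simpl; auto; try ring. f_equal. ring.
Qed.

Lemma D_affine (a b : C) : DC (fun s => a + s * b) 0 b.
Proof.
  eapply D_at_val; [apply D_at_plus; [apply D_at_const|apply D_at_mult; [apply D_at_id|apply D_at_const]]|].
  cbv beta. ring.
Qed.

(** Along the moved fields all jets are affine in [s], with slope [vary A]; only
    the values of [Rho] depend on [s] through the modulus. *)
Lemma D_shifted r z p : adm S p ->
  DC (fun s => den (val (shifted v A r s) z) p) 0 (den (val v z) (deriv (vary A) p)).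
Proof.
  intros Ap. eapply D_at_val; [|apply den_val_ext; intros; apply (val_shifted_0 r)].
  apply (D_den (fun s => s) (fun s => val (shifted v A r s) z) 0 (vary A) p).
  eapply all_atoms_impl; [|exact Ap].
  intros a Ha. rewrite (den_val_ext _ (val v z) (vary A a)) by (intros; apply val_shifted_0).
  destruct a as [f i k|k|p' q' i k|n k| |].
  - unfold val at 1, shifted. cbn [jet sp].
    rewrite (den_val_ext (val v z) (val (at_ v f (sp v f)) z)) by (intros; symmetry; apply val_upd_id).
    apply D_affine.
  - apply D_affine.
  - simpl vary. den_visible. unfold val at 1, shifted. cbn [sp tjet].
    change (den (val v z) (At (AR p' q' i (Datatypes.S k)))) with
      (Rho i (Datatypes.S k) (pt (sp v) p' - pt (sp v) q') (tjet v 0 z)).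
    rewrite Cmult_comm.
    apply (D_at_comp (fun s => s) (fun t => Rho i k (pt (sp v) p' - pt (sp v) q') t)
      (fun s => tjet v 0 z + s * den (val v z) (vary A (AT 0)))).
    + replace (tjet v 0 z + 0 * _) with (tjet v 0 z) by ring.
      apply D_Rho_tau; [apply (good_Im _ _ _ (G z))|apply (good_off _ _ _ (G z)), Ha].
    + apply D_affine.
  - exact (D_at_const (fun s => s) (xjet v n k z) 0).
  - exact (D_at_const (fun s => s) (lam v) 0).
  - exact (D_at_const (fun s => s) P2i 0).
Qed.

Lemma active_spec B C' f : compatible S A B = true -> compatible S A C' = true ->
  compatible S B C' = true -> active B C' f = true -> S f = true /\ compatible S A (GE f) = true.
Proof.
  unfold active. intros H1 H2 H3 Q. apply Bool.orb_true_iff in Q.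
  assert (K : forall B, compatible S A B = true -> match B with GE g => slot_eqb f g | GT _ => false end = true ->
    S f = true /\ compatible S A (GE f) = true).
  { intros [n|g] Cp E1; [discriminate|]. apply slot_eqb_spec in E1. subst g. split; [|exact Cp].
    destruct A; simpl in Cp; [exact Cp|]. rewrite !Bool.andb_true_iff in Cp. tauto. }
  destruct Q as [Q|Q]; [apply (K B)|apply (K C')]; auto.
Qed.

Lemma compatible_active B C' : compatible S B C' = true -> compatible (active B C') B C' = true.
Proof.
  unfold active. destruct B as [n|f], C' as [m|g]; simpl; auto;
    rewrite ?(proj2 (slot_eqb_spec f f) eq_refl), ?(proj2 (slot_eqb_spec g g) eq_refl); auto.
  rewrite !Bool.orb_true_r. rewrite !Bool.andb_true_iff. tauto.
Qed.

Lemma ext_bracket_den B C' z : compatible S A B = true -> compatible S A C' = true ->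
  compatible S B C' = true ->
  ext_bracket (elliptic_bracket (lam v)) (realize v A) (xjet v (slot_of A) 0)
    (gen_bracket (elliptic_bracket (lam v)) (realize v B) (realize v C') (xjet v (slot_of B) 0)) F z
  = den (val v z) (deriv (vary A) (bracket_ B C')).
Proof.
  intros H1 H2 H3. apply DC_unique.
  destruct (shifted_good (active B C') z) as [r [Hr H]].
  - intros f. now apply active_spec.
  - now apply (compatible_T S A SU B).
  - apply D_at_ext_loc with (f := fun s => den (val (shifted v A r s) z) (bracket_ B C')) (d := r);
      [exact Hr| |apply D_shifted, adm_bracket, H3].
    intros s L. symmetry. replace (s - 0) with s in L by ring.
    change (lam v) with (lam (shifted v A r s)).
    change (realize v) with (realize (shifted v A r s)).
    change (xjet v) with (xjet (shifted v A r s)).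
    apply (gen_bracket_den (active B C') _ _ z r (H s L) B C' Hr (compatible_active _ _ H3)).
Qed.

Lemma double_bracket_den B C' : compatible S A B = true -> compatible S A C' = true ->
  compatible S B C' = true ->
  double_bracket (elliptic_bracket (lam v)) (realize v A) (realize v B) (realize v C')
    (xjet v (slot_of A) 0) (xjet v (slot_of B) 0) (xjet v (slot_of C') 0) F
  = loop_int (fun z => den (val v z) (double_ A B C')).
Proof.
  intros. apply loop_int_ext. intros z. rewrite ext_bracket_den by assumption. reflexivity.
Qed.

End Variation.

(** * The elliptic bracket is a Poisson structure *)

Record describes (S : slot -> bool) (v : env) (F : fields) : Prop := Describes {
  desc_good : forall x, good S v x;
  desc_tau : forall x, tau_ F x = tjet v 0 x;
  desc_e : forall x f w, S f = true -> dom v f w -> e_ F w x = jet v f 0 0 w x;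
  desc_periodic : forall x a, admissible S a = true -> val v (x + 1) a = val v x a }.

Lemma DR_periodic (f g : R -> C) : (forall x, DR f x (g x)) ->
  (forall x, f (x + 1)%R = f x) -> forall x, g (x + 1)%R = g x.
Proof.
  intros D P x. rewrite <- (DR_unique _ _ _ (D x)). symmetry. apply DR_unique.
  apply D_at_ext with (f := fun y => f (y + 1)%R); [exact P|].
  intros eps He. destruct (D (x + 1)%R eps He) as [d [Hd H]]. exists d. split; [exact Hd|].
  intros y L. replace (RtoC y - RtoC x) with (RtoC (y + 1) - RtoC (x + 1)) in *
    by (rewrite !RtoC_plus; ring).
  now apply H.
Qed.

Lemma smooth_loop_jets f : smooth_loop f -> exists J : nat -> R -> C, f = J 0%nat /\
  (forall n x, DR (J n) x (J (Datatypes.S n) x)) /\ (forall n x, J n (x + 1)%R = J n x).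
Proof.
  intros [P [J [J0 JD]]]. exists J.
  assert (D : forall n x, DR (J n) x (J (Datatypes.S n) x)) by (intros; apply is_derive_DR, JD).
  split; [apply functional_extensionality; intros; symmetry; apply J0|split; [exact D|]].
  intros n. induction n; intros x.
  - rewrite !J0. apply P.
  - apply (DR_periodic (J n)); auto.
Qed.

(** Only [e] itself is assumed to be periodic; its jets inherit periodicity by
    differentiation, in the loop variable first and then in the parameter. *)
Lemma smooth_spectral_jets U e : open U -> smooth_spectral U e ->
  exists J : nat -> nat -> C -> R -> C,
    (forall u x, U u -> e u x = J 0%nat 0%nat u x) /\
    (forall u x, U u -> valid_jet J u x) /\
    (forall i k u x, U u -> J i k u (x + 1)%R = J i k u x).
Proof.
  intros HU [P [J [J0 JD]]]. exists J.
  assert (V : forall u x, U u -> valid_jet J u x).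
  { intros u x Hu i k. split; [apply is_derive_DC|apply is_derive_DR]; now apply JD. }
  split; [intros; symmetry; auto|split; [exact V|]].
  assert (K : forall k u x, U u -> J 0%nat k u (x + 1)%R = J 0%nat k u x).
  { induction k; intros u x Hu.
    - rewrite !J0 by exact Hu. now apply P.
    - apply (DR_periodic (J 0%nat k u)); auto. intros y. now apply V. }
  induction i; intros k u x Hu; [now apply K|].
  destruct (proj1 (locally_C_Cmod U u) (HU u Hu)) as [d [Hd O]].
  apply (DC_unique2 (fun w => J i k w (x + 1)%R) u); [now apply V|].
  apply D_at_ext_loc with (f := fun w => J i k w x) (d := d); [exact Hd| |now apply V].
  intros w L. symmetry. now apply IHi, O.
Qed.

Lemma description (lambda : C) U F S s (phi : slot -> R -> C) :
  open U -> field_point U F -> (forall f, U (s f) \/ S f = false) -> (forall n, smooth_loop (phi n)) ->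
  (forall x p q, admissible_pair S p q = true -> ~ period_lattice (tau_ F x) (pt s p - pt s q)) ->
  exists v, sp v = s /\ lam v = lambda /\ (forall n, xjet v n 0%nat = phi n) /\ describes S v F.
Proof.
  intros HU [Ht [It He]] Hs Hphi Off.
  destruct (smooth_loop_jets _ Ht) as [T [T0 [TD TP]]].
  destruct (smooth_spectral_jets U _ HU He) as [J [J0 [JD JP]]].
  destruct (smooth_loop_jets _ (Hphi SU)) as [XU [U0 [UD UP]]].
  destruct (smooth_loop_jets _ (Hphi SV)) as [XV [V0 [VD VP]]].
  destruct (smooth_loop_jets _ (Hphi SW)) as [XW [W0 [WD WP]]].
  exists (Env s (fun _ => U) (fun _ => J) T (fun n => match n with SU => XU | SV => XV | SW => XW end) lambda).
  split; [reflexivity|split; [reflexivity|split; [intros []; auto|]]].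
  assert (Us : forall f, S f = true -> U (s f)).
  { intros f Sf. destruct (Hs f); [assumption|congruence]. }
  constructor; simpl; auto.
  - intros x. constructor; simpl; auto.
    + intros _ w _ Hw. exact (proj1 (locally_C_Cmod U w) (HU w Hw)).
    + rewrite <- T0. apply It.
    + intros []; auto.
    + intros p q A. rewrite <- T0. apply off_lattice_iff, Off, A.
  - intros x. now rewrite T0.
  - intros x [f i k|k|p q i k|n k| |] A; simpl in *; auto.
    + now rewrite TP.
    + destruct n; auto.
Qed.

Lemma loop_int_exact S v F p : describes S v F -> adm S p ->
  loop_int (fun x => den (val v x) (Dx p)) = 0.
Proof.
  intros [G _ _ P] A. apply loop_int_derivative with (H := fun x => den (val v x) p).
  - intros x. now apply (D_x_den S).
  - intros x. eexists. now apply (D_x_den S), adm_Dx.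
  - apply den_ext. eapply all_atoms_impl; [|exact A]. intros a Ha.
    rewrite <- (P 0%R a Ha). now rewrite Rplus_0_l.
Qed.

Definition jacobi_sum (br : bracket) A B C' a b c F : C :=
  double_bracket br A B C' a b c F + double_bracket br B C' A b c a F
  + double_bracket br C' A B c a b F.

Lemma jacobi_sum_rotate br A B C' a b c F :
  jacobi_sum br A B C' a b c F = 0 -> jacobi_sum br B C' A b c a F = 0.
Proof. unfold jacobi_sum. intros <-. ring. Qed.

Lemma jacobi_of_identity S v F A B C' p : describes S v F ->
  (compatible S A B && compatible S B C' && compatible S C' A
   && compatible S A C' && compatible S B A && compatible S C' B)%bool = true ->
  (admb S p && admb S (double_ A B C') && admb S (double_ B C' A) && admb S (double_ C' A B))%bool = true ->
  (forall z, den (val v z) (jacobiator A B C') = den (val v z) (Dx p)) ->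
  jacobi_sum (elliptic_bracket (lam v)) (realize v A) (realize v B) (realize v C')
    (xjet v (slot_of A) 0) (xjet v (slot_of B) 0) (xjet v (slot_of C') 0) F = 0.
Proof.
  intros D Cp Ad E1. rewrite !Bool.andb_true_iff in Cp.
  destruct Cp as [[[[[? ?] ?] ?] ?] ?].
  apply Bool.andb_true_iff in Ad as [Ad A3]. apply Bool.andb_true_iff in Ad as [Ad A2].
  apply Bool.andb_true_iff in Ad as [A0 A1].
  apply admb_adm in A0, A1, A2, A3. pose proof D as [G Ft Fe _].
  assert (K : forall r, adm S r -> forall x, exists l, DR (fun y => den (val v y) r) x l).
  { intros r Ar x. eexists. now apply (D_x_den S). }
  unfold jacobi_sum. rewrite !(double_bracket_den S v F) by assumption.
  rewrite <- !loop_int_plus; auto.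
  - rewrite <- (loop_int_exact S v F p D A0). apply loop_int_ext. intros z. rewrite <- E1. reflexivity.
  - intros x. apply (K (double_ A B C' + double_ B C' A)%dp). now split.
Qed.

(** The value at [Tau] is arbitrary. *)
Definition spectral (A : generator) : C := match A with Tau => 0 | E u => u end.

Definition formal (A : generator) (f : slot) : gen := match A with Tau => GT f | E _ => GE f end.

Definition place {T} (a b c : T) (f : slot) : T := match f with SU => a | SV => b | SW => c end.

Definition is_e (A : generator) : bool := match A with Tau => false | E _ => true end.

Lemma lattice_opp tau z : period_lattice tau (- z) -> period_lattice tau z.
Proof.
  intros [a [b H]]. exists (- a)%Z, (- b)%Z. unfold int_C in *. rewrite !opp_IZR, !RtoC_opp.
  replace z with (- - z) by ring. rewrite H. ring.
Qed.

Lemma away_differences F A B C' S :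
  (away_from_poles F A B /\ away_from_poles F B C' /\ away_from_poles F C' A) ->
  S = place (is_e A) (is_e B) (is_e C') ->
  forall x p q, admissible_pair S p q = true ->
    ~ period_lattice (tau_ F x) (pt (place (spectral A) (spectral B) (spectral C')) p
      - pt (place (spectral A) (spectral B) (spectral C')) q).
Proof.
  intros (H1 & H2 & H3) -> x p q Ad L.
  assert (K : forall a b, period_lattice (tau_ F x) (a - b) -> period_lattice (tau_ F x) (b - a)).
  { intros a b Hab. apply lattice_opp. now replace (- (b - a)) with (a - b) by ring. }
  assert (K0 : forall a, period_lattice (tau_ F x) (a - 0) -> period_lattice (tau_ F x) a).
  { intros a. now replace (a - 0) with a by ring. }
  assert (K1 : forall a, period_lattice (tau_ F x) (0 - a) -> period_lattice (tau_ F x) a) by auto.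
  destruct A as [|u], B as [|v], C' as [|w]; simpl in H1, H2, H3;
    try specialize (H1 x); try specialize (H2 x); try specialize (H3 x);
    destruct p as [[]|], q as [[]|]; simpl in Ad, L; try discriminate Ad;
    intuition eauto.
Qed.

Lemma jacobi_configuration lambda U F A B C' a b c p :
  open U -> field_point U F -> in_spectral_domain U A -> in_spectral_domain U B ->
  in_spectral_domain U C' -> away_from_poles F A B -> away_from_poles F B C' ->
  away_from_poles F C' A -> smooth_loop a -> smooth_loop b -> smooth_loop c ->
  let S := place (is_e A) (is_e B) (is_e C') in
  let A' := formal A SU in let B' := formal B SV in let C'' := formal C' SW in
  (compatible S A' B' && compatible S B' C'' && compatible S C'' A'
   && compatible S A' C'' && compatible S B' A' && compatible S C'' B')%bool = true ->
  (admb S p && admb S (double_ A' B' C'') && admb S (double_ B' C'' A') && admb S (double_ C'' A' B'))%bool = true ->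
  (forall v z, (forall x, good S v x) ->
     den (val v z) (jacobiator A' B' C'') = den (val v z) (Dx p)) ->
  jacobi_sum (elliptic_bracket lambda) A B C' a b c F = 0.
Proof.
  intros HU HF HA HB HC D1 D2 D3 Ha Hb Hc S A' B' C'' Cp Ad I.
  destruct (description lambda U F S (place (spectral A) (spectral B) (spectral C')) (place a b c) HU HF)
    as [v [Hs [Hl [Hx D]]]].
  - intros []; [destruct A|destruct B|destruct C']; simpl in *; auto.
  - intros []; assumption.
  - now apply away_differences.
  - pose proof (jacobi_of_identity S v F A' B' C'' p D Cp Ad) as J.
    assert (RA : realize v A' = A) by (destruct A; simpl; rewrite ?Hs; reflexivity).
    assert (RB : realize v B' = B) by (destruct B; simpl; rewrite ?Hs; reflexivity).
    assert (RC : realize v C'' = C') by (destruct C'; simpl; rewrite ?Hs; reflexivity).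
    assert (SA : slot_of A' = SU) by (destruct A; reflexivity).
    assert (SB : slot_of B' = SV) by (destruct B; reflexivity).
    assert (SC : slot_of C'' = SW) by (destruct C'; reflexivity).
    rewrite RA, RB, RC, SA, SB, SC, Hl, !Hx in J. apply J. intros z. apply I, D.
Qed.

Ltac configuration :=
  match goal with
  | |- _ = true => vm_compute; reflexivity
  | |- forall _, _ => idtac
  | |- _ => first [assumption | exact I]
  end.

Lemma elliptic_jacobi lambda : jacobi (elliptic_bracket lambda) away_from_poles.
Proof.
  intros U F A B C' a b c HU HF HA HB HC D1 D2 D3 Ha Hb Hc.
  change (jacobi_sum (elliptic_bracket lambda) A B C' a b c F = 0).
  assert (TTT : forall a b c, smooth_loop a -> smooth_loop b -> smooth_loop c ->
    jacobi_sum (elliptic_bracket lambda) Tau Tau Tau a b c F = 0).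
  { intros. apply (jacobi_configuration lambda U F Tau Tau Tau a0 b0 c0
      (primitive SW (jacobiator (GT SU) (GT SV) (GT SW)))); configuration.
    intros. apply (identical_correct _ _ jacobiator_TTT). }
  assert (ETT : forall u a b c, U u -> smooth_loop a -> smooth_loop b -> smooth_loop c ->
    jacobi_sum (elliptic_bracket lambda) (E u) Tau Tau a b c F = 0).
  { intros. apply (jacobi_configuration lambda U F (E u) Tau Tau a0 b0 c0
      (primitive SW (jacobiator (GE SU) (GT SV) (GT SW)))); configuration.
    intros. apply (identical_correct _ _ jacobiator_ETT). }
  assert (EET : forall u v a b c, U u -> U v -> away_from_poles F (E u) (E v) ->
    smooth_loop a -> smooth_loop b -> smooth_loop c ->
    jacobi_sum (elliptic_bracket lambda) (E u) (E v) Tau a b c F = 0).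
  { intros. apply (jacobi_configuration lambda U F (E u) (E v) Tau a0 b0 c0
      (primitive SW (jacobiator (GE SU) (GE SV) (GT SW)))); configuration.
    intros. apply (identical_correct _ _ jacobiator_EET). }
  destruct A as [|u], B as [|v], C' as [|w]; simpl in HA, HB, HC; auto.
  - now apply jacobi_sum_rotate, ETT.
  - now apply jacobi_sum_rotate, jacobi_sum_rotate, ETT.
  - now apply jacobi_sum_rotate, jacobi_sum_rotate, EET.
  - now apply jacobi_sum_rotate, EET.
  - set (j := jacobiator (GE SU) (GE SV) (GE SW)).
    apply (jacobi_configuration lambda U F (E u) (E v) (E w) a b c
      (primitive SW (j - jacobians)%dp)); configuration.
    intros v' z G. unfold formal. rewrite (identical_correct _ _ jacobiator_EEE). fold j.
    change (den (val v' z) jacobians + den (val v' z) (Dx (primitive SW (j - jacobians)%dp))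
      = den (val v' z) (Dx (primitive SW (j - jacobians)%dp))).
    rewrite jacobians_zero; [apply Cplus_0_l|].
    replace every_slot with (place true true true) by (apply functional_extensionality; intros []; reflexivity).
    exact G.
Qed.

Lemma anticommutative_configuration lambda U F A B a b p :
  open U -> field_point U F -> in_spectral_domain U A -> in_spectral_domain U B ->
  away_from_poles F A B -> smooth_loop a -> smooth_loop b ->
  let S := place (is_e A) (is_e B) false in
  let A' := formal A SU in let B' := formal B SV in
  (compatible S A' B' && compatible S B' A')%bool = true ->
  admb S p = true ->
  (forall v z, den (val v z) (at_x SV 0 * bracket_ A' B' + at_x SU 0 * bracket_ B' A')%dp
     = den (val v z) (Dx p)) ->
  loop_int (fun y => b y * gen_bracket (elliptic_bracket lambda) A B a F y) =
  - loop_int (fun x => a x * gen_bracket (elliptic_bracket lambda) B A b F x).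
Proof.
  intros HU HF HA HB D1 Ha Hb S A' B' Cp Ad I.
  apply Bool.andb_true_iff in Cp as [C1 C2]. apply admb_adm in Ad.
  destruct (description lambda U F S (place (spectral A) (spectral B) 0) (place a b a) HU HF)
    as [v [Hs [Hl [Hx D]]]].
  - intros []; [destruct A|destruct B|]; simpl in *; auto.
  - intros []; assumption.
  - apply (away_differences F A B Tau); [|reflexivity]. destruct A, B; simpl in *; auto.
  - pose proof D as [G Ft Fe _].
    assert (RA : realize v A' = A) by (destruct A; simpl; rewrite ?Hs; reflexivity).
    assert (RB : realize v B' = B) by (destruct B; simpl; rewrite ?Hs; reflexivity).
    assert (SA : slot_of A' = SU) by (destruct A; reflexivity).
    assert (SB : slot_of B' = SV) by (destruct B; reflexivity).
    assert (R : forall z, represents S v F z 1) by (intros; constructor; auto).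
    assert (KA : forall z, gen_bracket (elliptic_bracket lambda) A B a F z = den (val v z) (bracket_ A' B')).
    { intros z. rewrite <- (gen_bracket_den S v F z 1 (R z) A' B') by (auto; lra).
      now rewrite RA, RB, SA, Hl, Hx. }
    assert (KB : forall z, gen_bracket (elliptic_bracket lambda) B A b F z = den (val v z) (bracket_ B' A')).
    { intros z. rewrite <- (gen_bracket_den S v F z 1 (R z) B' A') by (auto; lra).
      now rewrite RA, RB, SB, Hl, Hx. }
    rewrite (loop_int_ext _ (fun z => den (val v z) (at_x SV 0 * bracket_ A' B')%dp))
      by (intros z; rewrite KA; change b with (place a b a SV); now rewrite <- Hx).
    rewrite (loop_int_ext (fun x => a x * _) (fun z => den (val v z) (at_x SU 0 * bracket_ B' A')%dp))
      by (intros z; rewrite KB; change a with (place a b a SU) at 1; now rewrite <- Hx).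
    assert (K : forall r, adm S r -> forall x, exists l, DR (fun y => den (val v y) r) x l).
    { intros r Ar x. eexists. now apply (D_x_den S). }
    set (i1 := loop_int _). set (i2 := loop_int _).
    assert (Z : i1 + i2 = 0).
    { unfold i1, i2. rewrite <- loop_int_plus.
      - rewrite <- (loop_int_exact S v F p D Ad). apply loop_int_ext. intros z. rewrite <- I. reflexivity.
      - apply K. split; [exact eq_refl|]. now apply adm_bracket.
      - apply K. split; [exact eq_refl|]. now apply adm_bracket. }
    replace i1 with (i1 + i2 - i2) by ring. rewrite Z. ring.
Qed.

Lemma elliptic_anticommutative lambda : anticommutative (elliptic_bracket lambda) away_from_poles.
Proof.
  intros U F A B a b HU HF HA HB D Ha Hb.
  assert (ET : forall u a b, U u -> smooth_loop a -> smooth_loop b ->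
    loop_int (fun y => b y * gen_bracket (elliptic_bracket lambda) (E u) Tau a F y) =
    - loop_int (fun x => a x * gen_bracket (elliptic_bracket lambda) Tau (E u) b F x)).
  { intros. apply (anticommutative_configuration lambda U F (E u) Tau a0 b0
      (primitive SV (at_x SV 0 * bracket_ (GE SU) (GT SV) + at_x SU 0 * bracket_ (GT SV) (GE SU))%dp)); configuration.
    intros. apply (identical_correct _ _ anticommutator_ET). }
  destruct A as [|u], B as [|v].
  - apply (anticommutative_configuration lambda U F Tau Tau a b
      (primitive SV (at_x SV 0 * bracket_ (GT SU) (GT SV) + at_x SU 0 * bracket_ (GT SV) (GT SU))%dp)); configuration.
    intros. apply (identical_correct _ _ anticommutator_TT).
  - rewrite (ET v b a); auto. ring.
  - now apply ET.
  - apply (anticommutative_configuration lambda U F (E u) (E v) a b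
      (primitive SV (at_x SV 0 * bracket_ (GE SU) (GE SV) + at_x SU 0 * bracket_ (GE SV) (GE SU))%dp)); configuration.
    intros. apply (identical_correct _ _ anticommutator_EE).
Qed.

Theorem theorem1 (lambda : C) :
  poisson_structure (elliptic_bracket lambda) away_from_poles.
Proof. split; [apply elliptic_anticommutative|apply elliptic_jacobi]. Qed.
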